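(* Let $n\ge 1$. There exists an isomorphism of abelian groups $\gamma_n: K(\mathcal O^n)\to {}^{\mathbb Z}V_{\rm sp}^{\otimes n}$ given by $$\gamma_n([M(a_1,\dots,a_n)])=v_{a_1}\otimes v_{a_2}\otimes\cdots\otimes v_{a_n}$$ for every sequence $(a_1,\dots,a_n)\in[0,7]^n$. Moreover, for every $[\mathbf d]\in\widetilde{\mathbf D}$, the restriction of $\gamma_n$ to $K(\mathcal O_{[\mathbf d]})$ is an isomorphism of abelian groups between $K(\mathcal O_{[\mathbf d]})$ and ${}^{\mathbb Z}(V_{\rm sp}^{\otimes n})_{[\mathbf d]}$.
   Context: All Lie algebras and modules are over $\mathbb C$. $V_{\rm sp}=\bigoplus_{i=0}^7\mathbb C v_i$ is the 8-dimensional space underlying the spin representation of $U(\mathfrak{so}(7,\mathbb C))$, with basis $v_0,\dots,v_7$. $[0,7]=\{0,1,\dots,7\}$. Fix $n\ge1$ and the standard triangular decomposition $\mathfrak{gl}_n=\mathfrak n_+\oplus\mathfrak h\oplus\mathfrak n_-$. $\varepsilon_1,\dots,\varepsilon_n$ is the standard basis of $\mathfrak h^*$, the positive roots are $\varepsilon_i-\varepsilon_j$ ($i<j$), $\rho=\frac{n-1}{2}\varepsilon_1+\frac{n-3}{2}\varepsilon_2+\cdots+\frac{1-n}{2}\varepsilon_n$ is the half-sum of positive roots. $\mathcal O(\mathfrak{gl}_n)$ is the BGG category $\mathcal O$ for this decomposition. For $\lambda\in\mathfrak h^*$, $\theta_\lambda: Z(U(\mathfrak{gl}_n))\to\mathbb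 C$ is the central character of the Verma module with highest weight $\lambda$. For a central character $\theta$, $\mathcal O_\theta(\mathfrak{gl}_n)$ is the full subcategory of modules $M\in\mathcal O(\mathfrak{gl}_n)$ such that for each $m\in M$ and each $z\in Z(U(\mathfrak{gl}_n))$, $(z-\theta(z))^N m=0$ for some $N$. For $(a_1,\dots,a_n)\in[0,7]^n$, $M(a_1,\dots,a_n)$ is the Verma module with highest weight $a_1\varepsilon_1+\cdots+a_n\varepsilon_n-\rho$. $K(\mathcal A)$ is the Grothendieck group of an abelian category $\mathcal A$ and $[M]$ is the class of $M$. $\mathbf D$ is the set of 8-tuples $\mathbf d=(d_0,\dots,d_7)$ of nonnegative integers with $\sum_k d_k=n$. The equivalence relation $\sim$ on $\mathbf D$: $\mathbf d\sim\mathbf d'$ iff the three quantities $d_7+d_6+d_5+d_4-d_3-d_2-d_1-d_0$, $d_7+d_6-d_5-d_4+d_3+d_2-d_1-d_0$, $d_7-d_6+d_5-d_4+d_3-d_2+d_1-d_0$ agree for $\mathbf d$ and $\mathbf d'$. $[\mathbf d]$ is the class of $\mathbf d$ and $\widetilde{\mathbf D}$ the set of classes. ${}^{\mathbb Z}(V_{\rm sp}^{\otimes n})_{[\mathbf d]}$ is the $\mathbb Z$-submodule of $V_{\rm sp}^{\otimes n}$ spanned by all $v_{a_1}\otimes\cdots\otimes v_{a_n}$ with $(a_1,\dots,a_n)\in[0,7]^n$ such that for some $\mathbf d'\in[\mathbf d]$, $\#\{m: a_m=k\}=d'_k$ for all $0\le k\le7$. ${}^{\mathbb Z}V_{\rm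 sp}^{\otimes n}=\bigoplus_{[\mathbf d]\in\widetilde{\mathbf D}}{}^{\mathbb Z}(V_{\rm sp}^{\otimes n})_{[\mathbf d]}$. For $\mathbf d\in\mathbf D$ let $\lambda_{\mathbf d}=\sum_{i=0}^7\sum_{j=1}^{d_i} i\,\varepsilon_{d_0+\cdots+d_{i-1}+j}$ and $\theta_{\mathbf d}=\theta_{\lambda_{\mathbf d}-\rho}$. Put $\mathcal O_{\mathbf d}=\mathcal O_{\theta_{\mathbf d}}(\mathfrak{gl}_n)$, $\mathcal O_{[\mathbf d]}=\bigoplus_{\mathbf d'\in[\mathbf d]}\mathcal O_{\mathbf d'}$, $\mathcal O^n=\bigoplus_{[\mathbf d]\in\widetilde{\mathbf D}}\mathcal O_{[\mathbf d]}$. *)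

(* Defs.v *)
From HB Require Import structures.
From mathcomp Require Import all_boot all_order all_algebra.
From mathcomp Require Import boolp classical_sets reals.
From mathcomp Require Import complex.

Set Implicit Arguments.
Unset Strict Implicit.
Unset Printing Implicit Defensive.

Import Order.TTheory GRing.Theory Num.Theory.
Local Open Scope ring_scope.
Local Open Scope quotient_scope.

(* Everything below is written over a field C and is used at C = R[i] with
   R : realType. The Lie algebra gl_n is 'M[C]_n with the commutator. *)

Definition mxbracket (C : fieldType) (n : nat) (x y : 'M[C]_n) : 'M[C]_n :=
  x *m y - y *m x.

(* The positive roots are e_i - e_j with i < j, so n_+ is the space of strictly
   upper triangular matrices and h the space of diagonal ones. *)
Definition in_nplus (C : fieldType) (n : nat) (x : 'M[C]_n) : Prop :=
  forall i j : 'I_n, (j <= i)%N -> x i j = 0.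

Definition in_cartan (C : fieldType) (n : nat) (x : 'M[C]_n) : Prop :=
  is_diag_mx x.

(* A weight is the row of its coordinates in the basis e_1, ..., e_n of h^*. *)
Definition wt_eval (C : fieldType) (n : nat) (lam : 'rV[C]_n) (h : 'M[C]_n) : C :=
  \sum_(i < n) lam 0 i * h i i.

(* U(gl_n): the unital associative C-algebra generated by the vector space gl_n
   subject to x y - y x = [x, y]; [uterm] are the formal expressions in constants
   and elements of gl_n, and [ueq] is the congruence to divide by. *)

Inductive uterm (C : fieldType) (n : nat) : Type :=
| UConst of C
| UGen of 'M[C]_n
| UAdd of uterm C n & uterm C n
| UMul of uterm C n & uterm C n.

Arguments UConst {C n}.
Arguments UGen {C n}.

Inductive ueq (C : fieldType) (n : nat) : uterm C n -> uterm C n -> Prop :=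
| ueq_refl s : ueq s s
| ueq_sym s t : ueq s t -> ueq t s
| ueq_trans s t u : ueq s t -> ueq t u -> ueq s u
| ueq_add s s' t t' : ueq s s' -> ueq t t' -> ueq (UAdd s t) (UAdd s' t')
| ueq_mul s s' t t' : ueq s s' -> ueq t t' -> ueq (UMul s t) (UMul s' t')
| ueq_addA s t u : ueq (UAdd s (UAdd t u)) (UAdd (UAdd s t) u)
| ueq_addC s t : ueq (UAdd s t) (UAdd t s)
| ueq_add0 s : ueq (UAdd (UConst 0) s) s
| ueq_mulA s t u : ueq (UMul s (UMul t u)) (UMul (UMul s t) u)
| ueq_mul1l s : ueq (UMul (UConst 1) s) s
| ueq_mul0l s : ueq (UMul (UConst 0) s) (UConst 0)
| ueq_mulDl s t u : ueq (UMul (UAdd s t) u) (UAdd (UMul s u) (UMul t u))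
| ueq_mulDr s t u : ueq (UMul s (UAdd t u)) (UAdd (UMul s t) (UMul s u))
| ueq_constD a b : ueq (UConst (a + b)) (UAdd (UConst a) (UConst b))
| ueq_constM a b : ueq (UConst (a * b)) (UMul (UConst a) (UConst b))
| ueq_constC a s : ueq (UMul (UConst a) s) (UMul s (UConst a))
| ueq_gen_linear a x y :
    ueq (UGen (a *: x + y)) (UAdd (UMul (UConst a) (UGen x)) (UGen y))
| ueq_gen_bracket x y :
    ueq (UMul (UGen x) (UGen y))
        (UAdd (UMul (UGen y) (UGen x)) (UGen (mxbracket x y))).

HB.instance Definition _ (C : fieldType) (n : nat) := gen_eqMixin (uterm C n).
HB.instance Definition _ (C : fieldType) (n : nat) := gen_choiceMixin (uterm C n).

Section EnvelopingAlgebra.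
Variables (C : fieldType) (n : nat).
Implicit Types s t : uterm C n.

Definition ueqb s t : bool := `[< ueq s t >].

Lemma ueqb_equiv : equiv_class_of ueqb.
Proof.
split=> [s | s t | t s u].
- by apply/asboolP; apply: ueq_refl.
- by apply: asbool_equiv_eq; split; apply: ueq_sym.
- by move=> /asboolP h1 /asboolP h2; apply/asboolP; apply: ueq_trans h1 h2.
Qed.

Canonical ueq_equivrel := EquivRelPack ueqb_equiv.

Definition Ugl : Type := {eq_quot ueqb}.
HB.instance Definition _ := Choice.on Ugl.
HB.instance Definition _ : EqQuotient (uterm C n) ueqb Ugl := EqQuotient.on Ugl.

Definition upi (s : uterm C n) : Ugl := \pi_Ugl s.
Definition urepr (u : Ugl) : uterm C n := repr u.

Lemma ureprK : cancel urepr upi. Proof. exact: reprK. Qed.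

Lemma upiP s t : upi s = upi t <-> ueq s t.
Proof.
split=> [/eqP | h]; first by rewrite /upi piE => /asboolP.
by apply/eqP; rewrite /upi piE; apply/asboolP.
Qed.

Lemma urepr_pi s : ueq (urepr (upi s)) s.
Proof. by apply/upiP; rewrite ureprK. Qed.

Definition u0 : Ugl := upi (UConst 0).
Definition u1 : Ugl := upi (UConst 1).
Definition uadd (a b : Ugl) : Ugl := upi (UAdd (urepr a) (urepr b)).
Definition umul (a b : Ugl) : Ugl := upi (UMul (urepr a) (urepr b)).
Definition uopp (a : Ugl) : Ugl := upi (UMul (UConst (-1)) (urepr a)).
Definition uscale (c : C) (a : Ugl) : Ugl := upi (UMul (UConst c) (urepr a)).

Lemma uadd_pi s t : uadd (upi s) (upi t) = upi (UAdd s t).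
Proof. by apply/upiP; apply: ueq_add; apply: urepr_pi. Qed.
Lemma umul_pi s t : umul (upi s) (upi t) = upi (UMul s t).
Proof. by apply/upiP; apply: ueq_mul; apply: urepr_pi. Qed.
Lemma uscale_pi c s : uscale c (upi s) = upi (UMul (UConst c) s).
Proof. by apply/upiP; apply: ueq_mul (urepr_pi _); apply: ueq_refl. Qed.
Lemma uoppE a : uopp a = uscale (-1) a. Proof. by []. Qed.

Lemma upi_ind (P : Ugl -> Prop) : (forall s, P (upi s)) -> forall u, P u.
Proof. by move=> h u; rewrite -(ureprK u). Qed.

Lemma uaddA : associative uadd.
Proof.
elim/upi_ind=> s; elim/upi_ind=> t; elim/upi_ind=> u; rewrite !uadd_pi.
exact/upiP/ueq_addA.
Qed.
Lemma uaddC : commutative uadd.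
Proof.
by elim/upi_ind=> s; elim/upi_ind=> t; rewrite !uadd_pi; apply/upiP/ueq_addC.
Qed.
Lemma uadd0 : left_id u0 uadd.
Proof. by elim/upi_ind=> s; rewrite uadd_pi; apply/upiP/ueq_add0. Qed.
Lemma uaddN : left_inverse u0 uopp uadd.
Proof.
elim/upi_ind=> s; rewrite uoppE uscale_pi uadd_pi; apply/upiP.
apply: (@ueq_trans _ _ _ (UAdd (UMul (UConst (-1)) s) (UMul (UConst 1) s))).
  apply: ueq_add; [exact: ueq_refl | exact/ueq_sym/ueq_mul1l].
apply: ueq_trans (ueq_sym (ueq_mulDl _ _ _)) _.
apply: ueq_trans (ueq_mul0l s); apply: ueq_mul (ueq_refl _).
by have := @ueq_constD C n (-1) 1; rewrite addNr; apply: ueq_sym.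
Qed.
Lemma umulA : associative umul.
Proof.
elim/upi_ind=> s; elim/upi_ind=> t; elim/upi_ind=> u; rewrite !umul_pi.
exact/upiP/ueq_mulA.
Qed.
Lemma umul1l : left_id u1 umul.
Proof. by elim/upi_ind=> s; rewrite umul_pi; apply/upiP/ueq_mul1l. Qed.
Lemma umul1r : right_id u1 umul.
Proof.
elim/upi_ind=> s; rewrite umul_pi; apply/upiP.
exact: ueq_trans (ueq_sym (ueq_constC _ _)) (ueq_mul1l _).
Qed.
Lemma umulDl : left_distributive umul uadd.
Proof.
elim/upi_ind=> s; elim/upi_ind=> t; elim/upi_ind=> u.
by rewrite !(umul_pi, uadd_pi); apply/upiP/ueq_mulDl.
Qed.
Lemma umulDr : right_distributive umul uadd.
Proof.
elim/upi_ind=> s; elim/upi_ind=> t; elim/upi_ind=> u.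
by rewrite !(umul_pi, uadd_pi); apply/upiP/ueq_mulDr.
Qed.

(* The augmentation, used to see that U(gl_n) is not the zero ring. *)
Fixpoint uaug (s : uterm C n) : C :=
  match s with
  | UConst c => c
  | UGen _ => 0
  | UAdd s t => uaug s + uaug t
  | UMul s t => uaug s * uaug t
  end.

Lemma uaug_ueq s t : ueq s t -> uaug s = uaug t.
Proof.
elim=> {s t} //=.
- by move=> s t u _ -> _ ->.
- by move=> s s' t t' _ -> _ ->.
- by move=> s s' t t' _ -> _ ->.
- by move=> *; rewrite addrA.
- by move=> *; rewrite addrC.
- by move=> *; rewrite add0r.
- by move=> *; rewrite mulrA.
- by move=> *; rewrite mul1r.
- by move=> *; rewrite mul0r.
- by move=> *; rewrite mulrDl.
- by move=> *; rewrite mulrDr.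
- by move=> *; rewrite mulrC.
- by move=> *; rewrite mulr0 addr0.
- by move=> *; rewrite mulr0 addr0.
Qed.

Lemma u1_neq0 : u1 != u0.
Proof.
by apply/eqP => /upiP/uaug_ueq /= /eqP; rewrite oner_eq0.
Qed.

HB.instance Definition _ := GRing.isZmodule.Build Ugl uaddA uaddC uadd0 uaddN.
HB.instance Definition _ := GRing.Zmodule_isNzRing.Build Ugl
  umulA umul1l umul1r umulDl umulDr u1_neq0.

Lemma uscaleA a b (u : Ugl) : uscale a (uscale b u) = uscale (a * b) u.
Proof.
elim/upi_ind: u => s; rewrite !uscale_pi; apply/upiP.
apply: ueq_trans (ueq_mulA _ _ _) _; apply: ueq_mul (ueq_refl _).
exact/ueq_sym/ueq_constM.
Qed.
Lemma uscale1 : left_id 1 uscale.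
Proof. by elim/upi_ind=> s; rewrite uscale_pi; apply/upiP/ueq_mul1l. Qed.
Lemma uscaleDr : right_distributive uscale +%R.
Proof.
move=> a; elim/upi_ind=> s; elim/upi_ind=> t.
by rewrite [_ + _]uadd_pi !uscale_pi [RHS]uadd_pi; apply/upiP/ueq_mulDr.
Qed.
Lemma uscaleDl (u : Ugl) : {morph uscale^~ u : a b / a + b}.
Proof.
elim/upi_ind: u => s a b /=; rewrite !uscale_pi [RHS]uadd_pi; apply/upiP.
apply: ueq_trans (ueq_mulDl _ _ _); apply: ueq_mul (ueq_refl _).
exact: ueq_constD.
Qed.

HB.instance Definition _ :=
  GRing.Zmodule_isLmodule.Build C Ugl uscaleA uscale1 uscaleDr uscaleDl.

Lemma uscaleAl (a : C) (u v : Ugl) : a *: (u * v) = (a *: u) * v.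
Proof.
elim/upi_ind: u => s; elim/upi_ind: v => t.
change (uscale a (umul (upi s) (upi t)) = umul (uscale a (upi s)) (upi t)).
by rewrite umul_pi !uscale_pi umul_pi; apply/upiP/ueq_mulA.
Qed.
Lemma uscaleAr (a : C) (u v : Ugl) : a *: (u * v) = u * (a *: v).
Proof.
elim/upi_ind: u => s; elim/upi_ind: v => t.
change (uscale a (umul (upi s) (upi t)) = umul (upi s) (uscale a (upi t))).
rewrite umul_pi !uscale_pi umul_pi; apply/upiP.
apply: ueq_trans (ueq_mulA _ _ _) _.
apply: ueq_trans (ueq_sym (ueq_mulA _ _ _)).
apply: ueq_mul (ueq_refl _); exact: ueq_constC.
Qed.

HB.instance Definition _ := GRing.Lmodule_isLalgebra.Build C Ugl uscaleAl.
HB.instance Definition _ := GRing.Lalgebra_isAlgebra.Build C Ugl uscaleAr.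

Definition ugen (x : 'M[C]_n) : Ugl := upi (UGen x).

Lemma ugen_linear : linear ugen.
Proof.
move=> a x y; change (upi (UGen (a *: x + y))
  = uadd (uscale a (upi (UGen x))) (upi (UGen y))).
by rewrite uscale_pi uadd_pi; apply/upiP/ueq_gen_linear.
Qed.
HB.instance Definition _ := GRing.isLinear.Build C 'M[C]_n Ugl *:%R ugen ugen_linear.

Lemma ugen_bracket x y : ugen (mxbracket x y) = ugen x * ugen y - ugen y * ugen x.
Proof.
apply/eqP; rewrite eq_sym subr_eq addrC; apply/eqP.
change (umul (upi (UGen x)) (upi (UGen y))
  = uadd (umul (upi (UGen y)) (upi (UGen x))) (upi (UGen (mxbracket x y)))).
by rewrite !umul_pi uadd_pi; apply/upiP/ueq_gen_bracket.
Qed.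

End EnvelopingAlgebra.

Definition Ucentral (C : fieldType) (n : nat) (z : Ugl C n) : Prop :=
  forall u : Ugl C n, z * u = u * z.

Record glmod (C : fieldType) (n : nat) := GlMod {
  glcar :> lmodType C;
  glact : 'M[C]_n -> glcar -> glcar;
  glact_linear : forall x, linear (glact x);
  glact_linearl : forall m, linear (fun x => glact x m);
  glact_bracket : forall x y m,
    glact (mxbracket x y) m = glact x (glact y m) - glact y (glact x m)
}.

Section Modules.
Variables (C : fieldType) (n : nat).
Implicit Types M N : glmod C n.

Definition glhom M N (f : M -> N) : Prop :=
  linear f /\ forall x m, f (glact x m) = glact x (f m).

(* The action of U(gl_n) extending that of gl_n. *)

Fixpoint uterm_act M (s : uterm C n) (m : M) : M :=
  match s with
  | UConst c => c *: m
  | UGen x => glact x m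
  | UAdd s t => uterm_act s m + uterm_act t m
  | UMul s t => uterm_act s (uterm_act t m)
  end.

Definition uact M (u : Ugl C n) (m : M) : M := uterm_act (urepr u) m.

Lemma uterm_act_linear M s : linear (@uterm_act M s).
Proof.
elim: s => [c | x | s IHs t IHt | s IHs t IHt] a x' y /=.
- by rewrite scalerDr !scalerA mulrC.
- exact: glact_linear.
- by rewrite IHs IHt scalerDr addrACA.
- by rewrite IHt IHs.
Qed.

Lemma uterm_act_ueq M s t : ueq s t -> @uterm_act M s =1 uterm_act t.
Proof.
have DE u (x y : M) : uterm_act u (x + y) = uterm_act u x + uterm_act u y.
  by have := uterm_act_linear u 1 x y; rewrite !scale1r.
have ZE u a (x : M) : uterm_act u (a *: x) = a *: uterm_act u x.
  have E0 : uterm_act u (0 : M) = 0.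
    by apply: (addrI (uterm_act u 0)); rewrite -DE !addr0.
  by have := uterm_act_linear u a x 0; rewrite E0 !addr0.
elim=> {s t} //=.
- by move=> s t _ h m; rewrite h.
- by move=> s t u _ h1 _ h2 m; rewrite h1 h2.
- by move=> s s' t t' _ h1 _ h2 m; rewrite h1 h2.
- by move=> s s' t t' _ h1 _ h2 m; rewrite h1 h2.
- by move=> s t u m; rewrite addrA.
- by move=> s t m; rewrite addrC.
- by move=> s m; rewrite scale0r add0r.
- by move=> s m; rewrite scale1r.
- by move=> s m; rewrite !scale0r.
- by move=> s t u m; rewrite DE.
- by move=> a b m; rewrite scalerDl.
- by move=> a b m; rewrite scalerA.
- by move=> a s m; rewrite ZE.
- by move=> a x y m; apply: glact_linearl.
- by move=> x y m; rewrite glact_bracket addrC subrK.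
Qed.

Lemma uact_pi M s (m : M) : uact (upi s) m = uterm_act s m.
Proof. exact: uterm_act_ueq (urepr_pi s) m. Qed.

Lemma uact_gen M x (m : M) : uact (ugen x) m = glact x m.
Proof. exact: uact_pi. Qed.

Lemma uactM M u v (m : M) : uact (u * v) m = uact u (uact v m).
Proof. exact: uact_pi. Qed.

Lemma uactD M u v (m : M) : uact (u + v) m = uact u m + uact v m.
Proof. exact: uact_pi. Qed.

Lemma uactZ M c u (m : M) : uact (c *: u) m = c *: uact u m.
Proof. exact: uact_pi. Qed.

Lemma uact1 M (m : M) : uact 1 m = m.
Proof. by rewrite [LHS]uact_pi /= scale1r. Qed.

(* Verma modules: M(lam) = U / I with I the left ideal generated by n_+ and by
   the h - lam(h) for h in the Cartan subalgebra. *)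

Definition left_ideal (S : Ugl C n -> Prop) : Prop :=
  [/\ S 0, forall u v, S u -> S v -> S (u + v) & forall u v, S v -> S (u * v)].

Definition verma_ideal (lam : 'rV[C]_n) : {pred Ugl C n} := fun u =>
  `[< forall S : Ugl C n -> Prop, left_ideal S ->
      (forall x, in_nplus x -> S (ugen x)) ->
      (forall h, in_cartan h -> S (ugen h - (wt_eval lam h)%:A)) -> S u >].

Lemma verma_idealMl lam u v : v \in verma_ideal lam -> u * v \in verma_ideal lam.
Proof.
move=> /asboolP h; apply/asboolP => S S0 S1 S2.
by case: (S0) => _ _; apply; apply: h.
Qed.

Lemma verma_ideal_zmod lam : zmod_closed (verma_ideal lam).
Proof.
split=> [|u v hu hv].
  by apply/asboolP => S [].
rewrite -mulN1r; move: hu (verma_idealMl (-1) hv) => /asboolP hu /asboolP hNv.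
apply/asboolP => S S0 S1 S2; case: (S0) => _ SD _.
by apply: SD; [apply: hu | apply: hNv].
Qed.

HB.instance Definition _ lam :=
  GRing.isZmodClosed.Build (Ugl C n) (verma_ideal lam) (verma_ideal_zmod lam).

Section Verma.
Variable lam : 'rV[C]_n.

Definition vcar : Type := Quotient.quot (verma_ideal lam).
HB.instance Definition _ := GRing.Zmodule.on vcar.

Definition vpi (u : Ugl C n) : vcar := \pi_(Quotient.quot (verma_ideal lam)) u.
Definition vrepr (v : vcar) : Ugl C n := repr (v : Quotient.quot (verma_ideal lam)).

Lemma vreprK : cancel vrepr vpi. Proof. exact: reprK. Qed.

Lemma vpiP u v : vpi u = vpi v <-> u - v \in verma_ideal lam.
Proof. by rewrite Quotient.idealrBE; split=> /eqP. Qed.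

Lemma vpiD u v : vpi (u + v) = vpi u + vpi v.
Proof. exact: Quotient.pi_add. Qed.

Definition vmul (u : Ugl C n) (v : vcar) : vcar := vpi (u * vrepr v).

Lemma vmul_pi u v : vmul u (vpi v) = vpi (u * v).
Proof.
by apply/vpiP; rewrite -mulrBr; apply: verma_idealMl; apply/vpiP; rewrite vreprK.
Qed.

Lemma vpi_ind (P : vcar -> Prop) : (forall u, P (vpi u)) -> forall v, P v.
Proof. by move=> h v; rewrite -(vreprK v). Qed.

Lemma vmulA u v w : vmul u (vmul v w) = vmul (u * v) w.
Proof. by elim/vpi_ind: w => w; rewrite !vmul_pi mulrA. Qed.
Lemma vmul1 : left_id 1 vmul.
Proof. by elim/vpi_ind => w; rewrite vmul_pi mul1r. Qed.
Lemma vmulDr : right_distributive vmul +%R.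
Proof.
move=> u; elim/vpi_ind=> v; elim/vpi_ind=> w.
by rewrite -vpiD !vmul_pi mulrDr vpiD.
Qed.
Lemma vmulDl w : {morph vmul^~ w : u v / u + v}.
Proof. by elim/vpi_ind: w => w u v; rewrite !vmul_pi mulrDl vpiD. Qed.

Definition vscale (c : C) (v : vcar) : vcar := vmul c%:A v.

Lemma vscaleA a b v : vscale a (vscale b v) = vscale (a * b) v.
Proof. by rewrite /vscale vmulA -scalerAl mul1r scalerA. Qed.
Lemma vscale1 : left_id 1 vscale.
Proof. by move=> v; rewrite /vscale scale1r vmul1. Qed.
Lemma vscaleDr : right_distributive vscale +%R.
Proof. by move=> a; apply: vmulDr. Qed.
Lemma vscaleDl v : {morph vscale^~ v : a b / a + b}.
Proof. by move=> a b; rewrite /vscale scalerDl vmulDl. Qed.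

HB.instance Definition _ :=
  GRing.Zmodule_isLmodule.Build C vcar vscaleA vscale1 vscaleDr vscaleDl.

Definition vact (x : 'M[C]_n) (v : vcar) : vcar := vmul (ugen x) v.

Lemma vscaleE (a : C) (v : vcar) : a *: v = vmul a%:A v. Proof. by []. Qed.

Lemma vact_linear x : linear (vact x).
Proof.
move=> a v w; rewrite /vact vmulDr !vscaleE !vmulA.
by rewrite -scalerAr mulr1 -scalerAl mul1r.
Qed.
Lemma vact_linearl v : linear (fun x => vact x v).
Proof.
move=> a x y; rewrite /vact linearP vmulDl vscaleE vmulA.
by rewrite -scalerAl mul1r.
Qed.
Lemma vact_bracket x y v :
  vact (mxbracket x y) v = vact x (vact y v) - vact y (vact x v).
Proof.
rewrite /vact ugen_bracket; apply/eqP; rewrite eq_sym subr_eq; apply/eqP.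
by rewrite !vmulA -vmulDl subrK.
Qed.

Definition verma : glmod C n := GlMod vact_linear vact_linearl vact_bracket.

End Verma.

Definition weight_vector M (mu : 'rV[C]_n) (m : M) : Prop :=
  forall h, in_cartan h -> glact h m = wt_eval mu h *: m.

(* m' lies in U(n_+) m, the smallest n_+-stable subspace containing m. *)
Definition in_Unplus M (m m' : M) : Prop :=
  forall S : M -> Prop,
    (forall (a : C) u v, S u -> S v -> S (a *: u + v)) ->
    (forall x u, in_nplus x -> S u -> S (glact x u)) ->
    S m -> S m'.

Definition in_span M (s : seq M) (m : M) : Prop :=
  exists c : 'I_(size s) -> C, m = \sum_(i < size s) c i *: s`_i.

Definition catO M : Prop :=
  [/\ (* finitely generated *)
      exists s : seq M, forall m, exists u : 'I_(size s) -> Ugl C n,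
        m = \sum_(i < size s) uact (u i) s`_i,
      (* h-semisimple *)
      forall m : M, exists k (mu : 'I_k -> 'rV[C]_n) (w : 'I_k -> M),
        (forall i, weight_vector (mu i) (w i)) /\ m = \sum_(i < k) w i
    & (* locally n_+-finite *)
      forall m : M, exists s : seq M, forall m', in_Unplus m m' -> in_span s m'].

(* theta_lam(z) is the scalar by which z acts on the Verma module of highest
   weight lam; only its values on the center of U(gl_n) are meaningful. *)
Definition theta (lam : 'rV[C]_n) (z : Ugl C n) : C :=
  xget 0 [set c : C | forall m : verma lam, uact z m = c *: m].

Definition catO_theta (th : Ugl C n -> C) M : Prop :=
  catO M /\
  forall (m : M) z, Ucentral z -> exists k : nat, uact ((z - (th z)%:A) ^+ k) m = 0.

(* A full subcategory of the category of gl_n-modules is given by its class of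
   objects. The direct sum of such subcategories A_i inside the module category
   consists of the direct sums of one object from each A_i. *)

Definition is_dsum (I : finType) (N : I -> glmod C n) M : Prop :=
  exists2 f : forall i, N i -> M, forall i, glhom (f i) &
    bijective (fun x : (forall i, N i) => \sum_i f i (x i)).

Definition dsum_cat (I : finType) (A : I -> glmod C n -> Prop) M : Prop :=
  exists2 N : I -> glmod C n, forall i, A i (N i) & is_dsum N M.

(* Grothendieck groups: K(A) is the abelian group presented by generators [M]
   for M in A and relations [M] = [M'] + [M''] for the short exact sequences
   0 -> M' -> M -> M'' -> 0 in A. The classes A of interest are closed under
   submodules, quotients and direct sums, so exactness in A is exactness of
   modules. *)

Definition short_exact M' M M'' : Prop :=
  exists (f : M' -> M) (g : M -> M''),
    [/\ glhom f, glhom g, injective f, forall z, exists y, g y = z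
      & forall y, g y = 0 <-> exists x, f x = y].

(* (true, M) stands for [M], (false, M) for - [M], and a sequence for a sum. *)
Definition Kword (A : glmod C n -> Prop) : Type := seq (bool * {M | A M}).

Inductive Keq (A : glmod C n -> Prop) : Kword A -> Kword A -> Prop :=
| Keq_refl s : Keq s s
| Keq_sym s t : Keq s t -> Keq t s
| Keq_trans s t u : Keq s t -> Keq t u -> Keq s u
| Keq_cat s s' t t' : Keq s s' -> Keq t t' -> Keq (s ++ t) (s' ++ t')
| Keq_comm s t : Keq (s ++ t) (t ++ s)
| Keq_cancel b (M : {M | A M}) : Keq [:: (b, M); (~~ b, M)] [::]
| Keq_exact (M' M M'' : {M | A M}) : short_exact (sval M') (sval M) (sval M'') ->
    Keq [:: (true, M)] [:: (true, M'); (true, M'')].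

(* The objects of A form a large type, while zmodType is monomorphic and small
   (any zmodType is an lmodType int), so K(A) cannot be a zmodType; its group
   structure is given by hand. *)
Definition K (A : glmod C n -> Prop) : Type :=
  {P : Kword A -> Prop | exists s, P = Keq s}.

Definition Kof A (s : Kword A) : K A := exist _ (Keq s) (ex_intro _ s erefl).
Definition Krepr A (x : K A) : Kword A := sval (cid (svalP x)).

Definition Kcls A M (h : A M) : K A := Kof [:: (true, exist _ M h)].
Definition Kzero A : K A := Kof [::].
Definition Kadd A (x y : K A) : K A := Kof (Krepr x ++ Krepr y).
Definition Kopp A (x : K A) : K A := Kof [seq (~~ p.1, p.2) | p <- Krepr x].

Lemma KofP A (s t : Kword A) : Kof s = Kof t <-> Keq s t.
Proof.
split=> [/(congr1 sval) /= e | h]; first by rewrite e; apply: Keq_refl.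
apply: eq_exist => /=; apply/funext => u; apply/propext; split=> h'.
  exact: Keq_trans (Keq_sym h) h'.
exact: Keq_trans h h'.
Qed.

Lemma KreprK A : cancel (@Krepr A) (@Kof A).
Proof.
move=> x; rewrite /Krepr; case: cid; case: x => P hP s /= e.
by apply: eq_exist; rewrite e.
Qed.

Lemma Krepr_of A (s : Kword A) : Keq (Krepr (Kof s)) s.
Proof. by apply/KofP; rewrite KreprK. Qed.

Lemma Kof_ind A (P : K A -> Prop) : (forall s, P (Kof s)) -> forall x, P x.
Proof. by move=> h x; rewrite -(KreprK x). Qed.

Lemma Kadd_of A (s t : Kword A) : Kadd (Kof s) (Kof t) = Kof (s ++ t).
Proof. by apply/KofP/Keq_cat; apply: Krepr_of. Qed.

Lemma KaddA A : associative (@Kadd A).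
Proof.
elim/Kof_ind=> s; elim/Kof_ind=> t; elim/Kof_ind=> u.
by rewrite !Kadd_of catA.
Qed.
Lemma KaddC A : commutative (@Kadd A).
Proof.
by elim/Kof_ind=> s; elim/Kof_ind=> t; rewrite !Kadd_of; apply/KofP/Keq_comm.
Qed.
Lemma Kadd0 A : left_id (Kzero A) (@Kadd A).
Proof. by elim/Kof_ind=> s; rewrite Kadd_of. Qed.
Lemma KaddN A : left_inverse (Kzero A) (@Kopp A) (@Kadd A).
Proof.
move=> x; rewrite -[x in Kadd _ x]KreprK /Kopp Kadd_of.
move: (Krepr x) => s; apply/KofP; elim: s => [|[b M] s IHs] /=.
  exact: Keq_refl.
apply: (@Keq_trans _ _
  ([:: (~~ b, M); (b, M)] ++ ([seq (~~ p.1, p.2) | p <- s] ++ s))).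
  rewrite /= -cat1s -[X in Keq _ X]cat1s; apply: Keq_cat; first exact: Keq_refl.
  rewrite -cat1s catA -[X in Keq _ X]cat1s catA.
  by apply: Keq_cat (Keq_refl _); apply: Keq_comm.
rewrite -[X in Keq _ X]cats0; apply: Keq_cat IHs.
by have := Keq_cancel (~~ b) M; rewrite negbK.
Qed.

Lemma Kcls_exact A M' M M'' (h' : A M') (h : A M) (h'' : A M'') :
  short_exact M' M M'' -> Kcls h = Kadd (Kcls h') (Kcls h'').
Proof. by move=> e; rewrite Kadd_of; apply/KofP/Keq_exact. Qed.

(* The homomorphism K(A) -> K(B) induced by an inclusion of A in B. *)
Definition Kword_incl (A B : glmod C n -> Prop) (AB : forall M, A M -> B M)
    (s : Kword A) : Kword B :=
  [seq (p.1, exist _ (sval p.2) (AB _ (proj2_sig p.2))) | p <- s].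

Definition Kincl (A B : glmod C n -> Prop) (AB : forall M, A M -> B M)
    (x : K A) : K B :=
  Kof (Kword_incl AB (Krepr x)).

Lemma Kincl_of A B (AB : forall M, A M -> B M) s :
  Kincl AB (Kof s) = Kof (Kword_incl AB s).
Proof.
apply/KofP; move: (Krepr_of s); move: (Krepr _) => t.
elim=> {s t}.
- by move=> s; apply: Keq_refl.
- by move=> s t _; apply: Keq_sym.
- by move=> s t u _ h1 _ h2; apply: Keq_trans h1 h2.
- by move=> s s' t t' _ h1 _ h2; rewrite /Kword_incl !map_cat; apply: Keq_cat.
- by move=> s t; rewrite /Kword_incl !map_cat; apply: Keq_comm.
- by move=> b M; apply: Keq_cancel.
- by move=> M' M M'' e; apply: Keq_exact.
Qed.

Lemma Kincl_cls A B (AB : forall M, A M -> B M) M (h : A M) :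
  Kincl AB (Kcls h) = Kcls (AB M h).
Proof. by rewrite /Kcls Kincl_of. Qed.

Lemma KinclD A B (AB : forall M, A M -> B M) :
  {morph Kincl AB : x y / Kadd x y >-> Kadd x y}.
Proof.
elim/Kof_ind=> s; elim/Kof_ind=> t.
by rewrite Kadd_of !Kincl_of Kadd_of /Kword_incl map_cat.
Qed.

(* f is an isomorphism of abelian groups from K(A) to the subgroup S of V. *)
Definition Kiso A (V : zmodType) (f : K A -> V) (S : V -> Prop) : Prop :=
  [/\ {morph f : x y / Kadd x y >-> x + y}, injective f
    & forall v, S v <-> exists x, f x = v].

End Modules.

Arguments verma {C n} lam.
Arguments theta {C n} lam z.

Section Combinatorics.
Variable n : nat.

(* The parts of an 8-tuple with sum n are at most n. *)
Definition Dset : Type :=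
  {d : {ffun 'I_8 -> 'I_n.+1} | \sum_(k < 8) (d k : nat) == n}.
HB.instance Definition _ := Finite.on Dset.

Definition dpart (d : Dset) (k : 'I_8) : nat := val d k.

Definition dint (d : Dset) (k : nat) : int := (dpart d (inord k))%:Z.

Definition dsim : rel Dset := fun d d' =>
  let q1 d := dint d 7 + dint d 6 + dint d 5 + dint d 4
              - dint d 3 - dint d 2 - dint d 1 - dint d 0 in
  let q2 d := dint d 7 + dint d 6 - dint d 5 - dint d 4
              + dint d 3 + dint d 2 - dint d 1 - dint d 0 in
  let q3 d := dint d 7 - dint d 6 + dint d 5 - dint d 4
              + dint d 3 - dint d 2 + dint d 1 - dint d 0 in
  [&& q1 d == q1 d', q2 d == q2 d' & q3 d == q3 d'].

Definition Dtilde : Type :=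
  {c : {set Dset} | c \in equivalence_partition dsim [set: Dset]}.
HB.instance Definition _ := Finite.on Dtilde.

Definition has_content (a : {ffun 'I_n -> 'I_8}) (d : Dset) : bool :=
  [forall k : 'I_8, #|[set m | a m == k]| == dpart d k].

End Combinatorics.

Section SpinTensor.
Variables (C : fieldType) (n : nat).

Definition Vsp : Type := 'rV[C]_8.
Definition vsp (i : 'I_8) : Vsp := delta_mx 0 i.

(* The n-th tensor power of V_sp in coordinates: functions on [0,7]^n. *)
Definition Vspn : Type := {ffun {ffun 'I_n -> 'I_8} -> C}.
HB.instance Definition _ := GRing.Zmodule.on Vspn.

Definition tensor (w : 'I_n -> Vsp) : Vspn :=
  [ffun b : {ffun 'I_n -> 'I_8} => \prod_(m < n) (w m : 'rV[C]_8) 0 (b m)].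

Definition ZVsp_class (c : Dtilde n) (w : Vspn) : Prop :=
  exists z : {ffun 'I_n -> 'I_8} -> int,
    w = \sum_(a | [exists d in val c, has_content a d])
          tensor (fun m => vsp (a m)) *~ z a.

Definition ZVsp (w : Vspn) : Prop :=
  exists2 x : Dtilde n -> Vspn, forall c, ZVsp_class c (x c) & w = \sum_c x c.

End SpinTensor.

Section Blocks.
Variables (C : fieldType) (n : nat).

(* e_p with p numbered from 1. *)
Definition eps (p : nat) : 'rV[C]_n := \row_(q < n) (q.+1 == p)%:R.

Definition rho : 'rV[C]_n := \row_(q < n) ((n%:R - 1 - q%:R *+ 2) / 2%:R).

Definition lambda_d (d : Dset n) : 'rV[C]_n :=
  \sum_(i < 8) \sum_(1 <= j < (dpart d i).+1)
    i%:R *: eps (\sum_(k < 8 | (k < i)%N) dpart d k + j).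

Definition vermaM (a : {ffun 'I_n -> 'I_8}) : glmod C n :=
  verma ((\row_(q < n) (a q)%:R) - rho).

Definition O_d (d : Dset n) : glmod C n -> Prop :=
  catO_theta (theta (lambda_d d - rho)).

Definition O_class (c : Dtilde n) : glmod C n -> Prop :=
  dsum_cat (fun d : {d : Dset n | d \in val c} => O_d (val d)).

Definition O_n : glmod C n -> Prop := dsum_cat O_class.

Lemma zero_linear (x : 'M[C]_n) : linear (fun v : 'rV[C]_0 => 0 : 'rV[C]_0).
Proof. by move=> a u v; rewrite scaler0 addr0. Qed.
Lemma zero_linearl (v : 'rV[C]_0) : linear (fun x : 'M[C]_n => 0 : 'rV[C]_0).
Proof. by move=> a x y; rewrite scaler0 addr0. Qed.
Lemma zero_bracket (x y : 'M[C]_n) (v : 'rV[C]_0) : 0 = 0 - 0 :> 'rV[C]_0.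
Proof. by rewrite subr0. Qed.

Definition zero_glmod : glmod C n := GlMod zero_linear zero_linearl zero_bracket.

Lemma zero_glmodE (m m' : zero_glmod) : m = m'.
Proof. by rewrite (thinmx0 (m : 'rV_0)) (thinmx0 (m' : 'rV_0)). Qed.

Lemma zero_O_theta th : catO_theta th zero_glmod.
Proof.
split; last by move=> m z _; exists 0%N; apply: zero_glmodE.
split=> [|m|m].
- by exists [::] => m; exists (fun=> 0); apply: zero_glmodE.
- exists 0%N, (fun=> 0), (fun=> 0); split; last exact: zero_glmodE.
  by case.
- by exists [::] => m' _; exists (fun=> 0); apply: zero_glmodE.
Qed.

Lemma zero_O_class c : O_class c zero_glmod.
Proof.
exists (fun=> zero_glmod) => [d|]; first exact: zero_O_theta.
exists (fun _ => id) => [d|]; first by split.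
exists (fun _ _ => 0) => [x|y]; last exact: zero_glmodE.
by apply: functional_extensionality_dep => d; apply: zero_glmodE.
Qed.

Lemma O_class_sub c M : O_class c M -> O_n M.
Proof.
move=> hM.
pose N c' := if c' == c then M else zero_glmod.
pose f c' : N c' -> M :=
  match c' == c as b return (if b then M else zero_glmod) -> M with
  | true => id | false => fun=> 0 end.
pose g (m : M) c' : N c' :=
  match c' == c as b return (if b then M else zero_glmod) with
  | true => m | false => 0 end.
exists N => [c'|].
  by rewrite /N; case: eqP => [->|_] //; apply: zero_O_class.
have gl0 : glhom (fun _ : zero_glmod => 0 : M).
  have act0 x : glact x (0 : M) = 0.
    have := glact_linear x 1 (0 : M) 0.
    by rewrite !scale1r !addr0 -[X in X = _]addr0 => /addrI.
  by split=> [a u v|x m]; rewrite ?scaler0 ?addr0 // act0.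
exists f => [c'|].
  by rewrite /f /N; case: (c' == c).
have fsum (x : forall c', N c') : \sum_c' f c' (x c') = f c (x c).
  rewrite (bigD1 c) //= big1 ?addr0 // => c' nc.
  by move: (x c'); rewrite /f /N (negbTE nc).
have fg m : f c (g m c) = m by rewrite /f /g; case: (c == c) (eqxx c).
exists (fun m c' => g m c') => [x|m]; last by rewrite fsum fg.
rewrite fsum; apply: functional_extensionality_dep => c'.
case: (eqVneq c' c) => [->|nc].
  by move: (x c); rewrite /f /g /N; case: (c == c) (eqxx c).
move: (x c') (g _ c'); rewrite /N (negbTE nc) => y y'; exact: (zero_glmodE y' y).
Qed.

End Blocks.

(* Main.v *)
(* Weight multiplicities are additive on short exact sequences, and those of the
   Verma modules M(a) form a unitriangular matrix for the order by height, so
   the classes [M(a)] are independent. They generate: a module of O_d whose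
   linked weights have height at most k has a highest weight vector v at every
   linked weight of height k, and [M] = [M(a)] - [Ker (M(a) -> U v)] + [M / U v],
   where the kernel has only linked weights of smaller height and the quotient
   has smaller weight spaces. Since every nonzero submodule or quotient of a
   module of O_d meets a linked weight, finite generation follows from finite
   weight multiplicities and no Noetherian property of U(gl_n) is needed.

   "Linked" is the theorem of Harish-Chandra. That M(a) and M(a.s) have the same
   central character comes from the singular vector f^k v in M(a); that f^k v is
   not zero is seen, without the PBW theorem, in a module over the Weyl algebra
   in n x n variables. Conversely, the Gelfand invariants tr(E^k) determine the
   function prod_a (u - l_a - 1) / (u - l_a), where l = weight + rho up to a
   constant, and hence the multiset of the l_a. *)

From HB Require Import structures.
Require Import Defs.
From mathcomp Require Import fingroup perm.
From mathcomp Require Import all_boot all_order all_algebra.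
From mathcomp Require Import ring zify.
From mathcomp Require Import boolp classical_sets functions reals complex.

Set Implicit Arguments.
Unset Strict Implicit.
Unset Printing Implicit Defensive.

Import Order.TTheory GRing.Theory Num.Theory.
Local Open Scope ring_scope.
Local Open Scope quotient_scope.

(** * Spans and dimensions *)

(** The map is read off from weight multiplicities: the coefficients of a class in the [M(a)] are
    determined by its multiplicities at the weights of the M(b), so additivity and the values on
    Verma classes follow from uniqueness. Multiplicities do not see the ambient category, hence one
    argument, [Kiso_generated], serves O^n and each O_[d], and the injectivity of K(O_[d]) -> K(O^n)
    comes out of it. Heights of weights are elements of the field. They are compared only when they
    differ by a natural number, which characteristic zero, in the form [natr_inj], allows to
    recover. The module over the Weyl algebra must reach every highest weight, while polynomials
    reach only some: the diagonal variables get exponents in the field, and the variables below the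
    diagonal are Fourier transformed, so that E_ij with i < j kills the vacuum row by row. The
    rational function in u is evaluated only at u = -k for large natural k, a set stable under the
    shift u - 1 that occurs in it. *)

Section LinearSpan.
Variables (C : fieldType) (V : lmodType C).
Implicit Types (P S : V -> Prop) (s t : seq V).

Definition subspace S : Prop :=
  S 0 /\ forall (a : C) u v, S u -> S v -> S (a *: u + v).

Inductive lspan P : V -> Prop :=
| lspan0 : lspan P 0
| lspanS (a : C) u v : P u -> lspan P v -> lspan P (a *: u + v).

Lemma lspan_in P u : P u -> lspan P u.
Proof.
by move=> Pu; rewrite -[u]scale1r -[1 *: u]addr0; apply: lspanS => //; constructor.
Qed.

Lemma lspan_subspace P : subspace (lspan P).
Proof.
split=> [|a u v hu hv]; first exact: lspan0.
elim: hu => [|b x y Px _ IH]; first by rewrite scaler0 add0r.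
by rewrite scalerDr -addrA scalerA; apply: lspanS.
Qed.

Lemma subspace0 S : subspace S -> S 0. Proof. by case. Qed.

Lemma subspaceD S u v : subspace S -> S u -> S v -> S (u + v).
Proof. by case=> _ h hu hv; rewrite -[u]scale1r; apply: h. Qed.

Lemma subspaceZ S a u : subspace S -> S u -> S (a *: u).
Proof. by case=> S0 h hu; rewrite -[_ *: _]addr0; apply: h. Qed.

Lemma subspaceN S u : subspace S -> S u -> S (- u).
Proof. by move=> h hu; rewrite -scaleN1r; apply: subspaceZ. Qed.

Lemma subspaceB S u v : subspace S -> S u -> S v -> S (u - v).
Proof. by move=> h hu hv; apply: subspaceD => //; apply: subspaceN. Qed.

Lemma subspace_sum S (I : Type) (r : seq I) (Q : pred I) (F : I -> V) :
  subspace S -> (forall i, Q i -> S (F i)) -> S (\sum_(i <- r | Q i) F i).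
Proof.
move=> h hF; apply: big_ind => //; first exact: subspace0.
by move=> u v; apply: subspaceD.
Qed.

Lemma lspan_min P S : subspace S -> (forall u, P u -> S u) ->
  forall u, lspan P u -> S u.
Proof.
by move=> h hP u; elim=> [|a x y Px _ IH]; [case: h | apply h.2 => //; apply: hP].
Qed.

Lemma lspan_mono P P' : (forall u, P u -> P' u) ->
  forall u, lspan P u -> lspan P' u.
Proof.
move=> h; apply: lspan_min; first exact: lspan_subspace.
by move=> u /h; apply: lspan_in.
Qed.

(** Coefficients are a function on [nat], so that lists are split and extended by shifting it,
    without casts between ordinals. *)
Definition lcomb (c : nat -> C) s : V := \sum_(i < size s) c i *: s`_i.

Lemma lcomb_cons c v s : lcomb c (v :: s) = c 0%N *: v + lcomb (fun i => c i.+1) s.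
Proof. by rewrite /lcomb big_ord_recl. Qed.

Lemma lcomb_cat c s t :
  lcomb c (s ++ t) = lcomb c s + lcomb (fun i => c (size s + i)%N) t.
Proof.
elim: s c => [|v s IH] c /=; first by rewrite [lcomb c [::]]big_ord0 add0r.
by rewrite !lcomb_cons IH addrA.
Qed.

Definition sspan s : V -> Prop := lspan (fun v => v \in s).

Lemma lspan_seqP s u : sspan s u <-> exists c, u = lcomb c s.
Proof.
split=> [|[c ->]]; last first.
  apply: subspace_sum => [|i _]; first exact: lspan_subspace.
  apply: subspaceZ; first exact: lspan_subspace.
  by apply: lspan_in; apply: mem_nth.
move: u; apply: lspan_min => [|u us].
  split; first by exists (fun=> 0); rewrite /lcomb big1 // => i _; rewrite scale0r.
  move=> a u v [c ->] [d ->]; exists (fun i => a * c i + d i).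
  rewrite scaler_sumr -big_split; apply: eq_bigr => i _.
  by rewrite scalerDl scalerA.
have h : (index u s < size s)%N by rewrite index_mem.
exists (fun i => (i == index u s)%:R); rewrite /lcomb (bigD1 (Ordinal h)) //=.
rewrite eqxx scale1r nth_index // big1 ?addr0 // => i.
by rewrite -val_eqE /= => /negbTE ->; rewrite scale0r.
Qed.

Definition free_seq s : Prop :=
  forall c, lcomb c s = 0 -> forall i, (i < size s)%N -> c i = 0.

(** If [s] were longer than [t], its coordinate matrix would have more rows than columns; a nonzero
    row of the left kernel is a dependency in [s]. *)
Lemma steinitz s t :
  free_seq s -> (forall v, v \in s -> sspan t v) -> (size s <= size t)%N.
Proof.
move=> fs hs.
have /choice [A hA] (i : 'I_(size s)) : exists c, s`_i = lcomb c t.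
  by apply/lspan_seqP; apply: hs; apply: mem_nth.
pose B : 'M[C]_(size s, size t) := \matrix_(i, j) A i j.
rewrite leqNgt; apply/negP => lt.
have : kermx B != 0.
  by rewrite kermx_eq0 /row_free neq_ltn (leq_ltn_trans (rank_leq_col B) lt).
case/rowV0Pn => u /sub_kermxP uB u0; case/eqP: u0; apply/rowP => i.
pose c k : C := if insub k is Some j then u 0 j else 0.
have cE (j : 'I_(size s)) : c j = u 0 j by rewrite /c valK.
rewrite mxE -cE; apply: (fs c) => //; rewrite /lcomb.
under eq_bigr => j _ do rewrite hA cE scaler_sumr.
rewrite exchange_big big1 //= => k _; have /rowP/(_ k) := uB.
rewrite !mxE => e; rewrite -[RHS](scale0r t`_k) -e scaler_suml.
by apply: eq_bigr => j _; rewrite mxE scalerA.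
Qed.

Lemma free_cons v s : free_seq s -> ~ sspan s v -> free_seq (v :: s).
Proof.
move=> fs hv c; rewrite lcomb_cons => e.
have c0 : c 0%N = 0.
  apply/eqP/negPn/negP => c0; apply: hv.
  have -> : v = - (c 0%N)^-1 *: lcomb (fun i => c i.+1) s.
    move/eqP: e; rewrite addr_eq0 => /eqP e.
    by rewrite scaleNr -scalerN -e scalerA mulVf // scale1r.
  by apply: subspaceZ; [apply: lspan_subspace | apply/lspan_seqP; eexists].
by case=> [|i] //=; rewrite ltnS; apply: (fs (fun i => c i.+1)); rewrite -e c0 scale0r add0r.
Qed.

Definition fin_span P := exists t, forall v, P v -> sspan t v.

(** By [steinitz] the free lists in [P] have bounded length. A vector of [P] outside the span of a
    longest one would extend it. *)
Lemma basis_extract P : fin_span P ->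
  exists s, [/\ free_seq s, forall v, v \in s -> P v
              & forall v, P v -> sspan s v].
Proof.
case=> t ht.
pose Q k := `[< exists s, [/\ size s = k, free_seq s & forall v, v \in s -> P v] >].
have Q0 : exists k, Q k by exists 0%N; apply/asboolP; exists [::].
have Qm k : Q k -> (k <= size t)%N.
  by case/asboolP => s [<- fs hs]; apply: steinitz fs _ => v /hs/ht.
case: (ex_maxnP Q0 Qm) => k /asboolP [s [sk fs hs]] kmax.
exists s; split=> // v Pv; apply: contrapT => hv.
suff /kmax : Q k.+1 by rewrite ltnn.
apply/asboolP; exists (v :: s); split; rewrite /= ?sk //; first exact: free_cons.
by move=> w; rewrite inE => /predU1P [-> | /hs].
Qed.

(** A relation, because subspaces are predicates in an ambient space of arbitrary dimension;
    [hasdim_inj] makes it functional. *)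
Definition hasdim S d :=
  exists s, [/\ size s = d, free_seq s, forall v, v \in s -> S v
              & forall v, S v -> sspan s v].

Lemma hasdim_exists S : fin_span S -> exists d, hasdim S d.
Proof. by case/basis_extract => s [fs h1 h2]; exists (size s), s. Qed.

Lemma hasdim_inj S d e : hasdim S d -> hasdim S e -> d = e.
Proof.
case=> s [<- fs hs hs'] [t [<- ft ht ht']]; apply/eqP; rewrite eqn_leq.
by apply/andP; split; apply: steinitz => // v; [move/hs/ht' | move/ht/hs'].
Qed.

Lemma hasdim0 S : hasdim S 0 <-> forall v, S v -> v = 0.
Proof.
split=> [[s [/size0nil -> _ _ h]] v /h /lspan_seqP [c ->] | h].
  by rewrite /lcomb big_ord0.
by exists [::]; split=> // v /h ->; apply: lspan0.
Qed.

Lemma hasdim1 S u : u != 0 -> S u -> (forall v, S v -> exists a : C, v = a *: u) ->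
  hasdim S 1.
Proof.
move=> u0 Su h; exists [:: u]; split=> //.
- apply: free_cons; first by move=> c _ [].
  by case/lspan_seqP => c /eqP; rewrite /lcomb big_ord0 (negbTE u0).
- by move=> v; rewrite inE => /eqP ->.
- move=> v /h [a ->]; apply: subspaceZ; first exact: lspan_subspace.
  by apply: lspan_in; apply: mem_head.
Qed.

End LinearSpan.

Section LinearMaps.
Variables (C : fieldType) (V W : lmodType C) (f : V -> W).
Hypothesis lf : linear f.

Lemma lin0 : f 0 = 0.
Proof.
by apply: (addrI (f 0)); rewrite -[X in X + _]scale1r -lf scaler0 !addr0.
Qed.

Lemma linD u v : f (u + v) = f u + f v.
Proof. by rewrite -[u in LHS]scale1r lf scale1r. Qed.

Lemma linZ a u : f (a *: u) = a *: f u.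
Proof. by rewrite -[a *: u]addr0 lf lin0 addr0. Qed.

Lemma linB u v : f (u - v) = f u - f v.
Proof. by rewrite -!scaleN1r linD linZ. Qed.

Lemma lin_sum (I : Type) (r : seq I) (Q : pred I) (F : I -> V) :
  f (\sum_(i <- r | Q i) F i) = \sum_(i <- r | Q i) f (F i).
Proof. by apply: (big_morph f linD lin0). Qed.

Lemma lin_lcomb c s : f (lcomb c s) = lcomb c (map f s).
Proof.
rewrite /lcomb lin_sum size_map; apply: eq_bigr => i _.
by rewrite linZ (nth_map 0).
Qed.

Lemma lspan_image P u :
  lspan P u -> lspan (fun w => exists2 v, P v & w = f v) (f u).
Proof.
elim=> [|a x y Px _ IH]; first by rewrite lin0; apply: lspan0.
by rewrite lf; apply: lspanS => //; exists x.
Qed.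

Lemma fin_span_image (P : V -> Prop) (Q : W -> Prop) : fin_span P ->
  (forall w, Q w -> exists2 v, P v & w = f v) -> fin_span Q.
Proof.
case=> t ht h; exists (map f t) => w /h [v /ht/lspan_image + ->].
apply: lspan_mono => _ [x xt ->]; exact: map_f.
Qed.

(** The list spanning [Q] may leave the image of [f]. So a basis of f(P) is extracted first; its
    lifts span [P] because [f] is injective. *)
Lemma fin_span_preimage (P : V -> Prop) (Q : W -> Prop) : fin_span Q ->
  injective f -> (forall v, P v -> Q (f v)) -> fin_span P.
Proof.
move=> [t ht] fi h.
have : fin_span (fun w => exists2 v, P v & w = f v).
  by exists t => w [v /h/ht + ->].
case/basis_extract => s [fs h1 h2].
have /choice [g hg] w : exists v, w \in s -> P v /\ w = f v.
  have [/h1 [v Pv ->]|_] := boolP (w \in s); first by exists v.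
  by exists 0.
exists (map g s) => v Pv.
have /lspan_seqP [c e] : sspan s (f v) by apply: h2; exists v.
apply/lspan_seqP; exists c; apply: fi; rewrite e lin_lcomb; congr lcomb.
by rewrite -map_comp -[LHS]map_id; apply/eq_in_map => w /hg [_].
Qed.

End LinearMaps.

(** Additivity of dimension for subspaces that correspond under an exact sequence, made for weight
    spaces. The basis of [S2] consists of the image of one of [S1] and lifts of one of [S3]. *)
Lemma hasdim_exact (C : fieldType) (V1 V2 V3 : lmodType C) (f : V1 -> V2) (g : V2 -> V3)
    (S1 : V1 -> Prop) (S2 : V2 -> Prop) (S3 : V3 -> Prop) d1 d3 :
  linear f -> linear g -> injective f ->
  (forall y, g y = 0 <-> exists x, f x = y) ->
  subspace S2 ->
  (forall x, S1 x <-> S2 (f x)) ->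
  (forall y, S2 y -> S3 (g y)) -> (forall z, S3 z -> exists2 y, S2 y & z = g y) ->
  hasdim S1 d1 -> hasdim S3 d3 -> hasdim S2 (d1 + d3).
Proof.
move=> lf lg fi ex sS h1 h2 h3 [s [<- fs hs hs']] [t [<- ft ht ht']].
have /choice [l hl] z : exists y, z \in t -> S2 y /\ z = g y.
  have [/ht/h3 [y Sy ->]|_] := boolP (z \in t); first by exists y.
  by exists 0.
have gl : map g (map l t) = t.
  by rewrite -map_comp -[RHS]map_id; apply/eq_in_map => w /hl [].
have gf x : g (f x) = 0 by apply/ex; exists x.
exists (map f s ++ map l t); split.
- by rewrite size_cat !size_map.
- move=> c; rewrite lcomb_cat size_map -lin_lcomb // => e.
  have := congr1 g e; rewrite linD // gf add0r lin_lcomb // gl lin0 // => e3.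
  have ct := ft _ e3.
  have z3 : lcomb (fun i => c (size s + i)%N) (map l t) = 0.
    apply: big1 => i _; rewrite ct ?scale0r //.
    by have := ltn_ord i; rewrite [in X in (_ < X)%N -> _]size_map.
  move: e; rewrite z3 addr0 => e.
  have cs : lcomb c s = 0 by apply: fi; rewrite e lin0.
  move=> i; rewrite size_cat !size_map => hi.
  case: (ltnP i (size s)) => si; first exact: fs cs i si.
  by rewrite -(subnKC si); apply: ct; rewrite ltn_subLR.
- move=> v; rewrite mem_cat => /orP [] /mapP [w]; first by move=> /hs/h1 + ->.
  by move=> /hl [+ _] ->.
- move=> v Sv; have /h2/ht'/lspan_seqP [c e] := Sv.
  pose v' := lcomb c (map l t).
  have /ex [x fx] : g (v - v') = 0 by rewrite linB // e /v' (lin_lcomb lg) gl subrr.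
  have hm : forall w, w \in map l t -> S2 w by move=> w /mapP [z /hl [Sz _] ->].
  have Sv' : S2 v'.
    apply: (@lspan_min _ _ (fun v => v \in map l t) S2 sS hm).
    by apply/lspan_seqP; exists c.
  have /hs' : S1 x by apply/h1; rewrite fx; apply: subspaceB.
  move/(lspan_image lf); rewrite fx => hx.
  rewrite -[v](subrK v'); apply: subspaceD; first exact: lspan_subspace.
    by apply: lspan_mono hx => _ [y ys ->]; rewrite /= mem_cat map_f.
  have : sspan (map l t) v' by apply/lspan_seqP; exists c.
  by apply: lspan_mono => w wt; rewrite /= mem_cat wt orbT.
Qed.

Section SpanMore.
Variables (C : fieldType) (V : lmodType C).
Implicit Types P : V -> Prop.

Lemma lspan_sumP P v : lspan P v ->
  exists2 r : seq (C * V), (forall p, p \in r -> P p.2) & v = \sum_(p <- r) p.1 *: p.2.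
Proof.
elim=> [|a u w Pu _ [r hr ->]]; first by exists [::]; rewrite ?big_nil.
exists ((a, u) :: r); last by rewrite big_cons.
by move=> p; rewrite inE => /predU1P [-> | /hr].
Qed.

Lemma fin_span_mono P Q : (forall v, Q v -> lspan P v) -> fin_span P -> fin_span Q.
Proof.
move=> h [t ht]; exists t => v /h; apply: lspan_min => //.
exact: lspan_subspace.
Qed.

Lemma fin_span_bigcup (I : finType) (P : I -> V -> Prop) :
  (forall i, fin_span (P i)) -> fin_span (fun v => exists i, P i v).
Proof.
move=> /choice [t ht]; exists (flatten [seq t i | i <- enum I]) => v [i /ht].
apply: lspan_mono => w hw; apply/flattenP; exists (t i) => //.
by apply: map_f; rewrite mem_enum.
Qed.

End SpanMore.

(** * Submodules and quotient modules *)

Section SubQuotient.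
Variables (C : fieldType) (n : nat).

Definition submodule (M : glmod C n) (S : M -> Prop) : Prop :=
  subspace S /\ forall x m, S m -> S (glact x m).

Variables (M : glmod C n) (S : M -> Prop) (hS : submodule S).

(** The proof of [submodule S] is an argument, so that closure and quotient structures can be
    attached to [submod_pred hS] for a variable [S]. *)
Definition submod_pred of submodule S : {pred M} := fun m => `[< S m >].

Lemma submod_pred_closed : submod_closed (submod_pred hS).
Proof.
have [[S0 SD] _] := hS; split; first exact/asboolP.
by move=> a u v /asboolP hu /asboolP hv; apply/asboolP; apply: SD.
Qed.

HB.instance Definition _ := GRing.isSubmodClosed.Build C M (submod_pred hS)
  submod_pred_closed.

Definition submod_car : Type := {m : M | m \in submod_pred hS}.
HB.instance Definition _ := SubChoice.on submod_car.
HB.instance Definition _ := [SubChoice_isSubLmodule of submod_car by <:].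

Definition submod_in (m : M) (h : S m) : submod_car := exist _ m (asboolT h).

Lemma submod_car_in (m : submod_car) : S (val m).
Proof. exact/asboolP/(valP m). Qed.

Definition submod_incl (m : submod_car) : M := val m.

Lemma submod_incl_linear : linear submod_incl.
Proof. by move=> a u v; rewrite /submod_incl linearP. Qed.

Lemma submod_incl_inj : injective submod_incl. Proof. exact: val_inj. Qed.

Definition submod_act x (m : submod_car) : submod_car :=
  submod_in (hS.2 x _ (submod_car_in m)).

Lemma submod_incl_act x m : submod_incl (submod_act x m) = glact x (submod_incl m).
Proof. by []. Qed.

Lemma submod_act_linear x : linear (submod_act x).
Proof.
move=> a u v; apply: submod_incl_inj; rewrite submod_incl_linear !submod_incl_act.
by rewrite submod_incl_linear glact_linear.
Qed.
Lemma submod_act_linearl m : linear (fun x => submod_act x m).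
Proof.
move=> a u v; apply: submod_incl_inj; rewrite submod_incl_linear !submod_incl_act.
exact: glact_linearl.
Qed.
Lemma submod_act_bracket x y m :
  submod_act (mxbracket x y) m =
  submod_act x (submod_act y m) - submod_act y (submod_act x m).
Proof.
apply: submod_incl_inj; rewrite (linB submod_incl_linear) !submod_incl_act.
exact: glact_bracket.
Qed.

Definition submod : glmod C n :=
  GlMod submod_act_linear submod_act_linearl submod_act_bracket.

Definition submod_val (m : submod) : M := submod_incl m.

Lemma submod_val_hom : glhom submod_val.
Proof. by split=> //; apply: submod_incl_linear. Qed.

Lemma submod_val_inj : injective submod_val. Proof. exact: submod_incl_inj. Qed.

Lemma submod_valP m : S m <-> exists y, submod_val y = m.
Proof. by split=> [h | [y <-]]; [exists (submod_in h) | apply: submod_car_in]. Qed.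

Definition quotmod_car : Type := Quotient.quot (submod_pred hS).
HB.instance Definition _ := GRing.Zmodule.on quotmod_car.

Definition quotmod_pi (m : M) : quotmod_car := \pi_(Quotient.quot (submod_pred hS)) m.
Definition quotmod_repr (v : quotmod_car) : M :=
  repr (v : Quotient.quot (submod_pred hS)).

Lemma quotmod_reprK : cancel quotmod_repr quotmod_pi. Proof. exact: reprK. Qed.

Lemma quotmod_piP u v : quotmod_pi u = quotmod_pi v <-> S (u - v).
Proof.
rewrite /quotmod_pi; split=> [/eqP | h].
  by rewrite -Quotient.idealrBE => /asboolP.
by apply/eqP; rewrite -Quotient.idealrBE; apply/asboolP.
Qed.

Lemma quotmod_piD u v : quotmod_pi (u + v) = quotmod_pi u + quotmod_pi v.
Proof. exact: Quotient.pi_add. Qed.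

Lemma quotmod_ind (P : quotmod_car -> Prop) :
  (forall u, P (quotmod_pi u)) -> forall v, P v.
Proof. by move=> h v; rewrite -(quotmod_reprK v). Qed.

Definition quotmod_lift (f : M -> M) (v : quotmod_car) : quotmod_car :=
  quotmod_pi (f (quotmod_repr v)).

Lemma quotmod_liftE f : linear f -> (forall m, S m -> S (f m)) ->
  forall u, quotmod_lift f (quotmod_pi u) = quotmod_pi (f u).
Proof.
move=> lf hf u; apply/quotmod_piP; rewrite -(linB lf); apply: hf.
by apply/quotmod_piP; rewrite quotmod_reprK.
Qed.

Definition quotmod_scale (a : C) := quotmod_lift (fun m => a *: m).

Lemma quotmod_scaleE a u : quotmod_scale a (quotmod_pi u) = quotmod_pi (a *: u).
Proof.
apply: quotmod_liftE => [b x y | m]; last exact: subspaceZ hS.1.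
by rewrite scalerDr !scalerA mulrC.
Qed.

Lemma quotmod_scaleA a b v :
  quotmod_scale a (quotmod_scale b v) = quotmod_scale (a * b) v.
Proof. by elim/quotmod_ind: v => v; rewrite !quotmod_scaleE scalerA. Qed.
Lemma quotmod_scale1 : left_id 1 quotmod_scale.
Proof. by elim/quotmod_ind => v; rewrite quotmod_scaleE scale1r. Qed.
Lemma quotmod_scaleDr : right_distributive quotmod_scale +%R.
Proof.
move=> a; elim/quotmod_ind=> u; elim/quotmod_ind=> v.
by rewrite -quotmod_piD !quotmod_scaleE scalerDr quotmod_piD.
Qed.
Lemma quotmod_scaleDl v : {morph quotmod_scale^~ v : a b / a + b}.
Proof.
by elim/quotmod_ind: v => v a b; rewrite !quotmod_scaleE scalerDl quotmod_piD.
Qed.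

HB.instance Definition _ := GRing.Zmodule_isLmodule.Build C quotmod_car
  quotmod_scaleA quotmod_scale1 quotmod_scaleDr quotmod_scaleDl.

Lemma quotmod_pi_linear : linear quotmod_pi.
Proof. by move=> a u v; rewrite quotmod_piD -quotmod_scaleE. Qed.

Definition quotmod_act x := quotmod_lift (glact x).

Lemma quotmod_actE x u : quotmod_act x (quotmod_pi u) = quotmod_pi (glact x u).
Proof. by apply: quotmod_liftE; [apply: glact_linear | apply: hS.2]. Qed.

Lemma quotmod_act_linear x : linear (quotmod_act x).
Proof.
move=> a; elim/quotmod_ind=> u; elim/quotmod_ind=> v.
by rewrite -quotmod_pi_linear !quotmod_actE glact_linear quotmod_pi_linear.
Qed.
Lemma quotmod_act_linearl m : linear (fun x => quotmod_act x m).
Proof.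
by elim/quotmod_ind: m => m a x y; rewrite !quotmod_actE glact_linearl quotmod_pi_linear.
Qed.
Lemma quotmod_act_bracket x y m :
  quotmod_act (mxbracket x y) m =
  quotmod_act x (quotmod_act y m) - quotmod_act y (quotmod_act x m).
Proof.
elim/quotmod_ind: m => m; rewrite !quotmod_actE glact_bracket.
exact: (linB quotmod_pi_linear).
Qed.

Definition quotmod : glmod C n :=
  GlMod quotmod_act_linear quotmod_act_linearl quotmod_act_bracket.

Definition quotmod_proj (m : M) : quotmod := quotmod_pi m.

Lemma quotmod_proj_hom : glhom quotmod_proj.
Proof.
split=> [|x m]; first exact: quotmod_pi_linear.
by rewrite -[LHS]quotmod_actE.
Qed.

Lemma quotmod_proj_surj z : exists y, quotmod_proj y = z.
Proof. by exists (quotmod_repr z); apply: quotmod_reprK. Qed.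

Lemma quotmod_proj0 m : quotmod_proj m = 0 <-> S m.
Proof.
have -> : (0 : quotmod) = quotmod_pi 0 by rewrite (lin0 quotmod_pi_linear).
by split=> [/quotmod_piP | h]; [rewrite subr0 | apply/quotmod_piP; rewrite subr0].
Qed.

Lemma sub_quot_exact : short_exact submod M quotmod.
Proof.
exists submod_val, quotmod_proj; split.
- exact: submod_val_hom.
- exact: quotmod_proj_hom.
- exact: submod_val_inj.
- exact: quotmod_proj_surj.
- by move=> y; rewrite -submod_valP; apply: quotmod_proj0.
Qed.

End SubQuotient.

(** * Weights *)

Section Weights.
Variables (C : fieldType) (n : nat).
Hypothesis natr_inj : injective (fun k : nat => k%:R : C).
Implicit Types (M N : glmod C n) (mu nu : 'rV[C]_n).

Lemma uact_linear M u : linear (@uact C n M u).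
Proof. exact: uterm_act_linear. Qed.

Lemma submodule_uact M (S : M -> Prop) u m : submodule S -> S m -> S (uact u m).
Proof.
case=> sS hS; rewrite /uact; move: (urepr u) m.
elim=> [c | x | s IHs t IHt | s IHs t IHt] m Sm /=.
- exact: subspaceZ.
- exact: hS.
- by apply: subspaceD; auto.
- by auto.
Qed.

Lemma glact0 M x : glact x (0 : M) = 0.
Proof. exact: lin0 (glact_linear x). Qed.

Lemma glact_sum M m (I : Type) (r : seq I) (P : pred I) (F : I -> 'M[C]_n) :
  glact (\sum_(i <- r | P i) F i) m = \sum_(i <- r | P i) glact (F i) m :> M.
Proof. exact: (lin_sum (glact_linearl m)). Qed.

Definition E (i j : 'I_n) : 'M[C]_n := delta_mx i j.

Lemma glact_mxE M (x : 'M[C]_n) (m : M) :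
  glact x m = \sum_i \sum_j x i j *: glact (E i j) m.
Proof.
rewrite {1}[x]matrix_sum_delta glact_sum; apply: eq_bigr => i _.
by rewrite glact_sum; apply: eq_bigr => j _; rewrite (linZ (glact_linearl m)).
Qed.

Lemma mxbracketE (i j k l : 'I_n) :
  mxbracket (E i j) (E k l) = (j == k)%:R *: E i l - (l == i)%:R *: E k j.
Proof.
rewrite /mxbracket /E !mul_delta_mx_cond.
by case: (j == k); case: (l == i); rewrite ?scale1r ?scale0r ?mulr1n ?mulr0n.
Qed.

Lemma glact_comm M (x y : 'M[C]_n) (m : M) :
  glact x (glact y m) = glact y (glact x m) + glact (mxbracket x y) m.
Proof. by rewrite glact_bracket addrC subrK. Qed.

Lemma E_cartan i : in_cartan (E i i).
Proof.
apply/is_diag_mxP => k l kl; rewrite mxE.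
by case: eqP => // ki; case: eqP => // li; move: kl; rewrite ki li eqxx.
Qed.

Lemma E_nplus (i j : 'I_n) : (i < j)%N -> in_nplus (E i j).
Proof.
move=> ij k l lk; rewrite mxE; case: eqP => // ki; case: eqP => // lj.
by move: lk; rewrite ki lj leqNgt ij.
Qed.

Lemma wt_eval_E mu i : wt_eval mu (E i i) = mu 0 i.
Proof.
rewrite /wt_eval (bigD1 i) //= mxE !eqxx mulr1 big1 ?addr0 // => j ji.
by rewrite mxE (negbTE ji) mulr0.
Qed.

Lemma weight_vectorP M mu (m : M) :
  weight_vector mu m <-> forall i, glact (E i i) m = mu 0 i *: m.
Proof.
split=> [h i | h x /is_diag_mxP hx].
  by rewrite h ?wt_eval_E //; apply: E_cartan.
rewrite glact_mxE /wt_eval scaler_suml; apply: eq_bigr => i _.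
rewrite (bigD1 i) //= h scalerA mulrC big1 ?addr0 // => j ji.
by rewrite hx ?scale0r // eq_sym.
Qed.

Lemma weight_subspace M mu : subspace (@weight_vector C n M mu).
Proof.
split=> [x _ | a u v hu hv x hx]; first by rewrite glact0 scaler0.
by rewrite glact_linear hu // hv // scalerDr !scalerA mulrC.
Qed.

Lemma glhom_weight M N (f : M -> N) mu m :
  glhom f -> weight_vector mu m -> weight_vector mu (f m).
Proof. by case=> lf hf hm x hx; rewrite -hf hm // (linZ lf). Qed.

Lemma glhom_uact M N (f : M -> N) u m : glhom f -> f (uact u m) = uact u (f m).
Proof.
case=> lf hf; rewrite /uact; move: (urepr u) m.
elim=> [c | x | s IHs t IHt | s IHs t IHt] m /=.
- exact: linZ.
- exact: hf.
- by rewrite (linD lf) IHs IHt.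
- by rewrite IHs IHt.
Qed.

Definition simple_wt (i j : 'I_n) : 'rV[C]_n := delta_mx 0 i - delta_mx 0 j.

Lemma weight_E M mu (m : M) i j :
  weight_vector mu m -> weight_vector (mu + simple_wt i j) (glact (E i j) m).
Proof.
move=> /weight_vectorP hm; apply/weight_vectorP => k.
rewrite glact_comm mxbracketE hm (linZ (glact_linear _)) !mxE eqxx /= scalerDl.
congr (_ + _); rewrite (linB (glact_linearl m)) !(linZ (glact_linearl m)) scalerBl.
rewrite (eq_sym k j).
by case: (eqVneq k i) => [<-|ki]; case: (eqVneq j k) => [->|jk];
  rewrite ?eqxx ?scale0r ?subrr.
Qed.

(* A summand of weight nu <> mu is removed by applying
   (E_qq - nu_q) / (mu_q - nu_q) with nu_q <> mu_q, which fixes weight mu. *)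
Lemma weight_proj M (S : M -> Prop) (I : eqType) (r : seq I) (wt : I -> 'rV[C]_n)
    (w : I -> M) mu :
  subspace S -> (forall h m, in_cartan h -> S m -> S (glact h m)) ->
  (forall i, i \in r -> weight_vector (wt i) (w i)) ->
  S (\sum_(i <- r) w i) -> S (\sum_(i <- r | wt i == mu) w i).
Proof.
move=> sS hS; have [k] := ubnP (count (fun i => wt i != mu) r).
elim: k => // k IH in r w *; rewrite ltnS => le hw Sr.
have [/hasP [i0 i0r ne]|no] := boolP (has (fun i => wt i != mu) r); last first.
  rewrite big_seq_cond (eq_bigl (fun i => i \in r)) -?big_seq // => i.
  by apply: andb_idr => ir; apply: contraNT no => ne; apply/hasP; exists i.
have [q hq] : exists q, wt i0 0 q != mu 0 q.
  apply/existsP; apply: contraNT ne; rewrite negb_exists => /forallP h.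
  by apply/eqP/rowP => q; apply/eqP; have /negPn := h q.
pose c := mu 0 q - wt i0 0 q.
have c0 : c != 0 by rewrite subr_eq0 eq_sym.
pose r' := [seq i <- r | wt i != wt i0].
pose w' i := (c^-1 * (wt i 0 q - wt i0 0 q)) *: w i.
have e : \sum_(i <- r') w' i =
    c^-1 *: (glact (E q q) (\sum_(i <- r) w i) - wt i0 0 q *: \sum_(i <- r) w i).
  rewrite (lin_sum (glact_linear _)) scaler_sumr -sumrB scaler_sumr.
  rewrite big_filter big_mkcond [LHS]big_seq [RHS]big_seq; apply: eq_bigr => i ir.
  rewrite (iffLR (weight_vectorP _ _) (hw i ir)) -scalerBl scalerA.
  by case: eqP => [->|//]; rewrite subrr mulr0 scale0r.
have -> : \sum_(i <- r | wt i == mu) w i = \sum_(i <- r' | wt i == mu) w' i.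
  rewrite big_filter_cond; apply: eq_big => [i|i /eqP e'].
    by case: eqP => [->|]; rewrite ?andbF // eq_sym ne.
  by rewrite /w' e' mulVf // scale1r.
apply: IH => [|i|].
- apply: leq_trans le; rewrite count_filter -[X in (_ < X)%N]size_filter.
  rewrite -(count_predC (fun i => wt i != wt i0)) -addn1.
  rewrite (eq_count (_ : _ =1 predI (fun i => wt i != wt i0) (fun i => wt i != mu))).
    rewrite -count_filter leq_add2l -has_count; apply/hasP; exists i0 => /=.
      by rewrite mem_filter ne.
    by rewrite eqxx.
  by move=> i /=; rewrite andbC.
- rewrite mem_filter => /andP [_ ir]; apply: subspaceZ (hw i ir).
  exact: weight_subspace.
- rewrite e; apply: subspaceZ => //; apply: subspaceB => //; last exact: subspaceZ.
  by apply: hS => //; apply: E_cartan.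
Qed.

Lemma weight_component M (I : eqType) (r : seq I) (wt : I -> 'rV[C]_n)
    (w : I -> M) mu m :
  (forall i, i \in r -> weight_vector (wt i) (w i)) -> weight_vector mu m ->
  m = \sum_(i <- r) w i -> m = \sum_(i <- r | wt i == mu) w i.
Proof.
move=> hw hm e.
(* [None] indexes an additional summand [- m] of weight [mu]. The total is then 0 and [weight_proj]
   applies to the zero subspace. *)
pose wt' i := if i is Some j then wt j else mu.
pose w' i := if i is Some j then w j else - m.
have s0 : subspace (fun v : M => v = 0).
  by split=> // a u v -> ->; rewrite scaler0 addr0.
have := @weight_proj M (fun v => v = 0) _ (None :: map Some r) wt' w' mu s0.
rewrite !big_cons /= eqxx !big_map /= -e addNr => h.
apply/esym/eqP; rewrite -subr_eq0 addrC; apply/eqP/h => //.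
- by move=> x v _ ->; rewrite glact0.
- move=> [i|]; rewrite inE /=.
    by rewrite mem_map => [/hw|? ? []].
  move=> _; rewrite -scaleN1r; apply: subspaceZ hm; exact: weight_subspace.
Qed.

Lemma free_weights M (s : seq ('rV[C]_n * M)) :
  (forall p, p \in s -> p.2 != 0 /\ weight_vector p.1 p.2) -> uniq (map fst s) ->
  free_seq (map snd s).
Proof.
move=> hs us c e i; rewrite size_map => hi.
have s0 : subspace (fun v : M => v = 0).
  by split=> // a u v -> ->; rewrite scaler0 addr0.
have {}e : \sum_(j <- index_enum 'I_(size s)) c j *: (s`_j).2 = 0.
  rewrite -[RHS]e /lcomb.
  rewrite -[LHS](big_mkord xpredT (fun j => c j *: (s`_j).2)).
  rewrite -[RHS](big_mkord xpredT (fun j => c j *: (map snd s)`_j)) size_map.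
  by apply: eq_big_nat => j /andP [_ hj]; rewrite (nth_map 0).
have := @weight_proj M (fun v => v = 0) _ (index_enum _) (fun j : 'I_(size s) => (s`_j).1)
   (fun j => c j *: (s`_j).2) (s`_i).1 s0.
have h1 x (v : M) : in_cartan x -> v = 0 -> glact x v = 0.
  by move=> _ ->; rewrite glact0.
have h2 (j : 'I_(size s)) :
    j \in index_enum 'I_(size s) -> weight_vector (s`_j).1 (c j *: (s`_j).2).
  have [_ hj] := hs _ (mem_nth 0 (ltn_ord j)).
  by move=> _; apply: subspaceZ hj; apply: weight_subspace.
move=> /(_ h1 h2 e).
rewrite (bigD1 (Ordinal hi)) //= big1 => [|j /andP [/eqP ej ji]].
  have [/negbTE s0i _] := hs _ (mem_nth 0 hi).
  by rewrite addr0 => /eqP; rewrite scaler_eq0 s0i orbF => /eqP.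
move: ji; rewrite -val_eqE /= => /eqP []; apply/eqP.
by rewrite -(nth_uniq 0 _ _ us) ?size_map // !(nth_map 0) // ej.
Qed.

(** Pairing with (n, n-1, ..., 1), which gives e_i - e_j the value j - i; it is positive on positive
    roots. *)
Definition hgt mu : C := \sum_(q < n) (n - q)%:R * mu 0 q.

Lemma hgtD mu nu : hgt (mu + nu) = hgt mu + hgt nu.
Proof. by rewrite /hgt -big_split; apply: eq_bigr => q _; rewrite mxE mulrDr. Qed.

Lemma hgtN mu : hgt (- mu) = - hgt mu.
Proof. by rewrite /hgt -sumrN; apply: eq_bigr => q _; rewrite mxE mulrN. Qed.

Lemma hgt_simple (i j : 'I_n) : (i < j)%N -> hgt (simple_wt i j) = (j - i)%:R.
Proof.
move=> ij; have D (k : 'I_n) : \sum_(q < n) (n - q)%:R * (q == k)%:R = (n - k)%:R :> C.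
  rewrite (bigD1 k) //= eqxx mulr1 big1 ?addr0 // => q qk.
  by rewrite (negbTE qk) mulr0.
rewrite /hgt; under eq_bigr => q _ do rewrite !mxE eqxx /= mulrDr mulrN.
rewrite big_split /= sumrN !D -natrB; last by rewrite leq_sub2l // ltnW.
by congr _%:R; have := ltn_ord i; have := ltn_ord j; lia.
Qed.

(* Words of length l in the E_ij with j < i (a spanning set of n_-), applied to
   the elements of P. *)
Inductive nword M (P : M -> Prop) : nat -> M -> Prop :=
| nword0 m : P m -> nword P 0 m
| nwordS (i j : 'I_n) l m : (j < i)%N -> nword P l m -> nword P l.+1 (glact (E i j) m).

(** Each letter lowers the height by at least 1, so the drop [k] bounds the length of the word, and
    [k = 0] leaves only the empty word. *)
Lemma nword_weight M (P : M -> Prop) (Q : 'rV[C]_n -> Prop) l m :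
  (forall m, P m -> exists2 nu, Q nu & weight_vector nu m) -> nword P l m ->
  exists nu mu k, [/\ Q nu, weight_vector mu m, (l <= k)%N, hgt nu = hgt mu + k%:R &
     (k = 0%N -> mu = nu)].
Proof.
move=> hP; elim=> {l m} [m /hP [nu Qnu hm] | i j l m ji _ [nu [mu [k [Qnu hm lk e _]]]]].
  by exists nu, nu, 0%N; rewrite addr0.
exists nu, (mu + simple_wt i j), (k + (i - j))%N; split=> //.
- exact: weight_E.
- by rewrite -addn1 leq_add // subn_gt0.
- rewrite hgtD e -addrA; congr (_ + _); rewrite natrD; have := hgt_simple ji.
  rewrite /simple_wt -(opprB (delta_mx 0 i)) hgtN => /eqP; rewrite eqr_oppLR => /eqP ->.
  by rewrite addrCA addNr addr0.
- by move/eqP; rewrite addn_eq0 subn_eq0 leqNgt ji andbF.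
Qed.

Definition nspan M (P : M -> Prop) (L : nat) : M -> Prop :=
  lspan (fun m => exists2 l, (l <= L)%N & nword P l m).

Lemma nspan_le M (P : M -> Prop) L L' m : (L <= L')%N -> nspan P L m -> nspan P L' m.
Proof.
move=> le; apply: lspan_mono => v [l lL hv]; exists l => //; exact: leq_trans lL le.
Qed.

Lemma nspan_E M (P : M -> Prop) (i j : 'I_n) L m :
  (j < i)%N -> nspan P L m -> nspan P L.+1 (glact (E i j) m).
Proof.
move=> ji /(lspan_image (glact_linear (E i j))).
apply: lspan_mono => _ [v [l lL hv] ->]; exists l.+1 => //; exact: nwordS.
Qed.

Section BorelStable.
Variables (M : glmod C n) (P : M -> Prop).
Hypothesis hP : forall (i j : 'I_n) m, (i <= j)%N -> P m -> lspan P (glact (E i j) m).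

(** Moving E_ij past the first letter creates a bracket that acts on a word shorter by one, so even
    a lowering operator in it does not exceed length [l]. This is the spanning half of the
    triangular decomposition: U(n_-) P is already a submodule. *)
Lemma nword_borel l m (i j : 'I_n) : (i <= j)%N -> nword P l m ->
  nspan P l (glact (E i j) m).
Proof.
move=> + h; elim: h i j => {l m} [m Pm i j ij | k p l m pk hm IH i j ij].
  by apply: lspan_mono (hP ij Pm) => v Pv; exists 0%N => //; apply: nword0.
have any a b : nspan P l.+1 (glact (E a b) m).
  case: (leqP a b) => [/IH|ba]; first exact: nspan_le.
  by apply: nspan_E => //; apply: lspan_in; exists l.
rewrite glact_comm; apply: subspaceD; first exact: lspan_subspace.
  by apply: nspan_E => //; apply: IH.
rewrite mxbracketE (linB (glact_linearl m)) !(linZ (glact_linearl m)).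
apply: subspaceB; first exact: lspan_subspace.
  by apply: subspaceZ; [apply: lspan_subspace | apply: any].
by apply: subspaceZ; [apply: lspan_subspace | apply: any].
Qed.

Lemma nword_submodule : submodule (lspan (fun m => exists l, nword P l m)).
Proof.
split=> [|x m]; first exact: lspan_subspace.
move/(lspan_image (glact_linear x)); apply: lspan_min; first exact: lspan_subspace.
move=> _ [v [l hv] ->]; rewrite glact_mxE.
apply: subspace_sum => [|i _]; first exact: lspan_subspace.
apply: subspace_sum => [|j _]; first exact: lspan_subspace.
apply: subspaceZ; first exact: lspan_subspace.
case: (leqP i j) => [ij|ji]; last by apply: lspan_in; exists l.+1; apply: nwordS.
by apply: lspan_mono (nword_borel ij hv) => w [l' _ hw]; exists l'.
Qed.

End BorelStable.

Lemma fin_span_nword M (P : M -> Prop) l : fin_span P -> fin_span (nword P l).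
Proof.
move=> hP; elim: l => [|l IH].
  apply: fin_span_mono hP => v h; apply: lspan_in.
  by inversion h.
apply: (@fin_span_mono _ _ (fun v => exists p : 'I_n * 'I_n,
    exists2 w, nword P l w & v = glact (E p.1 p.2) w)).
  move=> v h; apply: lspan_in; inversion h as [|i j l' w ji hw]; subst.
  by exists (i, j), w.
apply: fin_span_bigcup => p.
exact: (fin_span_image (glact_linear (E p.1 p.2)) IH).
Qed.

Lemma fin_span_nspan M (P : M -> Prop) L : fin_span P -> fin_span (nspan P L).
Proof.
move=> hP; apply: (@fin_span_mono _ _ (fun v => exists l : 'I_L.+1, nword P l v)).
  apply: lspan_mono => v [l lL hv].
  by exists (inord l); rewrite inordK.
by apply: fin_span_bigcup => l; apply: fin_span_nword.
Qed.

Lemma hgt_bound mu (s : seq 'rV[C]_n) :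
  exists L, forall nu k, nu \in s -> hgt nu = hgt mu + k%:R -> (k <= L)%N.
Proof.
elim: s => [|nu s [L hL]]; first by exists 0%N.
have [[k e]|no] := pselect (exists k, hgt nu = hgt mu + k%:R).
  exists (maxn k L) => nu' k'; rewrite inE => /predU1P [->|/hL h /h].
    by rewrite e => /addrI/natr_inj <-; apply: leq_maxl.
  by move=> h'; apply: leq_trans h' (leq_maxr _ _).
exists L => nu' k'; rewrite inE => /predU1P [-> e|]; last exact: hL.
by case: no; exists k'.
Qed.

(** A word that lands in weight [mu] is no longer than the height it loses, and this loss is bounded
    over [s]. Hence finitely many words span the weight space. *)
Lemma fin_span_weight M (P : M -> Prop) (s : seq 'rV[C]_n) mu : fin_span P ->
  (forall m, P m -> exists2 nu, nu \in s & weight_vector nu m) ->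
  (forall m, lspan (fun m => exists l, nword P l m) m) ->
  fin_span (@weight_vector C n M mu).
Proof.
move=> fP hP gen; have [L hL] := hgt_bound mu s.
apply: fin_span_mono (fin_span_nspan L fP) => m hm; apply: lspan_in.
have /lspan_sumP [r hr e] := gen m.
have /choice [wt hwt] (p : C * M) : exists mu', p \in r -> weight_vector mu' p.2 /\
    (mu' = mu -> nspan P L p.2).
  have [/hr [l hw]|_] := boolP (p \in r); last by exists 0.
  have [nu [mu' [k [nus hmu lk ek _]]]] := nword_weight hP hw.
  exists mu' => _; split=> // e'; apply: lspan_in; exists l => //.
  by apply: leq_trans lk (hL _ _ nus _); rewrite ek e'.
rewrite (@weight_component _ _ r wt (fun p => p.1 *: p.2) mu m _ hm e) => [|p pr].
  rewrite big_seq_cond; apply: subspace_sum => [|p /andP [/hwt [_ h] /eqP /h hp]].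
    exact: lspan_subspace.
  by apply: subspaceZ hp; apply: lspan_subspace.
have [hp _] := hwt p pr; apply: subspaceZ hp; exact: weight_subspace.
Qed.

End Weights.

(** * Locally finite modules and Verma modules *)

Section LocallyFinite.
Variables (C : fieldType) (n : nat).
Implicit Types (M N : glmod C n) (mu nu lam : 'rV[C]_n).

Lemma in_Unplus_subspace M (m : M) : subspace (in_Unplus m).
Proof.
split=> [|a u v hu hv] S hS hx Sm.
  have := hS (-1) m m Sm Sm; by rewrite scaleN1r addNr.
by apply: (hS); [apply: hu | apply: hv].
Qed.

Lemma in_Unplus_act M (m u : M) x : in_nplus x -> in_Unplus m u -> in_Unplus m (glact x u).
Proof. by move=> hx hu S hS hS' Sm; apply: (hS') => //; apply: hu. Qed.

Lemma in_Unplus_self M (m : M) : in_Unplus m m.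
Proof. by move=> S _ _. Qed.

Lemma in_Unplus_min M (m : M) (S : M -> Prop) : subspace S ->
  (forall x u, in_nplus x -> S u -> S (glact x u)) -> S m ->
  forall v, in_Unplus m v -> S v.
Proof. by case=> S0 hS hx Sm v; apply. Qed.

Lemma in_spanP M (s : seq M) m : in_span s m <-> sspan s m.
Proof.
rewrite lspan_seqP; split=> [[c ->]|[c ->]]; last by exists (fun i => c i).
exists (fun k => if insub k is Some j then c j else 0).
by apply: eq_bigr => i _; rewrite valK.
Qed.

(** This and the next two definitions restate the conditions of [catO] through spans and submodules;
    [hss] is semisimplicity over the Cartan subalgebra. *)
Definition locfin M := forall m : M, fin_span (in_Unplus m).
Definition hss M := forall m : M, lspan (fun v => exists mu, weight_vector mu v) m.
Definition fingen M :=
  exists s : seq M, forall S, submodule S -> (forall m, m \in s -> S m) -> forall m : M, S m.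

Lemma locfinP M :
  locfin M <-> forall m : M, exists s : seq M, forall m', in_Unplus m m' -> in_span s m'.
Proof.
by split=> h m; have [t ht] := h m; exists t => v /ht /in_spanP.
Qed.

Lemma hssP M : hss M <->
  forall m : M, exists k (mu : 'I_k -> 'rV[C]_n) (w : 'I_k -> M),
        (forall i, weight_vector (mu i) (w i)) /\ m = \sum_(i < k) w i.
Proof.
split=> h m; last first.
  have [k [mu [w [hw ->]]]] := h m.
  apply: subspace_sum => [|i _]; first exact: lspan_subspace.
  by apply: lspan_in; exists (mu i).
have /lspan_sumP [r hr ->] := h m.
have /choice [mu hmu] (i : 'I_(size r)) : exists mu, weight_vector mu (r`_i).2.
  exact/hr/mem_nth.
exists (size r), mu, (fun i => (r`_i).1 *: (r`_i).2); split=> [i|].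
  apply: subspaceZ (hmu i); exact: weight_subspace.
by rewrite (big_nth 0) big_mkord.
Qed.

Lemma fingenP M : fingen M <->
  exists s : seq M, forall m, exists u : 'I_(size s) -> Ugl C n,
        m = \sum_(i < size s) uact (u i) s`_i.
Proof.
split=> [[s hs] | [s hs]]; exists s; last first.
  move=> S sS hS m; have [u ->] := hs m.
  apply: subspace_sum => [|i _]; first exact: sS.1.
  by apply: submodule_uact => //; apply/hS/mem_nth.
have uact0 (m : M) : uact (0 : Ugl C n) m = 0.
  by rewrite -[0 : Ugl C n](scale0r 0) uactZ scale0r.
apply: hs => [|m ms].
  split; first split.
  - by exists (fun=> 0); rewrite big1.
  - move=> a v w [u ->] [u' ->]; exists (fun i => a *: u i + u' i).
    rewrite scaler_sumr -big_split; apply: eq_bigr => i _.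
    by rewrite uactD uactZ.
  - move=> x m [u ->]; exists (fun i => ugen x * u i).
    rewrite (lin_sum (glact_linear x)); apply: eq_bigr => i _.
    by rewrite uactM uact_gen.
have h : (index m s < size s)%N by rewrite index_mem.
exists (fun i => if i == Ordinal h then 1 else 0).
rewrite (bigD1 (Ordinal h)) //= eqxx uact1 nth_index // big1 ?addr0 // => i /negbTE ->.
exact: uact0.
Qed.

Lemma catOP M : catO M <-> [/\ fingen M, hss M & locfin M].
Proof.
by split=> -[/fingenP h1 /hssP h2 /locfinP h3].
Qed.

Lemma hss_submodule M :
  @submodule C n M (lspan (fun v => exists mu, weight_vector mu v)).
Proof.
split=> [|x m]; first exact: lspan_subspace.
move/(lspan_image (glact_linear x)); apply: lspan_min; first exact: lspan_subspace.
move=> _ [v [mu hv] ->]; rewrite glact_mxE.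
apply: subspace_sum => [|i _]; first exact: lspan_subspace.
apply: subspace_sum => [|j _]; first exact: lspan_subspace.
apply: subspaceZ; first exact: lspan_subspace.
by apply: lspan_in; exists (mu + simple_wt C i j); apply: weight_E.
Qed.

(** For finiteness at x m: the finite-dimensional space U(n_+) m + gl_n U(n_+) m, spanned by [T],
    contains x m and is stable under n_+, by y (x w) = x (y w) + [y, x] w. *)
Lemma locfin_submodule M : @submodule C n M (fun m => fin_span (in_Unplus m)).
Proof.
split; first split.
- exists [::]; apply: in_Unplus_min; [exact: lspan_subspace | | exact: lspan0].
  move=> x u _ /lspan_seqP [c ->]; rewrite /lcomb big_ord0 glact0; exact: lspan0.
- move=> a u v hu hv.
  apply: (@fin_span_mono _ _ (fun w => exists b : bool, in_Unplus (if b then u else v) w)).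
    apply: in_Unplus_min; first exact: lspan_subspace.
      move=> x w hx /(lspan_image (glact_linear x)); apply: lspan_mono.
      by move=> _ [y [b hb] ->]; exists b; apply: in_Unplus_act.
    apply: (lspan_subspace _).2; apply: lspan_in.
      by exists true; apply: in_Unplus_self.
    by exists false; apply: in_Unplus_self.
  by apply: fin_span_bigcup; case.
- move=> x m hm.
  pose T v := exists p : option ('I_n * 'I_n), exists2 w, in_Unplus m w &
    v = if p is Some q then glact (E C q.1 q.2) w else w.
  apply: (@fin_span_mono _ _ T); last first.
    apply: fin_span_bigcup => -[q|]; last by apply: fin_span_mono hm => _ [w hw ->]; apply: lspan_in.
    exact: (fin_span_image (glact_linear (E C q.1 q.2)) hm).
  have act y w : in_Unplus m w -> lspan T (glact y w).
    move=> hw; rewrite glact_mxE.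
    apply: subspace_sum => [|i _]; first exact: lspan_subspace.
    apply: subspace_sum => [|j _]; first exact: lspan_subspace.
    apply: subspaceZ; first exact: lspan_subspace.
    by apply: lspan_in; exists (Some (i, j)), w.
  apply: in_Unplus_min; [exact: lspan_subspace | | by apply: act; apply: in_Unplus_self].
  move=> y u hy /(lspan_image (glact_linear y)); apply: lspan_min; first exact: lspan_subspace.
  move=> _ [_ [[q|] [w hw ->]] ->]; last exact: act.
  rewrite glact_comm; apply: subspaceD; first exact: lspan_subspace.
    by apply: act; apply: in_Unplus_act.
  exact: act.
Qed.

End LocallyFinite.

Section Verma.
Variables (C : fieldType) (n : nat).
Implicit Types (M N : glmod C n) (mu nu lam : 'rV[C]_n).

Definition highest M mu (v : M) : Prop :=
  weight_vector mu v /\ forall x, in_nplus x -> glact x v = 0.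

Definition vgen lam : verma lam := vpi lam 1.

Lemma upi_const (c : C) : upi (UConst c) = c%:A :> Ugl C n.
Proof.
change (upi (UConst c) = uscale c (upi (UConst 1)) :> Ugl C n).
by rewrite uscale_pi; apply/upiP; have := @ueq_constM C n c 1; rewrite mulr1; exact.
Qed.

Lemma verma_uact lam u (v : verma lam) : uact u v = vmul u v.
Proof.
elim/upi_ind: u v => s v; rewrite uact_pi.
elim: s v => [c|x|s IHs t IHt|s IHs t IHt] v /=.
- by rewrite upi_const -vscaleE.
- by [].
- by rewrite -uadd_pi IHs IHt [RHS]vmulDl.
- by rewrite -umul_pi IHs IHt vmulA.
Qed.

Lemma verma_uact_gen lam u : uact u (vgen lam) = vpi lam u.
Proof. by rewrite verma_uact vmul_pi mulr1. Qed.

Lemma vgen_highest lam : highest lam (vgen lam).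
Proof.
have pi0 u : u \in verma_ideal lam -> vpi lam u = 0.
  move=> hu; have -> : (0 : vcar lam) = vpi lam 0.
    by apply: (addrI (vpi lam 0)); rewrite -vpiD !addr0.
  by apply/vpiP; rewrite subr0.
split=> x hx; last first.
  rewrite -uact_gen verma_uact_gen; apply: pi0.
  by apply/asboolP => S hS h _; apply: h.
apply/eqP; rewrite -subr_eq0; apply/eqP.
rewrite -uact_gen -[X in _ - _ *: X]uact1 -uactZ -scaleN1r -uactZ -uactD.
rewrite verma_uact_gen scaleN1r; apply: pi0.
by apply/asboolP => S hS _; apply.
Qed.

Lemma highest_ideal M mu (v : M) u :
  highest mu v -> u \in verma_ideal mu -> uact u v = 0.
Proof.
case=> hw hn /asboolP h.
have uact0 : uact (0 : Ugl C n) v = 0.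
  by rewrite -[0 : Ugl C n](scale0r 0) uactZ scale0r.
apply: (h (fun u => uact u v = 0)).
- split=> // [a b ha hb | a b hb]; first by rewrite uactD ha hb addr0.
  by rewrite uactM hb (lin0 (uact_linear _)).
- by move=> x hx; rewrite uact_gen hn.
- move=> x hx; rewrite uactD uact_gen hw // -scaleN1r !uactZ uact1.
  by rewrite scaleN1r subrr.
Qed.

(** The universal property of M(lam): the class of u goes to u v. It is independent of the
    representative when [v] is highest of weight [lam]. *)
Definition verma_map M (v : M) lam (w : verma lam) : M := uact (vrepr w) v.

Lemma verma_map_pi M lam (v : M) u : highest lam v ->
  verma_map v (vpi lam u : verma lam) = uact u v.
Proof.
move=> hv; apply/eqP; rewrite -subr_eq0; apply/eqP.
have -> : verma_map v (vpi lam u : verma lam) - uact u v =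
   uact (vrepr (vpi lam u) - u) v.
  by rewrite /verma_map uactD -scaleN1r -uactZ scaleN1r.
apply: highest_ideal hv _; by apply/vpiP; rewrite vreprK.
Qed.

Lemma verma_map_hom M lam (v : M) : highest lam v -> glhom (@verma_map M v lam).
Proof.
move=> hv; split=> [a|x m].
  elim/vpi_ind => u; elim/vpi_ind => w; rewrite !(verma_map_pi _ hv).
  rewrite -uactZ -uactD -(verma_map_pi _ hv) vpiD; congr (verma_map v (_ + _)).
  by rewrite vscaleE vmul_pi -scalerAl mul1r.
elim/vpi_ind: m => u; rewrite (verma_map_pi _ hv).
by rewrite -uact_gen verma_uact vmul_pi (verma_map_pi _ hv) uactM uact_gen.
Qed.

Lemma verma_map_gen M lam (v : M) : highest lam v -> verma_map v (vgen lam) = v.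
Proof. by move=> hv; rewrite (verma_map_pi _ hv) uact1. Qed.

Lemma verma_gen lam (S : verma lam -> Prop) : submodule S -> S (vgen lam) ->
  forall m, S m.
Proof.
move=> sS Sg; elim/vpi_ind => u; rewrite -verma_uact_gen; exact: submodule_uact.
Qed.

Lemma verma_catO lam : catO (verma lam).
Proof.
apply/catOP; split.
- by exists [:: vgen lam] => S sS hS; apply: verma_gen => //; apply: hS; apply: mem_head.
- apply: verma_gen; first exact: hss_submodule.
  by apply: lspan_in; exists lam; case: (vgen_highest lam).
- apply: verma_gen; first exact: locfin_submodule.
  exists [:: vgen lam]; apply: in_Unplus_min; first exact: lspan_subspace.
    move=> x u hx /(lspan_image (glact_linear x)); apply: lspan_min.
      exact: lspan_subspace.
    move=> _ [v + ->]; rewrite inE => /eqP ->.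
    by rewrite (vgen_highest lam).2 //; apply: lspan0.
  by apply: lspan_in; apply: mem_head.
Qed.

Lemma verma_nword lam (m : verma lam) :
  lspan (fun m => exists l, nword (fun v : verma lam => v = vgen lam) l m) m.
Proof.
apply: verma_gen; last by apply: lspan_in; exists 0%N; apply: nword0.
apply: nword_submodule => i j v; rewrite leq_eqVlt => /orP [/eqP /val_inj <-|ij] ->.
  rewrite (vgen_highest lam).1; last exact: E_cartan.
  by apply: subspaceZ; [apply: lspan_subspace | apply: lspan_in].
by rewrite (vgen_highest lam).2; [apply: lspan0 | apply: E_nplus].
Qed.

Lemma Ucentral_gen (z : Ugl C n) M (m : M) x :
  Ucentral z -> glact x (uact z m) = uact z (glact x m).
Proof. by move=> hz; rewrite -!uact_gen -!uactM hz. Qed.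

Section Char0.
Hypothesis natr_inj : injective (fun k : nat => k%:R : C).

(** Keeps the words of weight [mu] in an expansion of [m]. Since a word is no longer than its height
    drop, at [k = 0] only the generator is left. *)
Lemma verma_weight_terms lam mu (m : verma lam) : weight_vector mu m ->
  exists2 r : seq (C * verma lam), m = \sum_(p <- r) p.1 *: p.2 &
    forall p, p \in r -> exists k, [/\ hgt lam = hgt mu + k%:R, k = 0%N -> mu = lam
      & k = 0%N -> p.2 = vgen lam].
Proof.
move=> hm; have /lspan_sumP [r hr e] := verma_nword m.
have h p : p \in r -> exists mu', weight_vector mu' p.2 /\
   exists k, [/\ hgt lam = hgt mu' + k%:R, k = 0%N -> mu' = lam & k = 0%N -> p.2 = vgen lam].
  move=> /hr [l hw].
  have hP (v : verma lam) : v = vgen lam -> exists2 nu, nu = lam & weight_vector nu v.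
    by move=> ->; exists lam => //; case: (vgen_highest lam).
  have [nu [mu' [k [-> hmu lk ek e0]]]] := nword_weight hP hw.
  exists mu'; split=> //; exists k; split=> // k0.
  by move: lk hw; rewrite k0 leqn0 => /eqP -> hw; inversion hw.
have /choice [wt hwt] p : exists mu', p \in r -> weight_vector mu' p.2 /\
   exists k, [/\ hgt lam = hgt mu' + k%:R, k = 0%N -> mu' = lam & k = 0%N -> p.2 = vgen lam].
  have [/h [mu' H]|_] := boolP (p \in r); [by exists mu' | by exists 0].
exists [seq p <- r | wt p == mu].
  rewrite big_filter; apply: weight_component hm e => p pr.
  have [hp _] := hwt p pr; apply: subspaceZ hp; exact: weight_subspace.
by move=> p; rewrite mem_filter => /andP [/eqP <- /hwt [_]].
Qed.

Lemma verma_weight_hgt lam mu (m : verma lam) : weight_vector mu m -> m != 0 ->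
  exists2 k, hgt lam = hgt mu + k%:R & (k = 0%N -> mu = lam).
Proof.
case/verma_weight_terms => -[|p r] -> h; first by rewrite big_nil eqxx.
by move=> _; have [k [e e0 _]] := h p (mem_head _ _); exists k.
Qed.

Lemma verma_weight_top lam (m : verma lam) : weight_vector lam m ->
  exists c : C, m = c *: vgen lam.
Proof.
case/verma_weight_terms => r -> h; exists (\sum_(p <- r) p.1).
rewrite scaler_suml !big_seq; apply: eq_bigr => p /h [k [e _ ->//]].
by apply: natr_inj; apply: (addrI (hgt lam)); rewrite -e addr0.
Qed.

(** A central z preserves the top weight space, which is a line, and its scalar there spreads to the
    whole module. So the set in [theta] is inhabited and [xget] does not return its default. *)
Lemma theta_verma lam z (m : verma lam) : Ucentral z -> uact z m = theta lam z *: m.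
Proof.
move=> hz; move: m.
suff h : exists c : C, forall m : verma lam, uact z m = c *: m.
  by have := xgetPex 0 h; apply.
have [c hc] : exists c, uact z (vgen lam) = c *: vgen lam.
  apply: verma_weight_top => x hx; rewrite Ucentral_gen // (vgen_highest lam).1 //.
  exact: linZ (uact_linear _) _ _.
exists c; apply: verma_gen => //; split; first split.
- by rewrite (lin0 (uact_linear _)) scaler0.
- by move=> a u v hu hv; rewrite uact_linear hu hv scalerDr !scalerA mulrC.
- by move=> x m hm; rewrite -Ucentral_gen // hm (linZ (glact_linear _)).
Qed.

Lemma theta_highest M mu (v : M) z : Ucentral z -> highest mu v ->
  uact z v = theta mu z *: v.
Proof.
move=> hz hv; have [lf hf] := verma_map_hom hv.
rewrite -(verma_map_gen hv) -(glhom_uact z (vgen mu) (verma_map_hom hv)).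
by rewrite theta_verma // (linZ lf).
Qed.

End Char0.
End Verma.

(** * Fock modules *)

(** The origin of the shift n - 1 - j: it counts the rows below row j of the Fock variables, and
    later the lowering terms in the Gelfand recursion. *)
Lemma sum_gt_ord n (j : 'I_n) : (\sum_(p < n) (j < p)%N)%N = (n - 1 - j)%N.
Proof.
rewrite -(big_mkord xpredT (fun p => (j < p) : nat)).
rewrite (@big_cat_nat _ _ _ j.+1) //= ?ltn_ord // big_nat_cond big1 => [|p].
  rewrite big_nat_cond (eq_bigr (fun=> 1%N)) => [|p /andP [/andP [-> _] _]//].
  by rewrite -big_nat_cond sum_nat_const_nat muln1 add0n; lia.
by rewrite andbT /= ltnS => pj; rewrite ltnNge pj.
Qed.

Section Fock.
Variables (C : fieldType) (n : nat) (m : 'I_n -> C).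

Local Notation idx := {ffun 'I_n * 'I_n -> int}.
(* A point of fock is the family of coefficients of a formal sum of monomials
   in variables indexed by pairs (row, column). *)
Definition fock : Type := idx -> C^o.
HB.instance Definition _ := GRing.Lmodule.on fock.
Implicit Types (F G : fock) (b : idx).

Definition unit_idx (a : 'I_n * 'I_n) (s : int) : idx :=
  [ffun c => if c == a then s else 0].

(** Multiplication, differentiation and their Fourier transforms are all weighted shifts of one
    exponent, and shifts in different variables commute. *)
Definition wshift a (s : int) (c : int -> C) (F : fock) : fock :=
  fun b => c (b a) * F (b - unit_idx a s).

Lemma wshift_linear a s c : linear (wshift a s c).
Proof.
move=> k F G; apply/funext => b; rewrite /wshift.
change (c (b a) * (k * F (b - unit_idx a s) + G (b - unit_idx a s)) =
  k * (c (b a) * F (b - unit_idx a s)) + c (b a) * G (b - unit_idx a s)).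
by ring.
Qed.

Lemma unit_idxE a s c : unit_idx a s c = if c == a then s else 0.
Proof. by rewrite ffunE. Qed.

Lemma unit_idxK a s s' b : s + s' = 0 -> b - unit_idx a s - unit_idx a s' = b.
Proof.
move=> e; rewrite -addrA -opprD (_ : unit_idx a s + _ = 0) ?subr0 //.
by apply/ffunP => c; rewrite !ffunE; case: (c == a); rewrite ?e ?addr0.
Qed.

Lemma wshift_comm a a' s s' c c' F : a != a' ->
  wshift a s c (wshift a' s' c' F) = wshift a' s' c' (wshift a s c F).
Proof.
move=> ne; apply/funext => b; rewrite /wshift !ffunE [a' == a]eq_sym.
rewrite (negbTE ne) !oppr0 !addr0 mulrCA.
by rewrite -!addrA [- unit_idx a s - _]addrC.
Qed.

(* The Weyl algebra generators x_pj and d_pj. For j < p they are Fourier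
   transformed, x = - d/dy and d = y, so that row p of the vacuum has weight
   - (e_1 + ... + e_p) + m_p e_(p+1) in the numbering from 1. *)
Definition mulx (a : 'I_n * 'I_n) : fock -> fock :=
  if (a.2 < a.1)%N then wshift a (-1) (fun k => - (k + 1)%:~R) else wshift a 1 (fun=> 1).

Definition derx (a : 'I_n * 'I_n) : fock -> fock :=
  if (a.2 < a.1)%N then wshift a 1 (fun=> 1)
  else wshift a (-1) (fun k => (k + 1)%:~R + (if a.2 == a.1 then m a.1 else 0)).

Lemma mulx_linear a : linear (mulx a).
Proof. by rewrite /mulx; case: ifP => _; apply: wshift_linear. Qed.

Lemma derx_linear a : linear (derx a).
Proof. by rewrite /derx; case: ifP => _; apply: wshift_linear. Qed.

Lemma mulx_comm a a' F : mulx a (mulx a' F) = mulx a' (mulx a F).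
Proof.
have [->//|ne] := eqVneq a a'.
by rewrite /mulx; case: ifP => _; case: ifP => _; exact: wshift_comm ne.
Qed.

Lemma derx_comm a a' F : derx a (derx a' F) = derx a' (derx a F).
Proof.
have [->//|ne] := eqVneq a a'.
by rewrite /derx; case: (a.2 < a.1)%N; case: (a'.2 < a'.1)%N; exact: wshift_comm ne.
Qed.

Lemma derx_mulx a a' F :
  derx a (mulx a' F) = mulx a' (derx a F) + (a == a')%:R *: F.
Proof.
have [<-|ne] := eqVneq a a'; last first.
  rewrite scale0r addr0 /mulx /derx.
  by case: (a.2 < a.1)%N; case: (a'.2 < a'.1)%N; exact: wshift_comm ne.
rewrite scale1r; apply/funext => b; rewrite /mulx /derx; case: (a.2 < a.1)%N.
  change (wshift a 1 (fun=> 1) (wshift a (-1) (fun k => - (k + 1)%:~R) F) b =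
    wshift a (-1) (fun k => - (k + 1)%:~R) (wshift a 1 (fun=> 1) F) b + F b :> C).
  rewrite /wshift !unit_idxK // !ffunE eqxx !mul1r subrK intrD.
  by rewrite !mulNr mulrDl mul1r opprD subrK.
set c := (fun k : int => _).
change (wshift a (-1) c (wshift a 1 (fun=> 1) F) b =
  wshift a 1 (fun=> 1) (wshift a (-1) c F) b + F b :> C).
rewrite /wshift !unit_idxK // !ffunE eqxx !mul1r /c subrK intrD.
by rewrite [_ + 1 + _]addrAC mulrDl mul1r.
Qed.

(** E_ij acts as the polarization operator, the sum over rows p of x_pi d_pj. *)
Definition fock_act (x : 'M[C]_n) (F : fock) : fock :=
  \sum_p \sum_i \sum_j x i j *: mulx (p, i) (derx (p, j) F).

Lemma fock_act_linear x : linear (fock_act x).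
Proof.
move=> k F G; rewrite /fock_act scaler_sumr -big_split; apply: eq_bigr => p _.
rewrite scaler_sumr -big_split; apply: eq_bigr => i _.
rewrite scaler_sumr -big_split; apply: eq_bigr => j _ /=.
by rewrite derx_linear mulx_linear scalerDr !scalerA mulrC.
Qed.

Lemma fock_act_linearl F : linear (fun x => fock_act x F).
Proof.
move=> k x y; rewrite /fock_act scaler_sumr -big_split; apply: eq_bigr => p _.
rewrite scaler_sumr -big_split; apply: eq_bigr => i _.
rewrite scaler_sumr -big_split; apply: eq_bigr => j _ /=.
by rewrite !mxE scalerDl scalerA.
Qed.

Lemma sum_delta (V : lmodType C) (k : 'I_n) (G : 'I_n -> V) :
  \sum_i (i == k)%:R *: G i = G k.
Proof.
rewrite (bigD1 k) //= eqxx scale1r big1 ?addr0 // => i /negbTE ->.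
by rewrite scale0r.
Qed.

(** The variables of a row span the standard representation and, in the next lemma, the derivations
    its dual. These two commutators give the bracket relation. *)
Lemma fock_act_mulx x q k F :
  fock_act x (mulx (q, k) F) =
  mulx (q, k) (fock_act x F) + \sum_i x i k *: mulx (q, i) F.
Proof.
rewrite /fock_act (lin_sum (mulx_linear _)).
have e p : \sum_i \sum_j x i j *: mulx (p, i) (derx (p, j) (mulx (q, k) F)) =
  mulx (q, k) (\sum_i \sum_j x i j *: mulx (p, i) (derx (p, j) F)) +
  (p == q)%:R *: \sum_i x i k *: mulx (p, i) F.
  rewrite (lin_sum (mulx_linear _)) scaler_sumr -big_split; apply: eq_bigr => i _ /=.
  rewrite (lin_sum (mulx_linear _)).
  rewrite -(sum_delta k (fun j => (p == q)%:R *: (x i j *: mulx (p, i) F))).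
  rewrite -big_split; apply: eq_bigr => j _ /=.
  rewrite derx_mulx (linD (mulx_linear _)) mulx_comm (linZ (mulx_linear (q, k))).
  rewrite scalerDr xpair_eqE (linZ (mulx_linear _)) !scalerA; congr (_ + _ *: _).
  by case: (p == q); case: (j == k); rewrite ?(mulr1, mulr0, mul1r, mul0r).
under eq_bigr => p _ do rewrite e.
by rewrite big_split sum_delta.
Qed.

Lemma fock_act_derx x q l F :
  fock_act x (derx (q, l) F) =
  derx (q, l) (fock_act x F) - \sum_j x l j *: derx (q, j) F.
Proof.
apply/eqP; rewrite eq_sym subr_eq eq_sym; apply/eqP.
rewrite /fock_act (lin_sum (derx_linear _)) .
have e p : derx (q, l) (\sum_i \sum_j x i j *: mulx (p, i) (derx (p, j) F)) =
  \sum_i \sum_j x i j *: mulx (p, i) (derx (p, j) (derx (q, l) F)) +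
  (p == q)%:R *: \sum_j x l j *: derx (p, j) F.
  rewrite (lin_sum (derx_linear _)).
  rewrite -(sum_delta l (fun i => (p == q)%:R *: (\sum_j x i j *: derx (p, j) F))).
  rewrite -big_split; apply: eq_bigr => i _ /=.
  rewrite (lin_sum (derx_linear _)) scalerA scaler_sumr -big_split; apply: eq_bigr => j _ /=.
  rewrite (linZ (derx_linear _)) derx_mulx scalerDr derx_comm xpair_eqE !scalerA.
  congr (_ + _ *: _); rewrite [q == p]eq_sym [l == i]eq_sym.
  by case: (p == q); case: (i == l); rewrite ?(mulr1, mulr0, mul1r, mul0r).
by under [RHS]eq_bigr => p _ do rewrite e; rewrite big_split sum_delta.
Qed.

Lemma fock_act_mulmx (x y : 'M[C]_n) F :
  fock_act (x *m y) F = \sum_p \sum_i \sum_j x i j *: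
     \sum_k y j k *: mulx (p, i) (derx (p, k) F).
Proof.
rewrite /fock_act; apply: eq_bigr => p _; apply: eq_bigr => i _.
under [RHS]eq_bigr => j _ do rewrite scaler_sumr.
rewrite exchange_big; apply: eq_bigr => k _ /=.
by rewrite mxE scaler_suml; apply: eq_bigr => j _; rewrite scalerA.
Qed.

Lemma fock_act_bracket (x y : 'M[C]_n) F :
  fock_act (mxbracket x y) F =
  fock_act x (fock_act y F) - fock_act y (fock_act x F).
Proof.
rewrite /mxbracket (linB (fock_act_linearl F)).
apply/eqP; rewrite eq_sym subr_eq; apply/eqP.
(* Moving [x] past x_pi and d_pj leaves two commutator terms, which add up to the actions of xy and
   of - yx. *)
have -> : fock_act x (fock_act y F) = \sum_p \sum_i \sum_j
   (y i j *: mulx (p, i) (derx (p, j) (fock_act x F)) -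
    y i j *: (\sum_k x j k *: mulx (p, i) (derx (p, k) F)) +
    y i j *: \sum_k x k i *: mulx (p, k) (derx (p, j) F)).
  rewrite {1}[fock_act y F]/fock_act (lin_sum (fock_act_linear x)).
  apply: eq_bigr => p _; rewrite (lin_sum (fock_act_linear x)).
  apply: eq_bigr => i _; rewrite (lin_sum (fock_act_linear x)).
  apply: eq_bigr => j _; rewrite (linZ (fock_act_linear x)) fock_act_mulx fock_act_derx.
  rewrite (linB (mulx_linear _)) scalerDr scalerBr; congr (_ - _ *: _ + _).
  rewrite (lin_sum (mulx_linear _)); apply: eq_bigr => k _.
  by rewrite (linZ (mulx_linear _)).
have -> : \sum_p \sum_i \sum_j
   (y i j *: mulx (p, i) (derx (p, j) (fock_act x F)) -
    y i j *: (\sum_k x j k *: mulx (p, i) (derx (p, k) F)) +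
    y i j *: \sum_k x k i *: mulx (p, k) (derx (p, j) F)) =
   fock_act y (fock_act x F) - fock_act (y *m x) F + fock_act (x *m y) F.
  rewrite fock_act_mulmx {1}[fock_act y _]/fock_act [fock_act (x *m y) F]/fock_act.
  rewrite -sumrB -big_split; apply: eq_bigr => p _ /=.
  rewrite -sumrB; under eq_bigr => i _ do rewrite big_split sumrB /=.
  rewrite big_split /=; congr (_ + _).
  under eq_bigr => i _ do
    (under eq_bigr => j _ do rewrite scaler_sumr; rewrite exchange_big /=).
  rewrite exchange_big; apply: eq_bigr => k _ /=.
  rewrite exchange_big; apply: eq_bigr => j _ /=.
  rewrite mxE scaler_suml; apply: eq_bigr => i _.
  by rewrite scalerA mulrC.
by rewrite addrAC [RHS]addrAC [_ + fock_act y _]addrC.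
Qed.

Definition fockmod : glmod C n :=
  GlMod fock_act_linear fock_act_linearl fock_act_bracket.

(** Index 0 stands for the product of the x_pp^(m_p), with exponent 0 in all other variables; the
    offsets [m] are built into [derx]. *)
Definition vacuum : fock := fun b => (b == 0)%:R.

Lemma mulx_vacuum (a : 'I_n * 'I_n) : (a.2 < a.1)%N -> mulx a vacuum = 0.
Proof.
move=> h; apply/funext => b; rewrite /mulx h /wshift /vacuum subr_eq0.
case: eqP => [->|_]; last by rewrite mulr0.
by rewrite unit_idxE eqxx addNr oppr0 mul0r.
Qed.

Lemma derx_vacuum (a : 'I_n * 'I_n) : (a.1 < a.2)%N -> derx a vacuum = 0.
Proof.
move=> h; apply/funext => b; rewrite /derx ltnNge (ltnW h) /= /wshift /vacuum subr_eq0.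
rewrite -val_eqE /= (gtn_eqF h) addr0.
case: (b =P _) => [->|_]; last by rewrite mulr0.
by rewrite unit_idxE eqxx addNr mul0r.
Qed.

Lemma mulx_derx_vacuum p : mulx (p, p) (derx (p, p) vacuum) = m p *: vacuum.
Proof.
apply/funext => b; rewrite /mulx /derx /= ltnn eqxx /wshift /vacuum.
rewrite unit_idxK // mul1r !ffunE eqxx subrK.
change (((b (p, p))%:~R + m p) * (b == 0)%:R = m p * (b == 0)%:R).
case: eqP => [->|_]; last by rewrite !mulr0.
by rewrite ffunE add0r.
Qed.

(** For i < j, row p of E_ij is killed by d_pj if p < j and by x_pi if p >= j. In E_jj each row p >
    j contributes -1, because xd = dx - 1 and x kills the vacuum; [m j] compensates for these. *)
Lemma vacuum_highest (lam : 'rV[C]_n) :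
  (forall j : 'I_n, m j = lam 0 j + (n - 1 - j)%:R) -> highest lam (vacuum : fockmod).
Proof.
move=> hm; split; last first.
  move=> x hx; apply: big1 => p _; apply: big1 => i _; apply: big1 => j _.
  case: (leqP j i) => [ji|ij]; first by rewrite hx // scale0r.
  case: (ltnP p j) => pj; first by rewrite derx_vacuum // (lin0 (mulx_linear _)) scaler0.
  have := derx_mulx (p, j) (p, i) vacuum.
  rewrite mulx_vacuum /=; last exact: leq_trans ij pj.
  rewrite xpair_eqE eqxx -val_eqE /= (gtn_eqF ij) scale0r addr0 (lin0 (derx_linear _)) => <-.
  by rewrite scaler0.
apply/weight_vectorP => j.
rewrite [LHS]/(fock_act _ _) /fock_act.
have e p : \sum_i \sum_k E C j j i k *: mulx (p, i) (derx (p, k) vacuum) =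
    ((p == j)%:R * m j - (j < p)%:R) *: vacuum.
  rewrite (bigD1 j) //= (bigD1 j) //= [X in _ + X + _]big1 => [|k kj]; last first.
    by rewrite mxE (negbTE kj) andbF scale0r.
  rewrite big1 => [|i ij]; last first.
    by apply: big1 => k _; rewrite mxE (negbTE ij) scale0r.
  rewrite mxE !eqxx scale1r !addr0; case: (ltngtP j p) => [jp|pj|/val_inj ->].
  - have := derx_mulx (p, j) (p, j) vacuum; rewrite mulx_vacuum // eqxx scale1r.
    rewrite (lin0 (derx_linear _)) -val_eqE /= (gtn_eqF jp) mul0r sub0r scaleN1r.
    by move/eqP; rewrite eq_sym addr_eq0 => /eqP.
  - rewrite derx_vacuum // (lin0 (mulx_linear _)) -val_eqE /= (ltn_eqF pj) mul0r.
    by rewrite subrr scale0r.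
  - by rewrite mulx_derx_vacuum eqxx mul1r subr0.
under eq_bigr => p _ do rewrite e.
rewrite -scaler_suml sumrB -mulr_suml hm; congr (_ *: _).
have -> : \sum_p (p == j)%:R = 1 :> C.
  by rewrite (bigD1 j) //= eqxx big1 ?addr0 // => p /negbTE ->.
have -> : \sum_(p < n) (j < p)%:R = (n - 1 - j)%:R :> C.
  by rewrite -natr_sum sum_gt_ord.
by rewrite mul1r addrK.
Qed.

Lemma vacuum_neq0 : vacuum != 0.
Proof.
apply/eqP => /(congr1 (fun F : fock => F 0)) /eqP.
by rewrite /vacuum eqxx oner_eq0.
Qed.

Section Lowering.
Variables (i j : 'I_n).
Hypothesis ij : (j : nat) = i.+1.

Lemma fock_E F : fock_act (E C j i) F = \sum_p mulx (p, j) (derx (p, i) F).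
Proof.
apply: eq_bigr => p _; rewrite (bigD1 j) //= (bigD1 i) //=.
rewrite [X in _ + X + _]big1 => [|k ki]; last by rewrite mxE (negbTE ki) andbF scale0r.
rewrite big1 => [|k kj]; last by apply: big1 => l _; rewrite mxE (negbTE kj) scale0r.
by rewrite mxE !eqxx scale1r !addr0.
Qed.

Let nij : i != j. Proof. by rewrite -val_eqE /= ij ltn_eqF. Qed.

Lemma fock_Ej F b : mulx (j, j) (derx (j, i) F) b =
  F (b - unit_idx (j, j) 1 - unit_idx (j, i) 1).
Proof. by rewrite /mulx /derx /= ltnn ij ltnSn /wshift !mul1r. Qed.

(* In every row [p] but row [j], lowering strictly increases the coordinate
   [(p, low p)]; hence no such row contributes to the coefficient below. *)
Definition low (p : 'I_n) : 'I_n := if (p < j)%N then j else i.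

Lemma fock_El p F b : p != j -> exists c, exists s : int,
  mulx (p, j) (derx (p, i) F) b =
  c * F (b - unit_idx (p, low p) 1 - unit_idx (p, if low p == j then i else j) s).
Proof.
rewrite /low -val_eqE /= neq_ltn => /orP [pj|jp].
  have ip : (i < p)%N = false by rewrite ltnNge -ltnS -ij pj.
  rewrite pj eqxx /mulx /derx /= ip ltnNge (ltnW pj) /= /wshift !mul1r.
  by eexists; exists (-1).
have ip : (i < p)%N by apply: ltn_trans jp; rewrite ij.
rewrite ltnNge (ltnW jp) /= (negbTE nij) /mulx /derx /= ip jp /wshift mul1r.
by eexists; exists (-1); rewrite [X in F X]addrAC.
Qed.

Definition lowpos F := forall p b, p != j -> b (p, low p) < 0 -> F b = 0.

Lemma low_neq p : low p != (if low p == j then i else j).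
Proof. by rewrite /low; case: ifP => _; rewrite ?eqxx ?(negbTE nij) // eq_sym. Qed.

Lemma lowpos_E F : lowpos F -> lowpos (fock_act (E C j i) F).
Proof.
move=> hF p b pj bp; rewrite fock_E fct_sumE; apply: big1 => q _.
have [->|qj] := eqVneq q j.
  rewrite fock_Ej; apply: (hF p) => //; rewrite !ffunE !xpair_eqE (negbTE pj) /=.
  by rewrite !subr0.
have [c [s ->]] := fock_El F b qj.
rewrite (hF p) ?mulr0 // !ffunE !xpair_eqE.
move: bp; have [<-|pq] := eqVneq p q; last by rewrite !subr0.
rewrite eqxx (negbTE (low_neq _)) /= subr0.
by move=> bp; lia.
Qed.

Definition low_idx (k : nat) : idx := unit_idx (j, j) k + unit_idx (j, i) k.

(** In row j both factors are shifts with coefficient 1 and carry the coefficient 1 from [low_idx k]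
    to [low_idx k.+1]. Any other row p reads the previous iterate at a point whose coordinate (p,
    low p) is -1, where it vanishes. *)
Lemma fock_E_iter k :
  lowpos (iter k (fock_act (E C j i)) vacuum) /\
  iter k (fock_act (E C j i)) vacuum (low_idx k) = 1.
Proof.
elim: k => [|k [h1 h2]] /=.
  split=> [p b _ bp|].
    by rewrite /= /vacuum; case: eqP => // b0; move: bp; rewrite b0 ffunE ltxx.
  rewrite /vacuum (_ : low_idx 0 == 0) //.
  by apply/eqP/ffunP => c; rewrite !ffunE; do 2!case: ifP => _.
split; first exact: lowpos_E.
rewrite fock_E fct_sumE (bigD1 j) //= big1 => [|p pj].
  rewrite addr0 fock_Ej -h2; congr (iter _ _ _ _).
  apply/ffunP => c; rewrite !ffunE; do 2!case: ifP => _; lia.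
have [c [s ->]] := fock_El (iter k (fock_act (E C j i)) vacuum) (low_idx k.+1) pj.
rewrite (h1 p) ?mulr0 // !ffunE !xpair_eqE (negbTE pj) eqxx /= (negbTE (low_neq _)).
by rewrite eqxx.
Qed.

End Lowering.
End Fock.

Section VermaNonzero.
Variables (C : fieldType) (n : nat) (lam : 'rV[C]_n).

Let m (j : 'I_n) : C := lam 0 j + (n - 1 - j)%:R.
Let hv : highest lam (@vacuum C n : fockmod m).
Proof. exact: vacuum_highest. Qed.

Lemma vgen_neq0 : vgen lam != 0.
Proof.
have [lf _] := verma_map_hom hv.
apply/eqP => e; have /eqP := @vacuum_neq0 C n; apply.
by rewrite -[LHS](verma_map_gen hv) e (lin0 lf).
Qed.

Lemma verma_iter_neq0 (i j : 'I_n) k : (j : nat) = i.+1 ->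
  iter k (glact (E C j i)) (vgen lam) != 0.
Proof.
move=> ij; have [lf hf] := verma_map_hom hv.
apply/eqP => e.
have : verma_map (@vacuum C n : fockmod m) (iter k (glact (E C j i)) (vgen lam)) =
   iter k (fock_act m (E C j i)) (@vacuum C n).
  elim: k {e} => [|k IH] /=; first exact: (verma_map_gen hv).
  by rewrite hf IH.
rewrite e (lin0 lf) => /(congr1 (fun F : fock C n => F (low_idx i j k))).
have [_ ->] := fock_E_iter m ij k.
by move/eqP; rewrite eq_sym oner_eq0.
Qed.

End VermaNonzero.

(** * Linkage *)

Section Linkage.
Variables (C : fieldType) (n : nat).
Hypothesis natr_inj : injective (fun k : nat => k%:R : C).
Implicit Types (a b : {ffun 'I_n -> 'I_8}) (z : Ugl C n).

Definition wta (a : {ffun 'I_n -> 'I_8}) : 'rV[C]_n := (\row_(q < n) (a q)%:R) - rho C n.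

Lemma natr_neq0 k : k.+1%:R != 0 :> C.
Proof. by apply/eqP => /(@natr_inj k.+1 0). Qed.

Lemma rhoB (i j : 'I_n) : rho C n 0 i - rho C n 0 j = j%:R - i%:R.
Proof.
by rewrite !mxE; field; apply: (natr_neq0 1).
Qed.

Section Simple.
Variables (i j : 'I_n) (lam : 'rV[C]_n) (M : glmod C n) (v : M).
Hypothesis hv : highest lam v.
Hypothesis ij : (j : nat) = i.+1.

Let ltij : (i < j)%N. Proof. by rewrite ij. Qed.
Let f := @glact C n M (E C j i).
Let c := lam 0 i - lam 0 j.

Lemma iter_weight k : weight_vector (lam + k%:R *: simple_wt C j i) (iter k f v).
Proof.
elim: k => [|k IH] /=; first by rewrite scale0r addr0; case: hv.
rewrite -[in k.+1%:R]addn1 natrD scalerDl scale1r addrA; exact: weight_E.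
Qed.

(** The sl_2 identity for the root (i, j); its coefficient vanishes exactly at the step where a
    singular vector appears. *)
Lemma iter_e k : glact (E C i j) (iter k.+1 f v) =
  (k.+1%:R * (c - k%:R)) *: iter k f v.
Proof.
have eh w mu : weight_vector mu w ->
    glact (mxbracket (E C i j) (E C j i)) w = (mu 0 i - mu 0 j) *: w :> M.
  move=> /weight_vectorP hw; rewrite mxbracketE !eqxx !scale1r.
  by rewrite (linB (glact_linearl w)) !hw scalerBl.
elim: k => [|k IH].
  rewrite /= /f glact_comm hv.2; last exact: E_nplus.
  rewrite glact0 add0r (eh _ lam); last by case: hv.
  by rewrite mul1r subr0.
rewrite iterS /f glact_comm -/f IH (linZ (glact_linear _ : linear f)) -iterS.
rewrite (eh _ _ (iter_weight k.+1)) -scalerDl; congr (_ *: _).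
have ji : (j == i) = false by rewrite -val_eqE /= (gtn_eqF ltij).
rewrite !mxE !eqxx ji [i == j]eq_sym ji /= /c.
by rewrite -[in k.+2]addn1 -![in k.+1]addn1 !natrD /=; ring.
Qed.

(** Commuting E_pq past E_ji gives E_pi when q = j and - E_jq when p = i. As i and j are adjacent,
    these are again raising operators other than E_ij. *)
Lemma iter_other k (p q : 'I_n) : (p < q)%N -> (p, q) != (i, j) ->
  glact (E C p q) (iter k f v) = 0.
Proof.
elim: k p q => [|k IH] p q pq ne.
  by rewrite hv.2 //; apply: E_nplus.
rewrite /= /f glact_comm IH // glact0 add0r mxbracketE (linB (glact_linearl _)).
rewrite !(linZ (glact_linearl _)).
have [eqj|_] := eqVneq q j; last rewrite scale0r sub0r.
  have pi : (p < i)%N.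
    move: ne pq; rewrite eqj xpair_eqE eqxx andbT -val_eqE /= ij; lia.
  rewrite (IH p i) // ?xpair_eqE; last by rewrite -[p == i]val_eqE /= (ltn_eqF pi).
  rewrite scaler0 sub0r -val_eqE /= (gtn_eqF pi) scale0r oppr0 //.
have [eip|_] := eqVneq i p; last by rewrite scale0r oppr0.
have jq : (j < q)%N.
  move: ne pq; rewrite -eip xpair_eqE eqxx /= -val_eqE /= ij; lia.
rewrite (IH j q) // ?scaler0 ?oppr0 // xpair_eqE -[j == i]val_eqE /= (gtn_eqF ltij) //.
Qed.

Lemma iter_highest k : c = k%:R ->
  highest (lam + k.+1%:R *: simple_wt C j i) (iter k.+1 f v).
Proof.
move=> ck; split=> [|x hx]; first exact: iter_weight.
rewrite glact_mxE; apply: big1 => p _; apply: big1 => q _.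
case: (leqP q p) => pq; first by rewrite hx // scale0r.
have [[-> ->]|ne] := eqVneq (p, q) (i, j).
  by rewrite iter_e ck subrr mulr0 scale0r scaler0.
by rewrite iter_other // scaler0.
Qed.

End Simple.

Lemma highest_theta_eq (M : glmod C n) lam mu (v : M) z : Ucentral z ->
  highest lam v -> (forall m, uact z m = theta mu z *: m :> M) -> v != 0 ->
  theta mu z = theta lam z.
Proof.
move=> hz hv hm v0; have := hm v; rewrite (theta_highest natr_inj hz hv) => /eqP.
by rewrite -subr_eq0 -scalerBl scaler_eq0 (negbTE v0) orbF subr_eq0 => /eqP.
Qed.

Definition fper (a : {ffun 'I_n -> 'I_8}) (s : {perm 'I_n}) : {ffun 'I_n -> 'I_8} :=
  [ffun q => a (s q)].

Lemma theta_swap_lt a (i j : 'I_n) z : (j : nat) = i.+1 -> (a j < a i)%N ->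
  Ucentral z -> theta (wta a) z = theta (wta (fper a (tperm i j))) z.
Proof.
move=> ij lt hz; set lam := wta a.
(* As rho_i - rho_j = 1, the difference lam_i - lam_j is a_i - a_j - 1, which is this [k].
   Subtracting k + 1 simple roots then exchanges a_i and a_j. *)
have [k ek] : exists k, (a i : nat) = (a j + k.+1)%N by exists (a i - a j).-1%N; lia.
have ck : lam 0 i - lam 0 j = k%:R.
  have -> : lam 0 i - lam 0 j = (a i)%:R - (a j)%:R - (rho C n 0 i - rho C n 0 j).
    by rewrite !mxE; ring.
  rewrite rhoB ek ij natrD -[k.+1]addn1 -[i.+1]addn1 !natrD; ring.
have hv := iter_highest (vgen_highest lam) ij ck.
have -> : wta (fper a (tperm i j)) = lam + k.+1%:R *: simple_wt C j i.
  apply/rowP => q; rewrite !mxE ffunE /=.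
  case: tpermP => [->|->|/eqP qi /eqP qj].
  - rewrite !eqxx ek natrD; have -> : (i == j) = false by rewrite -val_eqE /= ij ltn_eqF.
    by rewrite /=; ring.
  - rewrite !eqxx ek natrD; have -> : (j == i) = false by rewrite -val_eqE /= ij gtn_eqF.
    by rewrite /=; ring.
  - by rewrite (negbTE qi) (negbTE qj) /=; ring.
apply: (highest_theta_eq hz hv _ (verma_iter_neq0 lam k.+1 ij)) => m.
exact: theta_verma.
Qed.

Lemma fperM a s t : fper (fper a s) t = fper a (t * s)%g.
Proof. by apply/ffunP => q; rewrite !ffunE permM. Qed.

Lemma theta_swap a (i j : 'I_n) z : (j : nat) = i.+1 ->
  Ucentral z -> theta (wta (fper a (tperm i j))) z = theta (wta a) z.
Proof.
move=> ij hz; case: (ltngtP (a i) (a j)) => [lt|lt|e].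
- rewrite [LHS](theta_swap_lt ij) // ?fperM ?tperm2 ?ffunE ?tpermL ?tpermR //.
  by congr (theta (wta _) z); apply/ffunP => q; rewrite ffunE perm1.
- by rewrite -(theta_swap_lt ij).
- congr (theta (wta _) z); apply/ffunP => q; rewrite ffunE.
  by case: tpermP => [->|->|//]; apply/val_inj.
Qed.

Lemma theta_tperm a (i j : 'I_n) z : Ucentral z ->
  theta (wta (fper a (tperm i j))) z = theta (wta a) z.
Proof.
move=> hz.
suff h (k : nat) (p q : 'I_n) b : (q : nat) = (p + k.+1)%N ->
    theta (wta (fper b (tperm p q))) z = theta (wta b) z.
  case: (ltngtP i j) => [lt|lt|/val_inj ->].
  - by apply: (h (j - i).-1%N); lia.
  - by rewrite tpermC; apply: (h (i - j).-1%N); lia.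
  - congr (theta (wta _) z); apply/ffunP => q; rewrite ffunE.
    by case: tpermP => [->|->|].
elim: k p q b => [|k IH] p q b e; first by apply: theta_swap => //; rewrite e addn1.
have lt : (q.-1 < n)%N by apply: leq_ltn_trans (leq_pred q) (ltn_ord q).
pose r := Ordinal lt; have rq : (q : nat) = r.+1 by rewrite /= e addnS.
(* With r = q - 1, a transposition over distance k + 2 is the conjugate of one over distance k + 1
   by an adjacent one. *)
have -> : tperm p q = (tperm r q * (tperm p r * tperm r q))%g.
  have -> : (tperm r q * (tperm p r * tperm r q))%g = (tperm p r ^ tperm r q)%g.
    by rewrite conjgE tpermV.
  rewrite tpermJ tpermL tpermD // -val_eqE /=; move: e rq; rewrite /=; lia.
rewrite -!fperM theta_swap // IH ?theta_swap //=; move: e; lia.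
Qed.

Lemma theta_perm a s z : Ucentral z -> theta (wta (fper a s)) z = theta (wta a) z.
Proof.
move=> hz; have [ts -> _] := prod_tpermP s.
elim: ts a => [|t ts IH] a.
  by rewrite big_nil; congr (theta (wta _) z); apply/ffunP => q; rewrite ffunE perm1.
by rewrite big_cons -fperM theta_tperm // IH.
Qed.

Lemma content_perm a b d : has_content a d -> has_content b d ->
  exists s, b = fper a s.
Proof.
move=> /forallP ha /forallP hb.
have cnt g k : count_mem k [tuple g i | i < n] = #|[set m | g m == k]| :> nat.
  rewrite /= count_map enumT -sum1_count -sum1dep_card.
  by apply: eq_bigl.
have : perm_eq [tuple b i | i < n] [tuple a i | i < n].
  by apply/allP => k _; apply/eqP; rewrite !cnt (eqP (ha k)) (eqP (hb k)).
case/tuple_permP => s /val_inj es; exists s; apply/ffunP => q; rewrite ffunE.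
by have := congr1 (fun t => tnth t q) es; rewrite !tnth_mktuple.
Qed.
End Linkage.

(** * Gelfand invariants *)

Section Separation.
Variable C : fieldType.
Hypothesis natr_inj : injective (fun k : nat => k%:R : C).

(** Supplies evaluation points: from some K on, no -k is among the finitely many roots, and these
    points are stable under u -> u - 1. *)
Lemma poly_neg_nat (p : {poly C}) : p != 0 ->
  exists K, forall k, (K <= k)%N -> p.[- k%:R] != 0.
Proof.
have [N] := ubnP (size p); elim: N p => // N IH p; rewrite ltnS => le p0.
have [[k /factor_theorem [q e]]|no] := pselect (exists k, root p (- k%:R)).
  have q0 : q != 0 by apply: contraNneq p0 => q0; rewrite e q0 mul0r.
  have lt : (size q < N)%N.
    by move: le; rewrite e size_Mmonic ?monicXsubC // size_XsubC addn2.
  have [K hK] := IH q lt q0.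
  exists (maxn K k.+1) => l; rewrite geq_max => /andP [/hK hl kl].
  rewrite e hornerM mulf_neq0 // hornerXsubC opprK addrC subr_eq0.
  by apply/eqP => /natr_inj kl'; rewrite kl' ltnn in kl.
by exists 0%N => k _; apply/negP => h; apply: no; exists k.
Qed.

(* With F = char_poly T * char_poly T' killing both matrices and
   F(X) - F(u) = q(X) (X - u), one has (u - T)^-1 = q(T) / F(u), so the
   resolvent entry is a combination of the r T^k c with the same coefficients
   for T and T'. *)
Lemma resolvent_sum (n' : nat) (T T' : 'M[C]_n'.+1) (r : 'rV[C]_n'.+1) (c : 'cV[C]_n'.+1) u :
  (forall k, r *m T ^+ k *m c = r *m T' ^+ k *m c) ->
  (char_poly T * char_poly T').[u] != 0 ->
  exists y y', [/\ (u%:M - T) *m y = c, (u%:M - T') *m y' = c & r *m y = r *m y'].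
Proof.
move=> h; set F := _ * _ => Fu.
have /factor_theorem [q e] : root (F - F.[u]%:P) u.
  by rewrite rootE hornerD hornerN hornerC subrr.
have key (S : 'M[C]_n'.+1) : horner_mx S F = 0 ->
    (u%:M - S) *m (F.[u]^-1 *: (horner_mx S q *m c)) = c.
  move=> SF; have := congr1 (horner_mx S) e.
  rewrite raddfB rmorphM rmorphB /= SF !horner_mx_C horner_mx_X sub0r => eS.
  have cm : (u%:M - S) *m horner_mx S q = horner_mx S q * (u%:M - S).
    rewrite mulmxBl mulmxE mulrBr; congr (_ - _); last exact: comm_mx_horner.
    by rewrite -mulmxE -[LHS]scalar_mxC.
  rewrite -scalemxAr mulmxA cm -[u%:M - S]opprB mulrN -eS opprK mul_scalar_mx.
  by rewrite scalerA mulVf // scale1r.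
have rq (S : 'M[C]_n'.+1) : r *m (horner_mx S q *m c) =
    \sum_(i < size q) q`_i *: (r *m S ^+ i *m c).
  rewrite mulmxA; have -> : horner_mx S q = \sum_(i < size q) q`_i *: S ^+ i.
    rewrite [horner_mx S q]horner_coef size_map_poly; apply: eq_bigr => i _.
    by rewrite coef_map -[RHS]mul_scalar_mx mulmxE.
  rewrite mulmx_sumr mulmx_suml; apply: eq_bigr => i _.
  by rewrite -scalemxAr -scalemxAl.
exists (F.[u]^-1 *: (horner_mx T q *m c)), (F.[u]^-1 *: (horner_mx T' q *m c)).
split.
- by apply: key; rewrite rmorphM /= Cayley_Hamilton mul0r.
- by apply: key; rewrite rmorphM /= Cayley_Hamilton mulr0.
- by rewrite -!scalemxAr !rq; congr (_ *: _); apply: eq_bigr => i _; rewrite h.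
Qed.

(* The recursion satisfied by the eigenvalues of (E^k)_aa on a highest weight
   vector, where l a = mu_a + n - a in the numbering from 1. *)
Definition gelfand_mx n (l : 'I_n -> C) : 'M[C]_n :=
  \matrix_(a, c) if c == a then l a else if (a < c)%N then -1 else 0.

(** Back substitution. If w is 1 minus the sum of the y_c with c > a, row a reads (u - l_a) y_a = w,
    so passing to w - y_a multiplies w by (u - 1 - l_a) / (u - l_a). *)
Lemma gelfand_solve n (l : 'I_n -> C) u (y : 'cV[C]_n) :
  (u%:M - gelfand_mx l) *m y = const_mx 1 ->
  (1 - \sum_a y a 0) * \prod_a (u - l a) = \prod_a (u - 1 - l a).
Proof.
move=> h.
have row a : (u - l a) * y a 0 + \sum_(c < n | (a < c)%N) y c 0 = 1.
  have /matrixP/(_ a 0) := h; rewrite !mxE => <-.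
  rewrite [RHS](bigD1 a) //= !mxE eqxx mulr1n; congr (_ + _).
  rewrite [RHS](bigID (fun c : 'I_n => (a < c)%N)) /= [X in _ = _ + X]big1 ?addr0.
    apply: eq_big => c; first by rewrite andb_idl // => ac; rewrite -val_eqE /= gtn_eqF.
    move=> ac; rewrite !mxE -val_eqE /= (ltn_eqF ac) -val_eqE /= (gtn_eqF ac) ac.
    by rewrite mulr0n sub0r opprK mul1r.
  move=> c /andP [ca ac]; rewrite !mxE eq_sym (negbTE ca) (negbTE ac).
  by rewrite mulr0n subr0 mul0r.
suff w k : (k <= n)%N ->
    (1 - \sum_(a < n | (n - k <= a)%N) y a 0) * \prod_(a < n | (n - k <= a)%N) (u - l a)
     = \prod_(a < n | (n - k <= a)%N) (u - 1 - l a).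
  have := w n (leqnn n); rewrite subnn.
  exact.
elim: k => [|k IH] kn.
  have P0 (a : 'I_n) : (n - 0 <= a)%N = false by rewrite subn0 leqNgt ltn_ord.
  by rewrite !big_pred0 // subr0 mulr1.
have lt : (n - k.+1 < n)%N by lia.
pose a := Ordinal lt.
have sp (c : 'I_n) : ((n - k.+1 <= c)%N && (c != a)) = (n - k <= c)%N.
  by rewrite -val_eqE /=; lia.
have spa (c : 'I_n) : (a < c)%N = (n - k <= c)%N by rewrite /=; lia.
rewrite !(bigD1 (P := fun c : 'I_n => (n - k.+1 <= c)%N) a) //= !(eq_bigl _ _ sp).
rewrite -(IH (ltnW kn)); have := row a; rewrite (eq_bigl _ _ spa).
set S := \sum_(i | _) _; set P := \prod_(i | _) _ => e.
have -> : S = 1 - (u - l a) * y a 0 by rewrite -e addrC addKr.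
by ring.
Qed.

(** The hypothesis makes P / Q constant along the points -k. Thus P and Q are proportional at
    infinitely many points, and the leading coefficients give the constant 1. *)
Lemma monic_neg_nat_eq (P Q : {poly C}) K : P \is monic -> Q \is monic ->
  (forall k, (K <= k)%N -> [/\ P.[- k%:R] != 0, Q.[- k%:R] != 0 &
     P.[- k.+1%:R] * Q.[- k%:R] = P.[- k%:R] * Q.[- k.+1%:R]]) -> P = Q.
Proof.
move=> mP mQ h; set u := (- K%:R : C).
have [Pu Qu _] := h K (leqnn K).
have e k : (K <= k)%N -> P.[- k%:R] * Q.[u] = P.[u] * Q.[- k%:R].
  elim: k => [|k IH]; first by rewrite leqn0 => /eqP K0; rewrite /u K0.
  rewrite leq_eqVlt => /predU1P [eK|]; first by rewrite /u eK.
  rewrite ltnS => Kk; have [_ Qk ek] := h k Kk.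
  by apply: (mulIf Qk); rewrite mulrAC ek mulrAC (IH Kk) mulrAC.
have D0 : Q.[u] *: P - P.[u] *: Q = 0.
  apply/eqP/negPn/negP => /poly_neg_nat [K' hK'].
  have /eqP := hK' (maxn K K') (leq_maxr _ _); apply.
  by rewrite !hornerE [Q.[u] * _]mulrC e ?leq_maxl // subrr.
have lc : Q.[u] = P.[u].
  move/eqP: D0; rewrite subr_eq0 => /eqP /(congr1 lead_coef).
  by rewrite !lead_coefZ (monicP mP) (monicP mQ) !mulr1.
move/eqP: D0; rewrite lc -scalerBr scaler_eq0 (negbTE Pu) subr_eq0 => /eqP.
by [].
Qed.

Lemma gelfand_separate n (l l' : 'I_n -> C) :
  (forall k, const_mx 1 *m iter k (mulmx (gelfand_mx l)) (const_mx 1) =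
             const_mx 1 *m iter k (mulmx (gelfand_mx l')) (const_mx 1) :> 'M[C]_1) ->
  exists s : {perm 'I_n}, forall a, l a = l' (s a).
Proof.
case: n l l' => [|n] l l' h; first by exists 1%g => -[].
have pow (T : 'M[C]_n.+1) k : iter k (mulmx T) (const_mx 1) = T ^+ k *m const_mx 1 :> 'cV_n.+1.
  elim: k => [|k IH] /=; first by rewrite expr0 mul1mx.
  by rewrite IH mulmxA exprS.
pose P := \prod_a ('X - (l a)%:P); pose Q := \prod_a ('X - (l' a)%:P).
have mP : P \is monic by apply: monic_prod => a _; apply: monicXsubC.
have mQ : Q \is monic by apply: monic_prod => a _; apply: monicXsubC.
(* The roots of [F * (P * Q)] are the values of u to avoid: those where a resolvent or a denominator
   breaks down. *)
pose F := char_poly (gelfand_mx l) * char_poly (gelfand_mx l').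
have F0 : F * (P * Q) != 0.
  by rewrite !mulf_neq0 // monic_neq0 // char_poly_monic.
have [K hK] := poly_neg_nat F0.
have PQ : P = Q.
  apply: (@monic_neg_nat_eq P Q K) => // k /hK.
  rewrite !hornerM !mulf_eq0 !negb_or => /andP [/andP [f1 f2] /andP [p q]].
  have Fk : F.[- k%:R] != 0 by rewrite hornerM mulf_neq0.
  have hh i : const_mx 1 *m gelfand_mx l ^+ i *m const_mx 1 =
    const_mx 1 *m gelfand_mx l' ^+ i *m const_mx 1 :> 'M[C]_1.
    by rewrite -!mulmxA -!pow h.
  have [y [y' [/gelfand_solve e /gelfand_solve e' ey]]] := resolvent_sum hh Fk.
  have sy : \sum_a y a 0 = \sum_a y' a 0.
    have sE (v : 'cV[C]_n.+1) : (const_mx 1 *m v : 'M_1) 0 0 = \sum_a v a 0.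
      by rewrite mxE; apply: eq_bigr => a _; rewrite mxE mul1r.
    by rewrite -!sE ey.
  have ev (g : 'I_n.+1 -> C) (x : C) : (\prod_a ('X - (g a)%:P)).[x] = \prod_a (x - g a).
    by rewrite horner_prod; apply: eq_bigr => a _; rewrite hornerXsubC.
  have kS : - k.+1%:R = - k%:R - 1 :> C by rewrite -addn1 natrD opprD.
  split=> //; move: e e'; rewrite sy -!ev -kS -/P -/Q => <- <-.
  by rewrite mulrAC mulrC mulrCA !mulrA.
have pe : perm_eq [tuple l a | a < n.+1] [tuple l' a | a < n.+1].
  apply: prod_XsubC_eq; rewrite !big_map; move: PQ; rewrite /P /Q.
  by rewrite -!(big_enum_cond _ _ predT) /=.
case/tuple_permP: pe => s /val_inj es; exists s => q.
by have := congr1 (fun t => tnth t q) es; rewrite !tnth_mktuple.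
Qed.

End Separation.

(** * Gelfand invariants and their values on highest weight vectors *)

Section GelfandInvariants.
Variables (C : fieldType) (n : nat).
Implicit Types (M : glmod C n) (lam mu : 'rV[C]_n).

Let e i j : Ugl C n := ugen (E C i j).

(** The entry (E^k)_ij, where E is the matrix of the generators E_ij over the noncommutative ring
    U(gl_n). *)
Fixpoint gel k (i j : 'I_n) : Ugl C n :=
  if k is k'.+1 then \sum_c gel k' i c * e c j else (i == j)%:R%:A.

Definition gelfand k : Ugl C n := \sum_a gel k a a.

Lemma e_comm p q i j : e p q * e i j =
  e i j * e p q + (q == i)%:R *: e p j - (j == p)%:R *: e i q.
Proof.
have := ugen_bracket (E C p q) (E C i j); rewrite mxbracketE.
rewrite (linB (@ugen_linear C n)) !(linZ (@ugen_linear C n)) -/(e _ _) => h.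
by rewrite -addrA h subrKC.
Qed.

(** The entries of E^k transform under the adjoint action like those of E. For the trace the two
    correction terms cancel, hence [gelfand_central]. *)
Lemma gel_comm k p q a b : e p q * gel k a b =
  gel k a b * e p q + (q == a)%:R *: gel k p b - (b == p)%:R *: gel k a q.
Proof.
elim: k a b => [|k IH] a b /=.
  rewrite -scalerAr -scalerAl mulr1 mul1r !scalerA -addrA -[LHS]addr0; congr (_ + _).
  rewrite -scalerBl -!natrM !mulnb [b == p]eq_sym [a == q]eq_sym andbC.
  by rewrite subrr scale0r.
rewrite mulr_sumr mulr_suml !scaler_sumr.
(* The last two terms come from the contracted index i. Summed over i, each gives
   [gel k a q * e p b], so they cancel. *)
have -> : \sum_i e p q * (gel k a i * e i b) = \sum_i (gel k a i * e i b * e p q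
    + (q == a)%:R *: (gel k p i * e i b) - (b == p)%:R *: (gel k a i * e i q)
    + ((i == q)%:R *: (gel k a i * e p b) - (i == p)%:R *: (gel k a q * e i b))).
  apply: eq_bigr => i _; rewrite mulrA IH !mulrDl mulNr -[_ * e p q * _]mulrA.
  rewrite e_comm !mulrDr mulrN -!scalerAl -!scalerAr mulrA [q == i]eq_sym.
  by rewrite [LHS](ACl (1*4*3*(2*5))).
rewrite big_split sumrB big_split sumrB /=.
by rewrite !sum_delta subrr addr0.
Qed.

Lemma Ucentral_generators (z : Ugl C n) : (forall i j, e i j * z = z * e i j) ->
  Ucentral z.
Proof.
move=> h; elim/upi_ind; elim=> [c|x|s IHs t IHt|s IHs t IHt].
- by rewrite upi_const -scalerAl -scalerAr mul1r mulr1.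
- rewrite -[upi _]/(ugen x) [x]matrix_sum_delta (lin_sum (@ugen_linear C n)).
  rewrite mulr_sumr mulr_suml; apply: eq_bigr => i _.
  rewrite (lin_sum (@ugen_linear C n)) mulr_sumr mulr_suml; apply: eq_bigr => j _.
  by rewrite (linZ (@ugen_linear C n)) -scalerAl -scalerAr -[ugen _]/(e i j) h.
- by rewrite -uadd_pi -[uadd _ _]/(upi s + upi t) mulrDr mulrDl IHs IHt.
- by rewrite -umul_pi -[umul _ _]/(upi s * upi t) mulrA IHs -mulrA IHt mulrA.
Qed.

Lemma gelfand_central k : Ucentral (gelfand k).
Proof.
apply: Ucentral_generators => p q; rewrite mulr_sumr mulr_suml.
under eq_bigr => a _ do rewrite gel_comm.
rewrite sumrB big_split /=.
under [X in _ + X - _]eq_bigr => a _ do rewrite eq_sym.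
by rewrite !sum_delta addrK.
Qed.

(** Since n - 1 - a = rho_a + (n - 1) / 2, this is mu + rho up to a constant. *)
Definition hc_shift mu (a : 'I_n) : C := mu 0 a + (n - 1 - a)%:R.

Definition gel_eigen mu k : 'cV[C]_n :=
  iter k (mulmx (gelfand_mx (hc_shift mu))) (const_mx 1).

Lemma uactB M u w (m : M) : uact (u - w) m = uact u m - uact w m.
Proof. by rewrite uactD -scaleN1r uactZ scaleN1r. Qed.

Lemma uact_sum M (I : Type) (r : seq I) (P : pred I) (F : I -> Ugl C n) (m : M) :
  uact (\sum_(i <- r | P i) F i) m = \sum_(i <- r | P i) uact (F i) m.
Proof.
apply: (big_morph (fun u => uact u m)) => [u v|]; first exact: uactD.
by rewrite -[0 : Ugl C n](scale0r 0) uactZ scale0r.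
Qed.

Lemma gelfand_mxE (l : 'I_n -> C) (y : 'cV[C]_n) a :
  (gelfand_mx l *m y) a 0 = l a * y a 0 - \sum_(c < n | (a < c)%N) y c 0.
Proof.
rewrite mxE (bigD1 a) //= mxE eqxx -sumrN; congr (_ + _).
rewrite [LHS]big_mkcond [RHS]big_mkcond; apply: eq_bigr => c _; rewrite mxE -val_eqE /=.
by case: ltngtP => //= _; rewrite ?mul0r ?mulN1r.
Qed.

(** Induction on k. For c > a, moving E_ca to the left in (E^k)_ac E_ca leaves (E^k)_aa - (E^k)_cc
    on v: the first terms add up to the shift n - 1 - a, the second are the entries -1 of
    [gelfand_mx]. For c < a the factor E_ca kills v. *)
Lemma gel_highest M mu (v : M) : highest mu v -> forall k (a : 'I_n),
  (forall b : 'I_n, (a < b)%N -> uact (gel k a b) v = 0) /\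
  uact (gel k a a) v = gel_eigen mu k a 0 *: v.
Proof.
case=> /weight_vectorP hw hn; elim=> [|k IH] a.
  rewrite /= !uactZ !uact1 /gel_eigen /= !mxE eqxx; split=> // b ab.
  by rewrite uactZ uact1 -val_eqE /= (ltn_eqF ab) scale0r.
have up (b c : 'I_n) : uact (gel k a c * e c b) v = if (c < b)%N then 0 else
   if c == b then mu 0 b *: uact (gel k a b) v else
     uact (e c b) (uact (gel k a c) v) - (b == a)%:R *: uact (gel k c c) v
        + uact (gel k a b) v.
  case: ltngtP => [cb|bc|/val_inj ->].
  - by rewrite uactM uact_gen hn ?(lin0 (uact_linear _)) //; exact: E_nplus.
  - have -> : (c == b) = false by rewrite -val_eqE /= (gtn_eqF bc).
    have -> : gel k a c * e c b = e c b * gel k a c - (b == a)%:R *: gel k c c + gel k a b.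
      by rewrite gel_comm eqxx scale1r addrAC subrK addrK.
    by rewrite uactD uactB uactM uactZ.
  - by rewrite eqxx uactM uact_gen hw (linZ (uact_linear _)).
split=> [b ab|]; rewrite [gel _ _ _]/= uact_sum.
  apply: big1 => c _; rewrite up; case: ltngtP => // [bc|/val_inj ->].
    have -> : (c == b) = false by rewrite -val_eqE /= (gtn_eqF bc).
    rewrite !(IH a).1 //; last exact: ltn_trans bc.
    rewrite (lin0 (uact_linear _)) -val_eqE /= (gtn_eqF ab) scale0r.
    by rewrite subrr addr0.
  by rewrite eqxx (IH a).1 // scaler0.
have -> : gel_eigen mu k.+1 = gelfand_mx (hc_shift mu) *m gel_eigen mu k by [].
rewrite gelfand_mxE /hc_shift.
set y := gel_eigen mu k.
transitivity (\sum_(c < n) ((c == a)%:R * (mu 0 a * y a 0) + (a < c)%:R * y a 0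
    - (if (a < c)%N then y c 0 else 0)) *: v).
  apply: eq_bigr => c _; rewrite up; case: ltngtP => [ca|ac|/val_inj ->].
  - by rewrite -val_eqE /= (ltn_eqF ca) !mul0r subr0 addr0 scale0r.
  - rewrite -val_eqE /= (gtn_eqF ac) eqxx (IH a).1 // (lin0 (uact_linear _)).
    rewrite (IH c).2 (IH a).2 scale1r sub0r -/y mul0r add0r mul1r.
    by rewrite scalerBl addrC.
  - by rewrite eqxx (IH a).2 mul1r mul0r addr0 subr0 scalerA.
rewrite -scaler_suml; congr (_ *: _).
rewrite sumrB big_split /= -!mulr_suml -!natr_sum sum_gt_ord -!big_mkcond /= big_pred1_eq.
by rewrite mul1r mulrDl.
Qed.

Hypothesis natr_inj : injective (fun k : nat => k%:R : C).

Lemma theta_gelfand mu k :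
  theta mu (gelfand k) = (const_mx 1 *m gel_eigen mu k : 'M_1) 0 0.
Proof.
have h := theta_verma natr_inj (vgen mu) (gelfand_central k).
have /eqP : (theta mu (gelfand k) - (const_mx 1 *m gel_eigen mu k : 'M_1) 0 0) *: vgen mu = 0.
  rewrite scalerBl -h uact_sum mxE scaler_suml -sumrB; apply: big1 => a _.
  by rewrite mxE mul1r (gel_highest (vgen_highest mu) k a).2 subrr.
by rewrite scaler_eq0 (negbTE (vgen_neq0 mu)) orbF subr_eq0 => /eqP.
Qed.

Lemma theta_separates mu (a : {ffun 'I_n -> 'I_8}) :
  (forall z, Ucentral z -> theta mu z = theta (wta C a) z) ->
  exists s, mu = wta C (fper a s).
Proof.
move=> h.
have [k|s hs] := @gelfand_separate C natr_inj n (hc_shift mu) (hc_shift (wta C a)).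
  apply/matrixP => i j; rewrite !ord1.
  by have := h _ (gelfand_central k); rewrite !theta_gelfand.
exists s; apply/rowP => q; have := hs q; rewrite /hc_shift.
(* The shifted coordinates are the entries of the sequence plus a constant independent of the
   position, so permuting them permutes the sequence. *)
have E1 (b : {ffun 'I_n -> 'I_8}) (r : 'I_n) :
    wta C b 0 r + (n - 1 - r)%:R = (b r)%:R + (n%:R - 1) / 2%:R.
  have -> : (n - 1 - r)%:R = n%:R - 1 - r%:R :> C by have lt := ltn_ord r; rewrite !natrB //; lia.
  by rewrite !mxE; field; apply: (natr_neq0 natr_inj 1).
by rewrite E1 => hq; apply: (addIr (n - 1 - q)%:R); rewrite hq E1 ffunE.
Qed.

End GelfandInvariants.

(** * Category O and its blocks *)

Section CategoryO.
Variables (C : fieldType) (n : nat).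
Hypothesis natr_inj : injective (fun k : nat => k%:R : C).
Implicit Types (M N : glmod C n) (lam mu nu : 'rV[C]_n) (d : Dset n).
Implicit Types (a b : {ffun 'I_n -> 'I_8}).

(** Apply raising operators E_ij as long as one gives a nonzero vector. The vectors met, collected
    in [s], have strictly increasing heights, hence are free, and lie in the finite-dimensional
    U(n_+) w; [N] counts the steps still possible. *)
Lemma singular_vector M (w : M) mu : locfin M -> weight_vector mu w -> w != 0 ->
  exists mu' k (v : M), [/\ highest mu' v, v != 0 & hgt mu' = hgt mu + k%:R].
Proof.
move=> /(_ w) [t ht] hw w0.
suff F (N : nat) (s : seq ('rV[C]_n * M)) nu (u : M) (k : nat) :
    (forall p, p \in s -> [/\ p.2 != 0, weight_vector p.1 p.2, in_Unplus w p.2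
       & exists l, hgt nu = hgt p.1 + l.+1%:R]) ->
    uniq (map fst s) -> u != 0 -> weight_vector nu u -> in_Unplus w u ->
    hgt nu = hgt mu + k%:R -> (size t < size s + N)%N ->
    exists mu' k (v : M), [/\ highest mu' v, v != 0 & hgt mu' = hgt mu + k%:R].
  apply: (F (size t).+1 [::] mu w 0%N) => //; rewrite ?addr0 //.
elim: N s nu u k => [|N IH] s nu u k hs us u0 hu wu hk.
  rewrite addn0 ltnNge => /negP []; rewrite -(size_map snd); apply: steinitz.
    by apply: free_weights us => p /hs [].
  by move=> v /mapP [p /hs [_ _ hp _] ->]; apply: ht.
move=> lt; have [hi|no] := pselect (forall i j : 'I_n, (i < j)%N -> glact (E C i j) u = 0).
  exists nu, k, u; split=> //; split=> // x hx; rewrite glact_mxE.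
  apply: big1 => i _; apply: big1 => j _.
  by case: (leqP j i) => ij; [rewrite hx // scale0r | rewrite hi // scaler0].
have [i [j [ij Eu]]] : exists i j : 'I_n, (i < j)%N /\ glact (E C i j) u <> 0.
  apply: contrapT => h; apply: no => i j ij; apply: contrapT => h'.
  by apply: h; exists i, j.
have hn : hgt (nu + simple_wt C i j) = hgt nu + (j - i)%:R by rewrite hgtD hgt_simple.
have hs' p : p \in (nu, u) :: s -> [/\ p.2 != 0, weight_vector p.1 p.2, in_Unplus w p.2
       & exists l, hgt (nu + simple_wt C i j) = hgt p.1 + l.+1%:R].
  rewrite inE => /predU1P [-> | /hs [h1 h2 h3 [l el]]]; split=> //=.
    by exists (j - i).-1%N; rewrite hn prednK // subn_gt0.
  by exists (l + (j - i))%N; rewrite hn el -addrA -natrD.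
apply: (IH ((nu, u) :: s) (nu + simple_wt C i j) (glact (E C i j) u) (k + (j - i))%N) => //.
- rewrite /= us andbT; apply/negP => /mapP [p /hs [_ _ _ [l el]] e].
  by move: el; rewrite e -[LHS]addr0 => /addrI /(@natr_inj 0 l.+1).
- exact/eqP.
- exact: weight_E.
- by apply: in_Unplus_act => //; apply: E_nplus.
- by rewrite hn hk -addrA -natrD.
- by rewrite /= addSnnS.
Qed.

Lemma nonzero_weight M (m : M) : hss M -> m != 0 ->
  exists mu (w : M), weight_vector mu w /\ w != 0.
Proof.
move=> /(_ m) hm; apply: contraNP => h; apply/eqP.
apply: (lspan_min (S := fun v : M => v = 0)) hm => [|u [mu hu]].
  by split=> // a u v -> ->; rewrite scaler0 addr0.
by apply/eqP; apply: contra_notT h => u0; exists mu, u.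
Qed.

(** The image of [f] is stable under the Cartan subalgebra, so by [weight_proj] it contains the
    weight components of f(m), which are then pulled back. *)
Lemma hss_inj M N (f : N -> M) : glhom f -> injective f -> hss M -> hss N.
Proof.
move=> [lf hf] fi hM m.
have /lspan_sumP [r hr e] := hM (f m).
have /choice [wt hwt] (p : C * M) : exists mu, p \in r -> weight_vector mu p.2.
  by have [/hr [mu h]|_] := boolP (p \in r); [exists mu | exists 0].
pose S v := exists x, f x = v.
have sS : subspace S.
  split; first by exists 0; rewrite (lin0 lf).
  by move=> a u v [x <-] [y <-]; exists (a *: x + y); rewrite lf.
have hw p : p \in r -> weight_vector (wt p) (p.1 *: p.2).
  by move=> /hwt; apply: subspaceZ; apply: weight_subspace.
have proj mu : S (\sum_(p <- r | wt p == mu) p.1 *: p.2).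
  apply: weight_proj => //; last by exists m.
  by move=> x _ _ [y <-]; exists (glact x y); rewrite hf.
have /choice [g hg] := proj.
have {e} -> : m = \sum_(mu <- undup (map wt r)) g mu.
  apply: fi; rewrite (lin_sum lf) e.
  under [RHS]eq_bigr => mu _ do rewrite hg big_mkcond.
  rewrite exchange_big /= [LHS]big_seq [RHS]big_seq; apply: eq_bigr => p pr.
  rewrite (bigD1_seq (wt p)) ?undup_uniq ?mem_undup ?map_f //= eqxx big1 ?addr0 //.
  by move=> mu; rewrite eq_sym => /negbTE ->.
apply: subspace_sum => [|mu _]; first exact: lspan_subspace.
apply: lspan_in; exists mu => x hx; apply: fi; rewrite hf (linZ lf) hg.
suff : weight_vector mu (\sum_(p <- r | wt p == mu) p.1 *: p.2) by apply.
rewrite big_seq_cond; apply: subspace_sum => [|p /andP [pr /eqP <-]].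
  exact: weight_subspace.
exact: hw.
Qed.

Lemma locfin_inj M N (f : N -> M) : glhom f -> injective f -> locfin M -> locfin N.
Proof.
move=> [lf hf] fi hM m; apply: (fin_span_preimage lf (hM (f m)) fi).
apply: in_Unplus_min; last exact: in_Unplus_self.
  split=> [|a u v hu hv]; first by rewrite (lin0 lf); apply: (in_Unplus_subspace _).1.
  by rewrite lf; apply: (in_Unplus_subspace _).2.
by move=> x u hx hu; rewrite hf; apply: in_Unplus_act.
Qed.

Lemma hss_surj M N (g : M -> N) : glhom g -> (forall z, exists y, g y = z) ->
  hss M -> hss N.
Proof.
move=> hg gs hM z; have [y <-] := gs z.
apply: lspan_mono (lspan_image hg.1 (hM y)) => _ [v [mu hv] ->].
by exists mu; apply: glhom_weight.
Qed.

Lemma locfin_surj M N (g : M -> N) : glhom g -> (forall z, exists y, g y = z) ->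
  locfin M -> locfin N.
Proof.
move=> [lg hg] gs hM z; have [y <-] := gs z.
apply: (fin_span_image lg (hM y)).
apply: in_Unplus_min.
- split; first by exists 0; rewrite ?(lin0 lg) //; apply: (in_Unplus_subspace _).1.
  move=> a _ _ [u hu ->] [v hv ->]; exists (a *: u + v); last by rewrite lg.
  exact: (in_Unplus_subspace _).2.
- move=> x _ hx [u hu ->]; exists (glact x u); last by rewrite hg.
  exact: in_Unplus_act.
- by exists y => //; apply: in_Unplus_self.
Qed.

Lemma weight_lift M N (g : M -> N) mu z : glhom g -> (forall z, exists y, g y = z) ->
  hss M -> weight_vector mu z -> exists2 y, weight_vector mu y & z = g y.
Proof.
move=> gh gs hM hz; have [y gy] := gs z.
have /lspan_sumP [r hr e] := hM y.
have /choice [wt hwt] (p : C * M) : exists mu, p \in r -> weight_vector mu p.2.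
  by have [/hr [mu' h]|_] := boolP (p \in r); [exists mu' | exists 0].
have hw p : p \in r -> weight_vector (wt p) (p.1 *: p.2).
  by move=> /hwt; apply: subspaceZ; apply: weight_subspace.
exists (\sum_(p <- r | wt p == mu) p.1 *: p.2).
  rewrite big_seq_cond; apply: subspace_sum => [|p /andP [pr /eqP <-]].
    exact: weight_subspace.
  exact: hw.
rewrite (lin_sum gh.1); apply: weight_component hz _ => [p /hw|].
  exact: glhom_weight.
by rewrite -(lin_sum gh.1) -e gy.
Qed.

Definition fdw M := forall mu, fin_span (@weight_vector C n M mu).

Lemma fdw_inj M N (f : N -> M) : glhom f -> injective f -> fdw M -> fdw N.
Proof.
move=> hf fi hM mu; apply: (fin_span_preimage hf.1 (hM mu) fi) => v.
exact: glhom_weight.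
Qed.

Lemma fdw_surj M N (g : M -> N) : glhom g -> (forall z, exists y, g y = z) ->
  hss M -> fdw M -> fdw N.
Proof.
move=> hg gs sM hM mu; apply: (fin_span_image hg.1 (hM mu)) => z hz.
exact: weight_lift gs sM hz.
Qed.

(** The generators are replaced by weight vectors, and these by a finite basis [b] of what n_+ makes
    of them. The span of [b] is stable under the Borel subalgebra, so M = U(n_-) b and
    [fin_span_weight] applies. *)
Lemma catO_fdw M : catO M -> fdw M.
Proof.
case/catOP => -[s gen] hM lM mu.
have /choice [W hW] (m : M) : exists r : seq M,
    (forall w, w \in r -> exists mu, weight_vector mu w) /\ sspan r m.
  have /lspan_sumP [r hr ->] := hM m; exists (map snd r); split.
    by move=> _ /mapP [p /hr hp ->].
  rewrite big_seq; apply: subspace_sum => [|p pr]; first exact: lspan_subspace.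
  apply: subspaceZ; first exact: lspan_subspace.
  by apply: lspan_in; apply: map_f.
pose Ws := flatten (map W s).
have hWs w : w \in Ws -> exists mu, weight_vector mu w.
  by case/flattenP => _ /mapP [m _ ->]; apply: (hW m).1.
(* Restricting to weight vectors makes every basis element taken from [P] a weight vector, and [P]
   is stable under E_ij for i < j. *)
pose P (m : M) := (exists mu, weight_vector mu m) /\ exists2 w, w \in Ws & in_Unplus w m.
have : fin_span P.
  apply: (@fin_span_mono _ _ (fun v => exists i : 'I_(size Ws), in_Unplus Ws`_i v)).
    move=> v [_ [w wW wv]]; apply: lspan_in.
    have lt : (index w Ws < size Ws)%N by rewrite index_mem.
    by exists (Ordinal lt); rewrite /= nth_index.
  by apply: fin_span_bigcup => i; apply: lM.
case/basis_extract => b [fb bP Pb].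
have /choice [wt hwt] (m : M) : exists mu, m \in b -> weight_vector mu m.
  by have [/bP [[mu' h] _]|_] := boolP (m \in b); [exists mu' | exists 0].
apply: (@fin_span_weight _ _ natr_inj _ (fun v => v \in b) (map wt b)).
- by exists b => v; apply: lspan_in.
- by move=> m mb; exists (wt m); [apply: map_f | apply: hwt].
- have sb : submodule (lspan (fun m => exists l, nword (fun v => v \in b) l m)).
    apply: nword_submodule => i j m; rewrite leq_eqVlt => /orP [/eqP /val_inj <-|ij] mb.
      have [[mu' /weight_vectorP ->] _] := bP _ mb.
      by apply: subspaceZ; [apply: lspan_subspace | apply: lspan_in].
    apply: Pb; have [[mu' hm] [w wW wm]] := bP _ mb; split.
      by exists (mu' + simple_wt C i j); apply: weight_E.
    by exists w => //; apply: in_Unplus_act => //; apply: E_nplus.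
  apply: gen => // m ms; apply: lspan_min (hW m).2; first exact: lspan_subspace.
  move=> w wW; have wWs : w \in Ws by apply/flattenP; exists (W m) => //; apply: map_f.
  have : sspan b w.
    by apply: Pb; split; [apply: hWs | exists w => //; apply: in_Unplus_self].
  by apply: lspan_mono => v vb; exists 0%N; apply: nword0.
Qed.

End CategoryO.

Lemma card_interval n s l : (s + l <= n)%N ->
  #|[set q : 'I_n | (s <= q < s + l)%N]| = l.
Proof.
move=> le; rewrite -sum1dep_card.
rewrite -(big_mkord (fun q => (s <= q < s + l)%N) (fun=> 1%N)).
have -> : (\sum_(0 <= q < n | (s <= q < s + l)%N) 1 = \sum_(s <= q < s + l) 1)%N.
  rewrite [RHS](@big_nat_widenl _ _ _ s 0 (s + l)) // [RHS](@big_nat_widen _ _ _ 0 (s + l) n) //.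
by rewrite sum_nat_const_nat muln1 addKn.
Qed.

(** * Central characters and linked weights *)

Section CentralCharacter.
Variables (C : fieldType) (n : nat).
Hypothesis natr_inj : injective (fun k : nat => k%:R : C).
Implicit Types (M N : glmod C n) (lam mu nu : 'rV[C]_n) (d : Dset n).
Implicit Types (a b : {ffun 'I_n -> 'I_8}).

(** The sequence is the nondecreasing one, d_0 zeros, then d_1 ones, and so on: position q carries
    the i whose block from [D i] to [D i.+1] contains q. *)
Lemma lambda_content d : exists2 a, has_content a d & wta C a = lambda_d C d - rho C n.
Proof.
pose D m := (\sum_(k < 8 | (k < m)%N) dpart d k)%N.
have DS (i : 'I_8) : D i.+1 = (D i + dpart d i)%N.
  rewrite /D (bigD1 i) //= addnC; congr (_ + _)%N; apply: eq_bigl => k.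
  by rewrite -val_eqE /= ltnS; lia.
have D8 : D 8%N = n.
  by apply: etrans (eqP (valP d)); apply: eq_bigl => k; rewrite ltn_ord.
have D0 : D 0%N = 0%N by rewrite /D big_pred0.
have Dmono m m' : (m <= m')%N -> (D m <= D m')%N.
  move=> le; rewrite /D [leqRHS](bigID (fun k : 'I_8 => (k < m)%N)) /=.
  rewrite (eq_bigl (fun k : 'I_8 => (k < m')%N && (k < m)%N)) ?leq_addr // => k /=; lia.
have /choice [a ha] (q : 'I_n) : exists i : 'I_8, (D i <= q < D i + dpart d i)%N.
  have ex : exists m, (q < D m.+1)%N by exists 7%N; rewrite D8 ltn_ord.
  case: (ex_minnP ex) => m hm mmin.
  have m8 : (m < 8)%N by apply: mmin; rewrite D8.
  exists (Ordinal m8); rewrite -DS hm andbT /=.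
  by case: m hm mmin m8 => [|m] hm mmin m8; rewrite ?D0 // leqNgt; apply/negP => /mmin; rewrite ltnn.
have uniq_a (i : 'I_8) (q : 'I_n) : (D i <= q < D i + dpart d i)%N = (a q == i).
  apply/idP/eqP => [h|<-]; last exact: ha.
  have := ha q; move: h; rewrite -!DS => /andP [h1 h2] /andP [h3 h4]; apply/val_inj; apply/eqP.
  rewrite eqn_leq; apply/andP; split; rewrite leqNgt; apply/negP => /Dmono le.
    by have := leq_trans h2 (leq_trans le h3); rewrite ltnn.
  by have := leq_trans h4 (leq_trans le h1); rewrite ltnn.
exists [ffun q => a q].
  apply/forallP => k; apply/eqP.
  rewrite -[RHS](@card_interval n (D k)); last first.
    by rewrite -DS -[leqRHS]D8; apply: Dmono; rewrite ltn_ord.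
  by apply: eq_card => q; rewrite !inE ffunE uniq_a.
congr (_ - _); apply/rowP => q; rewrite mxE ffunE /lambda_d summxE.
(* [eps] counts positions from 1, so the only j that can contribute at q is q + 1 - D i. *)
have e (i : 'I_8) : (\sum_(1 <= j < (dpart d i).+1) i%:R *: eps C n (D i + j)) 0 q =
    if i == a q then i%:R else 0 :> C.
  rewrite summxE eq_sym -uniq_a.
  case: ifP => h.
    rewrite (bigD1_seq (q.+1 - D i)%N) ?iota_uniq //=; last by rewrite mem_index_iota; lia.
    rewrite big1 ?addr0 => [|j hj].
      by rewrite !mxE (_ : (q.+1 == _) = true) ?mulr1 //; lia.
    by rewrite !mxE (_ : (q.+1 == _) = false) ?mulr0 //; lia.
  rewrite big_nat big1 // => j hj; rewrite !mxE (_ : (q.+1 == _) = false) ?mulr0 //; lia.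
rewrite (eq_bigr _ (fun i _ => e i)) -big_mkcond big_pred1_eq //.
Qed.

Lemma has_content_fper a s d : has_content a d -> has_content (fper a s) d.
Proof.
move=> /forallP h; apply/forallP => k; rewrite -(eqP (h k)).
rewrite -(card_imset [set m | fper a s m == k] (@perm_inj _ s)); apply/eqP.
apply: eq_card => q; rewrite !inE; apply/imsetP/idP => [[r]|hq].
  by rewrite inE ffunE => h' ->.
by exists (perm_inv s q); rewrite ?inE ?ffunE ?permKV.
Qed.

Definition theta_d d := theta (lambda_d C d - rho C n).

Lemma theta_content a d z : has_content a d -> Ucentral z ->
  theta (wta C a) z = theta_d d z.
Proof.
move=> ha hz; have [b hb e] := lambda_content d; rewrite /theta_d -e.
have [s ->] := content_perm ha hb; by rewrite theta_perm.
Qed.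

Definition cchar d M := forall (m : M) z, Ucentral z ->
  exists k : nat, uact ((z - (theta_d d z)%:A) ^+ k) m = 0.

Lemma cchar_inj d M N (f : N -> M) : glhom f -> injective f -> cchar d M -> cchar d N.
Proof.
move=> hf fi hM m z hz; have [k e] := hM (f m) z hz; exists k; apply: fi.
by rewrite glhom_uact // e (lin0 hf.1).
Qed.

Lemma cchar_surj d M N (g : M -> N) : glhom g -> (forall z, exists y, g y = z) ->
  cchar d M -> cchar d N.
Proof.
move=> hg gs hM w z hz; have [m <-] := gs w; have [k e] := hM m z hz.
by exists k; rewrite -glhom_uact // e (lin0 hg.1).
Qed.

(** On a highest weight vector z - theta_d(z) is a scalar; being nilpotent it is 0, and
    [theta_separates] identifies the weight. *)
Lemma highest_linked d M mu (v : M) : cchar d M -> highest mu v -> v != 0 ->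
  exists2 a, has_content a d & mu = wta C a.
Proof.
move=> hM hv v0; have [a ha _] := lambda_content d.
have [|s e] := @theta_separates C n natr_inj mu a.
  move=> z hz; rewrite (theta_content ha hz); have [k e] := hM v z hz.
  have ek : uact ((z - (theta_d d z)%:A) ^+ k) v = (theta mu z - theta_d d z) ^+ k *: v.
    elim: k {e} => [|k IH]; first by rewrite !expr0 uact1 scale1r.
    rewrite exprS uactM IH (linZ (uact_linear _)) uactB uactZ uact1.
    rewrite (theta_highest natr_inj hz hv) -scalerBl scalerA -exprSr //.
  apply/eqP; rewrite -subr_eq0; apply: contraTT v0 => t0; rewrite negbK.
  by move/eqP: e; rewrite ek scaler_eq0 expf_eq0 (negbTE t0) andbF.
by exists (fper a s) => //; apply: has_content_fper.
Qed.

Lemma linked_weight d M mu (w : M) : locfin M -> cchar d M -> weight_vector mu w ->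
  w != 0 -> exists a (v : M) k, [/\ has_content a d, highest (wta C a) v, v != 0
    & hgt (wta C a) = hgt mu + k%:R].
Proof.
move=> lM cM hw w0; have [mu' [k [v [hv v0 e]]]] := singular_vector natr_inj lM hw w0.
have [a ha ea] := highest_linked cM hv v0; subst mu'; by exists a, v, k.
Qed.

(* A highest weight vector of the quotient by the submodule generated by all
   linked weight spaces would lift into that submodule. *)
Lemma O_d_fingen d M : hss M -> locfin M -> cchar d M -> fdw M -> fingen M.
Proof.
move=> hM lM cM wM.
pose S (m : M) := forall S', submodule S' ->
  (forall a v, has_content a d -> weight_vector (wta C a) v -> S' v) -> S' m.
have sS : submodule S.
  split; first split.
  - by move=> S' sS' _; apply: sS'.1.1.
  - by move=> c u v hu hv S' sS' h; apply: sS'.1.2; [apply: hu | apply: hv].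
  - by move=> x m hm S' sS' h; apply: sS'.2; apply: hm.
have full m : S m.
  apply/(quotmod_proj0 sS); apply/eqP/negPn/negP => m0.
  have hg := quotmod_proj_hom sS; have gs := quotmod_proj_surj (hS := sS).
  have [mu [w [hw w0]]] := nonzero_weight (hss_surj hg gs hM) m0.
  have [a [v [_ [ha [hv _] v0 _]]]] :=
    linked_weight (locfin_surj hg gs lM) (cchar_surj hg gs cM) hw w0.
  have [y hy e] := weight_lift hg gs hM hv.
  case/eqP: v0; rewrite e; apply/quotmod_proj0 => S' sS' h; exact: h hy.
have /choice [t ht] (a : {ffun 'I_n -> 'I_8}) := wM (wta C a).
exists (flatten [seq t a | a <- enum {ffun 'I_n -> 'I_8}]) => S' sS' h m.
apply: (full m) => // a v _ /ht; apply: lspan_min; first exact: sS'.1.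
move=> u ut; apply: h; apply/flattenP; exists (t a) => //.
by apply: map_f; rewrite mem_enum.
Qed.

(** Trades finite generation for finite weight multiplicities, so that the block is seen to be
    closed under submodules and quotients. *)
Lemma O_dP d M : O_d d M <-> [/\ hss M, locfin M, cchar d M & fdw M].
Proof.
split=> [[hO cM] | [hM lM cM wM]].
  by have wM := catO_fdw natr_inj hO; have /catOP [_ hM lM] := hO.
by split=> //; apply/catOP; split=> //; apply: O_d_fingen cM wM.
Qed.

Lemma O_d_inj d M N (f : N -> M) : glhom f -> injective f -> O_d d M -> O_d d N.
Proof.
move=> hf fi /O_dP [h1 h2 h3 h4]; apply/O_dP; split.
- exact: hss_inj hf fi h1.
- exact: locfin_inj hf fi h2.
- exact: cchar_inj hf fi h3.
- exact: fdw_inj hf fi h4.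
Qed.

Lemma O_d_surj d M N (g : M -> N) : glhom g -> (forall z, exists y, g y = z) ->
  O_d d M -> O_d d N.
Proof.
move=> hg gs /O_dP [h1 h2 h3 h4]; apply/O_dP; split.
- exact: hss_surj hg gs h1.
- exact: locfin_surj hg gs h2.
- exact: cchar_surj hg gs h3.
- exact: fdw_surj hg gs h1 h4.
Qed.

Lemma vermaM_O_d a d : has_content a d -> O_d d (vermaM C a).
Proof.
move=> ha; split; first exact: verma_catO.
move=> m z hz; exists 1%N; rewrite expr1 uactB uactZ uact1.
by rewrite (theta_verma natr_inj (lam := wta C a)) // (theta_content ha hz) subrr.
Qed.

End CentralCharacter.

(** * Grothendieck groups *)

Section GrothendieckGroup.
Variables (C : fieldType) (n : nat) (A : glmod C n -> Prop).
Implicit Types (x y z : K A).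

(** Makes the lemmas on big operators available for sums in [K A]. *)
HB.instance Definition _ := Monoid.isComLaw.Build (K A) (Kzero A) (@Kadd C n A)
  (@KaddA C n A) (@KaddC C n A) (@Kadd0 C n A).

Lemma Kaddr0 x : Kadd x (Kzero A) = x.
Proof. by rewrite KaddC Kadd0. Qed.

Lemma KaddIr x y z : Kadd x z = Kadd y z -> x = y.
Proof.
move=> /(congr1 (fun w => Kadd w (Kopp z))).
by rewrite -!KaddA [Kadd z _]KaddC KaddN !Kaddr0.
Qed.

Lemma KaddLR x y z : x = Kadd y z -> z = Kadd (Kopp y) x.
Proof. by move=> ->; rewrite KaddA KaddN Kadd0. Qed.

Lemma Kopp_uniq x y : Kadd x y = Kzero A -> x = Kopp y.
Proof. by move=> h; apply: (@KaddIr _ _ y); rewrite h KaddN. Qed.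

Lemma Kcls_irr M (h h' : A M) : Kcls h = Kcls h'.
Proof. by congr Kcls; apply: Prop_irrelevance. Qed.

(** For M = 0 the identity maps form an exact sequence 0 -> M -> M -> M -> 0, so [M] = [M] + [M]. *)
Lemma Kcls_trivial M (h : A M) : (forall m : M, m = 0) -> Kcls h = Kzero A.
Proof.
move=> h0; have e : short_exact M M M.
  exists id, id; split=> //; first by move=> w; exists w.
  by move=> w; split=> _; [exists w | apply: h0].
apply: (@KaddIr _ _ (Kcls h)); rewrite Kadd0 {3}(Kcls_exact h h h e) //.
Qed.

Lemma Kof_cons b (M : {M | A M}) s :
  Kof ((b, M) :: s) =
  Kadd (if b then Kcls (svalP M) else Kopp (Kcls (svalP M))) (Kof s).
Proof.
have cl : Kcls (svalP M) = Kof [:: (true, M)].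
  by rewrite /Kcls; congr (Kof [:: (true, _)]); case: M => M h; apply: eq_exist.
rewrite -cat1s -Kadd_of; congr Kadd; rewrite cl; case: b => //.
apply: Kopp_uniq; rewrite Kadd_of; apply/KofP.
exact: (Keq_cancel false M).
Qed.

Inductive Vgen (T : pred {ffun 'I_n -> 'I_8}) : K A -> Prop :=
| Vgen0 : Vgen T (Kzero A)
| Vgen_cls a (h : A (vermaM C a)) : T a -> Vgen T (Kcls h)
| VgenD x y : Vgen T x -> Vgen T y -> Vgen T (Kadd x y)
| VgenN x : Vgen T x -> Vgen T (Kopp x).

Lemma Vgen_mono (T T' : pred {ffun 'I_n -> 'I_8}) x :
  (forall a, T a -> T' a) -> Vgen T x -> Vgen T' x.
Proof.
move=> TT'; elim=> [|a h Ta|y z _ h1 _ h2|y _ h].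
- exact: Vgen0.
- by apply: Vgen_cls; apply: TT'.
- exact: VgenD.
- exact: VgenN.
Qed.

Lemma Vgen_all T : (forall M (h : A M), Vgen T (Kcls h)) -> forall x, Vgen T x.
Proof.
move=> h; elim/Kof_ind; elim=> [|[b M] s IH]; first exact: Vgen0.
rewrite Kof_cons; apply: VgenD => //; case: b; first exact: h.
exact/VgenN/h.
Qed.

End GrothendieckGroup.

Section Inclusion.
Variables (C : fieldType) (n : nat) (A B : glmod C n -> Prop).
Hypothesis AB : forall M, A M -> B M.

Lemma Kincl0 : Kincl AB (Kzero A) = Kzero B.
Proof. by rewrite /Kzero Kincl_of. Qed.

Lemma KinclN x : Kincl AB (Kopp x) = Kopp (Kincl AB x).
Proof. by apply: Kopp_uniq; rewrite -KinclD KaddN Kincl0. Qed.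

Lemma Vgen_incl T x : Vgen T x -> Vgen T (Kincl AB x).
Proof.
elim=> [|a h Ta|y z _ h1 _ h2|y _ h].
- rewrite Kincl0; exact: Vgen0.
- rewrite Kincl_cls; exact: Vgen_cls.
- rewrite KinclD; exact: VgenD.
- rewrite KinclN; exact: VgenN.
Qed.

End Inclusion.

(** * Weight multiplicities as additive functions on K(A) *)

Section WeightDimension.
Variables (C : fieldType) (n : nat).
Implicit Types (M N : glmod C n) (mu : 'rV[C]_n).

(** The value is 0 by default when the weight space is not finite-dimensional. *)
Definition wdim M mu : nat := xget 0%N [set e | hasdim (@weight_vector C n M mu) e].

Lemma wdim_eq M mu e : hasdim (@weight_vector C n M mu) e -> wdim M mu = e.
Proof.
move=> h; have := @xgetPex _ 0%N [set e | hasdim (@weight_vector C n M mu) e].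
by case; [exists e | move=> s hs; apply: hasdim_inj h; exists s].
Qed.

Lemma wdimP M mu : fdw M -> hasdim (@weight_vector C n M mu) (wdim M mu).
Proof. by move=> /(_ mu) /hasdim_exists [e he]; rewrite (wdim_eq he). Qed.

Lemma weight_glhom_inj M N (f : M -> N) mu m : glhom f -> injective f ->
  weight_vector mu (f m) -> weight_vector mu m.
Proof. by move=> hf fi h x hx; apply: fi; rewrite hf.2 h // (linZ hf.1). Qed.

Lemma wdim_exact M' M M'' mu : short_exact M' M M'' -> hss M -> fdw M' -> fdw M'' ->
  wdim M mu = (wdim M' mu + wdim M'' mu)%N.
Proof.
move=> [f [g [hf hg fi gs ex]]] hM d' d''; apply: wdim_eq.
apply: (hasdim_exact hf.1 hg.1 fi ex _ _ _ _ (wdimP mu d') (wdimP mu d'')).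
- exact: weight_subspace.
- move=> m; split=> h; first exact: glhom_weight.
  exact: weight_glhom_inj h.
- by move=> y; apply: glhom_weight.
- by move=> w hw; apply: weight_lift hw.
Qed.

Variables (A : glmod C n -> Prop).
Hypothesis hA : forall M, A M -> hss M /\ fdw M.

Definition chi_word mu (s : Kword A) : int :=
  \sum_(p <- s) (if p.1 then 1 else -1) * (wdim (sval p.2) mu)%:Z.

Definition chi mu (x : K A) : int := chi_word mu (Krepr x).

Lemma chi_word_eq mu s t : Keq s t -> chi_word mu s = chi_word mu t.
Proof.
rewrite /chi_word; elim=> {s t} //.
- by move=> s t u _ -> _ ->.
- by move=> s s' t t' _ h1 _ h2; rewrite !big_cat /= h1 h2.
- by move=> s t; rewrite !big_cat /= addrC.
- by move=> b M; rewrite !big_cons !big_nil; case: b => /=; ring.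
- move=> M' M M'' e; rewrite !big_cons !big_nil /= (wdim_exact mu e).
  + by rewrite PoszD; ring.
  + by have [] := hA (svalP M).
  + by have [] := hA (svalP M').
  + by have [] := hA (svalP M'').
Qed.

Lemma chi_of mu s : chi mu (Kof s) = chi_word mu s.
Proof. by apply: chi_word_eq; apply: Krepr_of. Qed.

Lemma chiD mu x y : chi mu (Kadd x y) = chi mu x + chi mu y.
Proof.
by elim/Kof_ind: x => s; elim/Kof_ind: y => t; rewrite Kadd_of !chi_of /chi_word big_cat.
Qed.

Lemma chi0 mu : chi mu (Kzero A) = 0.
Proof. by rewrite chi_of /chi_word big_nil. Qed.

Lemma chi_cls mu M (h : A M) : chi mu (Kcls h) = (wdim M mu)%:Z.
Proof. by rewrite chi_of /chi_word big_cons big_nil /= mul1r addr0. Qed.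

End WeightDimension.

(** * Generation of K(O_d) by Verma classes *)

Section VermaGeneration.
Variables (C : fieldType) (n : nat).
Hypothesis natr_inj : injective (fun k : nat => k%:R : C).
Implicit Types (M N : glmod C n) (mu : 'rV[C]_n) (d : Dset n).
Implicit Types (a b : {ffun 'I_n -> 'I_8}).

(** The height of [wta C a] up to the constant hgt(rho), as a natural number, which provides a total
    order for inductions. *)
Definition wheight a : nat := (\sum_(q < n) (n - q) * a q)%N.

Lemma hgt_wta a : hgt (wta C a) = (wheight a)%:R - hgt (rho C n).
Proof.
rewrite /wta hgtD hgtN; congr (_ - _); rewrite /wheight natr_sum.
by apply: eq_bigr => q _; rewrite mxE natrM.
Qed.

Lemma wheight_hgt a b k : hgt (wta C a) = hgt (wta C b) + k%:R ->
  wheight a = (wheight b + k)%N.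
Proof.
rewrite !hgt_wta addrAC -natrD => /addIr; exact: natr_inj.
Qed.

Lemma wta_inj : injective (@wta C n).
Proof.
move=> a b /addIr /rowP h; apply/ffunP => q; apply/val_inj.
by have := h q; rewrite !mxE => /natr_inj.
Qed.

Lemma verma_weight_wta a b (m : verma (wta C a)) : weight_vector (wta C b) m -> m != 0 ->
  (wheight b <= wheight a)%N /\ (wheight a <= wheight b -> b = a)%N.
Proof.
move=> hm m0; have [k /wheight_hgt e e0] := verma_weight_hgt hm m0.
rewrite e leq_addr; split=> // le; apply/wta_inj/e0; lia.
Qed.

Lemma O_d_no_linked d M (m : M) : O_d d M ->
  (forall a (v : M), has_content a d -> weight_vector (wta C a) v -> v = 0) -> m = 0.
Proof.
move=> /(O_dP natr_inj) [hM lM cM _] h; apply/eqP/negPn/negP => m0.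
have [mu [w [hw w0]]] := nonzero_weight hM m0.
have [a [v [_ [ha [hv _] /eqP v0 _]]]] := linked_weight natr_inj lM cM hw w0.
by apply: v0; apply: h ha hv.
Qed.

(** If some E_ij v with i < j were nonzero, a singular vector would exist at or above its weight.
    Its weight is linked and higher than that of v, against the maximality. *)
Lemma O_d_top_highest d M a (v : M) : O_d d M -> has_content a d ->
  (forall b (u : M), has_content b d -> (wheight a < wheight b)%N ->
     weight_vector (wta C b) u -> u = 0) ->
  weight_vector (wta C a) v -> highest (wta C a) v.
Proof.
move=> /(O_dP natr_inj) [_ lM cM _] ha top hv; split=> // x hx.
rewrite glact_mxE; apply: big1 => i _; apply: big1 => j _.
case: (leqP j i) => ij; first by rewrite hx // scale0r.
have [->|Ev] := eqVneq (glact (E C i j) v) 0; first by rewrite scaler0.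
have [b [u [k [hb [hu _] /eqP u0]]]] := linked_weight natr_inj lM cM (weight_E i j hv) Ev.
rewrite hgtD hgt_simple // -addrA -natrD => /wheight_hgt e.
case: u0; apply: (top b) => //; lia.
Qed.

Lemma Kcls_O_d_gen d M (h : O_d d M) : Vgen (fun a => has_content a d) (Kcls h).
Proof.
suff [k hk] : exists k : nat, forall a : {ffun 'I_n -> 'I_8}, has_content a d -> (wheight a < k)%N.
  (* Outer induction on a strict upper bound [k'] for the heights of the linked weights that occur
     in M. *)
  suff F (k' : nat) : forall M (h : O_d d M), (forall a (v : M), has_content a d ->
      (k' <= wheight a)%N -> weight_vector (wta C a) v -> v = 0) ->
      Vgen (fun a => has_content a d) (Kcls h).
    by apply: (F k) => a v /hk lt; rewrite leqNgt lt.
  elim: k' => [|k' IHk] {k hk}.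
    move=> {}M {}h top; rewrite Kcls_trivial; first exact: Vgen0.
    by move=> m; apply: (O_d_no_linked _ h) => a v ha; apply: top.
  move=> {}M {}h.
  (* Inner induction on the total multiplicity of the linked weights of the top height [k']. *)
  pose meas M := (\sum_(a | has_content a d && (wheight a == k')) wdim M (wta C a))%N.
  have [N] := ubnP (meas M); elim: N => // N IHN in M h *; rewrite ltnS => le top.
  have [no|ex] := pselect (forall a (v : M), has_content a d -> wheight a = k' ->
      weight_vector (wta C a) v -> v = 0).
    apply: IHk => a v ha; rewrite leq_eqVlt => /predU1P [/esym|]; first exact: no.
    exact: top.
  have [a [v [ha ea hv v0]]] : exists a (v : M), [/\ has_content a d, wheight a = k',
      weight_vector (wta C a) v & v != 0].
    apply: contrapT => ne; apply: ex => a v ha ea hv; apply: contrapT => /eqP v0.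
    by apply: ne; exists a, v.
  have hi : highest (wta C a) v.
    by apply: O_d_top_highest h ha _ hv => b u hb lt; apply: top => //; rewrite -ea.
  have hf := verma_map_hom hi; set f := @verma_map C n M v (wta C a) in hf.
  pose S m := exists w, f w = m.
  have sS : submodule S.
    split; first split.
    - by exists 0; rewrite (lin0 hf.1).
    - by move=> c _ _ [w <-] [w' <-]; exists (c *: w + w'); rewrite hf.1.
    - by move=> x _ [w <-]; exists (glact x w); rewrite hf.2.
  have sK : submodule (fun w => f w = 0).
    split; first split.
    - exact: lin0 hf.1.
    - by move=> c u w hu hw; rewrite hf.1 hu hw scaler0 addr0.
    - by move=> x w hw; rewrite hf.2 hw glact0.
  have exQ := sub_quot_exact sS.
  pose g w : submod sS := submod_in sS (ex_intro _ w erefl : S (f w)).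
  have gf w : submod_val (g w) = f w by [].
  have gh : glhom g.
    split=> [c w w'|x w]; apply: (@submod_val_inj _ _ _ _ sS).
      by rewrite (submod_val_hom sS).1 !gf hf.1.
    by rewrite (submod_val_hom sS).2 !gf hf.2.
  have gs w : exists y, g y = w.
    have [y e] : S (submod_val w) by apply: submod_car_in.
    by exists y; apply: (@submod_val_inj _ _ _ _ sS); rewrite gf.
  have exK : short_exact (submod sK) (verma (wta C a)) (submod sS).
    exists (@submod_val _ _ _ _ sK), g.
    split; [exact: submod_val_hom | exact: gh | exact: submod_val_inj | exact: gs | ].
    - move=> y; rewrite -submod_valP -gf; split=> [->|e].
        exact: lin0 (submod_val_hom sS).1.
      apply: (@submod_val_inj _ _ _ _ sS); rewrite e.
      by rewrite (lin0 (submod_val_hom sS).1).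
  have hV := vermaM_O_d natr_inj ha.
  have hS := O_d_inj natr_inj (submod_val_hom sS) (@submod_val_inj _ _ _ _ sS) h.
  have hK := O_d_inj natr_inj (submod_val_hom sK) (@submod_val_inj _ _ _ _ sK) hV.
  have hQ := O_d_surj natr_inj (quotmod_proj_hom sS) (@quotmod_proj_surj _ _ _ _ sS) h.
  have [hM _ _ wM] := iffLR (O_dP natr_inj d M) h.
  have [_ _ _ wS] := iffLR (O_dP natr_inj d _) hS.
  have [_ _ _ wQ] := iffLR (O_dP natr_inj d _) hQ.
  rewrite (Kcls_exact hS h hQ exQ); apply: VgenD.
    rewrite (KaddLR (Kcls_exact hK hV hS exK)); apply: VgenD; last exact: Vgen_cls.
    (* In M(a) a linked weight of height at least [k'] is the weight of a itself. So w would be a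
       multiple of the generator, but f sends the generator to v, which is not 0. *)
    apply/VgenN/IHk => b w hb le' hw; apply: (@submod_val_inj _ _ _ _ sK).
    rewrite (lin0 (submod_val_hom sK).1); apply/eqP/negPn/negP => w0.
    have hw' := glhom_weight (submod_val_hom sK) hw.
    have [_ eb] := verma_weight_wta hw' w0.
    have {}eb : b = a by apply: eb; rewrite ea.
    rewrite eb in hw'; have [c e] := verma_weight_top natr_inj hw'.
    have fw : f (submod_val w) = 0 by apply: (submod_car_in w).
    move: fw; rewrite e (linZ hf.1) /f (verma_map_gen hi) => /eqP.
    rewrite scaler_eq0 (negbTE v0) orbF => /eqP c0.
    by move: w0; rewrite e c0 scale0r eqxx.
  apply: IHN; last first.
    move=> b u hb lt hu; have [y hy ->] := weight_lift (quotmod_proj_hom sS)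
      (@quotmod_proj_surj _ _ _ _ sS) hM hu.
    by rewrite (top b y) // (lin0 (quotmod_proj_hom sS).1).
  apply: leq_trans le; rewrite /meas (bigD1 a) /= ?ha ?ea ?eqxx //.
  rewrite [X in (_ < X)%N](bigD1 a) /= ?ha ?ea ?eqxx //.
  have add b := wdim_exact (wta C b) exQ hM wS wQ.
  rewrite -addSn; apply: leq_add; last by apply: leq_sum => b _; rewrite add leq_addl.
  (* The measure of the quotient drops because the image of f contains v, so its multiplicity at the
     weight of a is positive. *)
  rewrite add -[X in (X <= _)%N]add1n leq_add2r lt0n; apply/eqP => e.
  have := wdimP (wta C a) wS; rewrite e => /hasdim0 z0.
  have [y ey] : exists y : submod sS, submod_val y = v.
    by apply/submod_valP; exists (vgen (wta C a)); apply: verma_map_gen.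
  have y0 : y = 0.
    apply: z0; apply: (weight_glhom_inj (submod_val_hom sS)
      (@submod_val_inj _ _ _ _ sS)).
    by rewrite ey.
  by move: v0; rewrite -ey y0 (lin0 (submod_val_hom sS).1) eqxx.
exists (\max_a wheight a).+1 => a _; rewrite ltnS.
exact: (leq_bigmax (F := wheight)).
Qed.

End VermaGeneration.

(** * Direct sums of categories *)

Section DirectSum.
Variables (C : fieldType) (n : nat) (I : finType).
Implicit Types (M : glmod C n) (N : I -> glmod C n).

Lemma is_dsumP N M : is_dsum N M <->
  exists f : forall i, N i -> M, [/\ forall i, glhom (f i),
    forall m, exists x : forall i, N i, m = \sum_i f i (x i)
    & forall x y : forall i, N i, \sum_i f i (x i) = \sum_i f i (y i) ->
        forall i, x i = y i].
Proof.
split=> [[f hf [g gK Kg]]|[f [hf fs fi]]]; exists f => //.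
  split=> // [m|x y e i]; first by exists (g m); rewrite Kg.
  by rewrite -[x]gK -[y]gK e.
have /choice [g hg] m : exists x : (forall i, N i), m = \sum_i f i (x i) := fs m.
exists g => [x|m]; last by rewrite -hg.
by apply: functional_extensionality_dep => i; apply: fi; rewrite -hg.
Qed.

Lemma sum_dfwith N M (f : forall i, N i -> M) (x : forall i, N i) j (w : N j) :
  \sum_i f i (dfwith x w i) = f j w + \sum_(i | i != j) f i (x i).
Proof.
rewrite (bigD1 j) //= dfwith_in; congr (_ + _); apply: eq_bigr => i ij.
by rewrite dfwith_out // eq_sym.
Qed.

Lemma dsum_inj N M (f : forall i, N i -> M) : (forall i, glhom (f i)) ->
  (forall x y : forall i, N i, \sum_i f i (x i) = \sum_i f i (y i) ->
        forall i, x i = y i) -> forall i, injective (f i).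
Proof.
move=> hf fi j u w e.
have := fi (dfwith (fun i => 0 : N i) u) (dfwith (fun i => 0 : N i) w) _ j.
rewrite !dfwith_in; apply.
by rewrite !sum_dfwith e.
Qed.

Lemma dsum_hss_fdw N M : is_dsum N M -> (forall i, hss (N i) /\ fdw (N i)) ->
  hss M /\ fdw M.
Proof.
case/is_dsumP => f [hf fs fi] hN; split=> [m|mu].
  have [x ->] := fs m; apply: subspace_sum => [|i _]; first exact: lspan_subspace.
  apply: lspan_mono (lspan_image (hf i).1 ((hN i).1 (x i))) => _ [v [mu hv] ->].
  by exists mu; apply: glhom_weight.
apply: (@fin_span_mono _ _ (fun v => exists i, exists2 u, weight_vector mu u & v = f i u)).
  move=> v; have [x ->] := fs v => hx.
  apply: subspace_sum => [|i _]; first exact: lspan_subspace.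
  apply: lspan_in; exists i, (x i) => // h hh.
  apply: (fi (fun i => glact h (x i)) (fun i => wt_eval mu h *: x i)).
  under eq_bigr => k _ do rewrite (hf k).2.
  under [RHS]eq_bigr => k _ do rewrite (linZ (hf k).1).
  by rewrite -(lin_sum (glact_linear h)) hx // scaler_sumr.
apply: fin_span_bigcup => i.
exact: (fin_span_image (hf i).1 ((hN i).2 mu)).
Qed.

Section Kill.
Variables (N : I -> glmod C n) (j : I).

(** A summand is replaced by zero rather than removed, so that the index type, and with it the
    category [dsum_cat A], stays fixed. *)
Definition kill i : glmod C n := if i == j then zero_glmod C n else N i.

Definition kill_up i : kill i -> N i :=
  match i == j as b return (if b then zero_glmod C n else N i) -> N i with
  | true => fun=> 0 | false => id end.

Definition kill_dn i : N i -> kill i :=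
  match i == j as b return N i -> (if b then zero_glmod C n else N i) with
  | true => fun=> 0 | false => id end.

Lemma kill_up_hom i : glhom (@kill_up i).
Proof.
rewrite /kill_up /kill; case: (i == j); last by split.
by split=> [a u v|x m]; rewrite ?scaler0 ?addr0 // glact0.
Qed.

Lemma kill_dnK i (x : kill i) : kill_dn (kill_up x) = x.
Proof.
move: x; rewrite /kill_dn /kill_up /kill; case: (i == j) => // x; exact: zero_glmodE.
Qed.

Lemma kill_upK i (x : N i) : i != j -> kill_up (kill_dn x) = x.
Proof. by rewrite /kill_dn /kill_up /kill; case: (i == j). Qed.

Lemma kill_up0 (x : kill j) : kill_up x = 0.
Proof. by move: x; rewrite /kill_up /kill; case: (j == j) (eqxx j). Qed.

End Kill.

Lemma dsum_kill N M (f : forall i, N i -> M) j : (forall i, glhom (f i)) ->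
  (forall m, exists x : forall i, N i, m = \sum_i f i (x i)) ->
  (forall x y : forall i, N i, \sum_i f i (x i) = \sum_i f i (y i) ->
        forall i, x i = y i) ->
  exists2 Q, is_dsum (kill N j) Q & short_exact (N j) M Q.
Proof.
move=> hf fs fi; pose S m := exists w, f j w = m.
have sS : submodule S.
  split; first split.
  - by exists 0; rewrite (lin0 (hf j).1).
  - by move=> c _ _ [w <-] [w' <-]; exists (c *: w + w'); rewrite (hf j).1.
  - by move=> x _ [w <-]; exists (glact x w); rewrite (hf j).2.
have hp := quotmod_proj_hom sS.
exists (quotmod sS); last first.
  exists (f j), (quotmod_proj sS); split=> //.
  - exact: (@dsum_inj N M f hf fi j).
  - exact: quotmod_proj_surj.
  - by move=> y; apply: quotmod_proj0.
apply/is_dsumP; exists (fun i x => quotmod_proj sS (f i (kill_up x))); split.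
- move=> i; have hu := @kill_up_hom N j i; split=> [a u v|x m].
    by rewrite hu.1 (hf i).1 hp.1.
  by rewrite hu.2 (hf i).2 hp.2.
- move=> z; have [m <-] := quotmod_proj_surj z; have [x ->] := fs m.
  exists (fun i => kill_dn j (x i)); rewrite (lin_sum hp.1).
  apply: eq_bigr => i _; have [->|ij] := eqVneq i j; last by rewrite kill_upK.
  rewrite kill_up0 (lin0 (hf j).1) (lin0 hp.1); apply/quotmod_proj0.
  by exists (x j).
- move=> x y e i; rewrite -[x i]kill_dnK -[y i]kill_dnK.
  have [->|ij] := eqVneq i j; first by rewrite !kill_up0.
  have : S (\sum_k f k (kill_up (x k)) - \sum_k f k (kill_up (y k))).
    apply/(quotmod_proj0 sS); rewrite (linB hp.1) !(lin_sum hp.1) e subrr //.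
  case=> w ew; congr kill_dn.
  have := fi (fun k => kill_up (x k)) (dfwith (fun k => kill_up (y k)) w) _ i.
  rewrite dfwith_out 1?eq_sym //; apply.
  rewrite sum_dfwith ew -addrA; set X := \sum_k _.
  rewrite [X in _ + (- X + _)](bigD1 j) //= kill_up0 (lin0 (hf j).1) add0r addNr addr0 //.
Qed.

Variable A : I -> glmod C n -> Prop.
Hypothesis A0 : forall i, A i (zero_glmod C n).

Lemma dsum_cat_single i M : A i M -> dsum_cat A M.
Proof.
move=> hM; pose N k := if k == i then M else zero_glmod C n.
exists N => [k|]; first by rewrite /N; case: eqP => [->|_] //; apply: A0.
pose f k : N k -> M :=
  match k == i as b return (if b then M else zero_glmod C n) -> M with
  | true => id | false => fun=> 0 end.
pose g (m : M) k : N k :=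
  match k == i as b return (if b then M else zero_glmod C n) with
  | true => m | false => 0 end.
have f0 k (x : N k) : k != i -> f k x = 0.
  by move: x; rewrite /f /N; case: (k == i).
have fsum (x : forall k, N k) : \sum_k f k (x k) = f i (x i).
  by rewrite (bigD1 i) //= big1 ?addr0 // => k ki; apply: f0.
have fg m : f i (g m i) = m by rewrite /f /g; case: (i == i) (eqxx i).
apply/is_dsumP; exists f; split.
- move=> k; rewrite /f /N; case: (k == i); first by split.
  by split=> [a u v|x m]; rewrite ?scaler0 ?addr0 // glact0.
- by move=> m; exists (g m); rewrite fsum fg.
- move=> x y; rewrite !fsum => e k; case: (eqVneq k i) => [->|ki].
    by move: (x i) (y i) e; rewrite /f /N; case: (i == i) (eqxx i).
  move: (x k) (y k); rewrite /N (negbTE ki) => u v; exact: zero_glmodE.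
Qed.

(** Induction on a list [r] outside which all summands vanish, splitting off one summand at a time
    by [dsum_kill]. *)
Lemma dsum_cat_gen (T : pred {ffun 'I_n -> 'I_8}) :
  (forall i M (h : A i M) (h' : dsum_cat A M), Vgen T (Kcls h')) ->
  forall M (h : dsum_cat A M), Vgen T (Kcls h).
Proof.
move=> gen.
suff F (r : seq I) N M (h : dsum_cat A M) : (forall i, A i (N i)) -> is_dsum N M ->
    (forall i, i \notin r -> forall x : N i, x = 0) -> Vgen T (Kcls h).
  move=> M h; have [N hN dN] := h; apply: (F (enum I) N) => // i.
  by rewrite mem_enum.
elim: r N M h => [|j r IH] N M h hN dN hr.
  rewrite Kcls_trivial; first exact: Vgen0.
  move=> m; have /is_dsumP [f [hf fs _]] := dN; have [x ->] := fs m.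
  by apply: big1 => i _; rewrite (hr i isT (x i)) (lin0 (hf i).1).
have /is_dsumP [f [hf fs fi]] := dN.
have [Q dQ ex] := dsum_kill j hf fs fi.
have hk i : A i (kill N j i) by rewrite /kill; case: ifP.
have hQ : dsum_cat A Q by exists (kill N j).
have hj := dsum_cat_single (hN j).
rewrite (Kcls_exact hj h hQ ex); apply: VgenD; first exact: gen (hN j) _.
apply: (IH _ _ _ hk dQ) => i ir x; rewrite -[x]kill_dnK.
have e0 : kill_up x = 0.
  have [ej|ij] := eqVneq i j; first by subst i; apply: kill_up0.
  by apply: (hr i); rewrite inE negb_or ij.
rewrite e0; move: {e0}x; rewrite /kill_dn /kill; case: (i == j) => // x.
Qed.

End DirectSum.

(** * The isomorphism *)

Section VermaBasis.
Variables (C : fieldType) (n : nat).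
Hypothesis natr_inj : injective (fun k : nat => k%:R : C).
Implicit Types (M : glmod C n) (mu : 'rV[C]_n) (d : Dset n).
Local Notation idx := {ffun 'I_n -> 'I_8}.
Implicit Types (a b : idx).

Definition verma_dim a b : int := (wdim (vermaM C a) (wta C b))%:Z.

Lemma verma_dim_diag a : verma_dim a a = 1.
Proof.
congr Posz; apply: wdim_eq; apply: (@hasdim1 _ _ _ (vgen (wta C a))).
- exact: vgen_neq0.
- by case: (vgen_highest (wta C a)).
- exact: verma_weight_top.
Qed.

Lemma verma_dim_neq0 a b : verma_dim a b != 0 ->
  (wheight b <= wheight a)%N /\ (wheight a <= wheight b -> b = a)%N.
Proof.
move=> h; apply: contrapT => no; case/negP: h; apply/eqP.
congr Posz; apply: wdim_eq; apply/hasdim0 => v hv; apply: contrapT => /eqP v0.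
apply: no; exact: (verma_weight_wta natr_inj (m := v : verma (wta C a)) hv v0).
Qed.

Lemma verma_dim_free (z : idx -> int) :
  (forall b, \sum_a z a * verma_dim a b = 0) -> forall a, z a = 0.
Proof.
move=> h a0; apply/eqP/negPn/negP => z0.
(* Test at the weight of an a of maximal height in the support: any other M(b) with this weight is
   strictly higher, so its coefficient is 0. *)
case: (@arg_maxnP _ a0 (fun a => z a != 0) (fun a => wheight a) z0) => a za amax.
have := h a; rewrite (bigD1 a) //= verma_dim_diag mulr1 big1 ?addr0 => [/eqP|b ba].
  by rewrite (negbTE za).
have [->|zb] := eqVneq (z b) 0; first by rewrite mul0r.
have [->|cb] := eqVneq (verma_dim b a) 0; first by rewrite mulr0.
have [_ e] := verma_dim_neq0 cb; move: ba; rewrite e ?eqxx //; exact: amax.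
Qed.

Section Class.
Variables (A : glmod C n -> Prop) (T : pred idx).
Hypothesis hA : forall M, A M -> hss M /\ fdw M.
Hypothesis hT : forall a, T a -> A (vermaM C a).
Implicit Types (x y : K A) (p q : idx -> nat).

(** The default 0 outside A allows families indexed by all sequences. *)
Definition vcls a : K A :=
  if pselect (A (vermaM C a)) is left h then Kcls h else Kzero A.

Lemma vclsE a (h : A (vermaM C a)) : vcls a = Kcls h.
Proof. by rewrite /vcls; case: pselect => // h'; apply: Kcls_irr. Qed.

(** Only sums with natural coefficients are formed in [K A]; an integral combination x is encoded by
    a pair with x + Nsum q = Nsum p, as in [Vgen_coef]. *)
Definition Nsum p : K A := \big[@Kadd C n A/Kzero A]_a iter (p a) (Kadd (vcls a)) (Kzero A).

Lemma NsumD p q : Nsum (fun a => p a + q a)%N = Kadd (Nsum p) (Nsum q).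
Proof.
rewrite /Nsum -big_split; apply: eq_bigr => a _ /=.
elim: (p a) => [|k IH]; first by rewrite Kadd0.
by rewrite addSn /= IH KaddA.
Qed.

Lemma Nsum0 : Nsum (fun=> 0%N) = Kzero A.
Proof. exact: big1. Qed.

Lemma Nsum1 a : Nsum (fun b => b == a : nat) = vcls a.
Proof.
rewrite /Nsum (bigD1 a) //= eqxx /= big1 => [|b /negbTE -> //].
by rewrite !Kaddr0.
Qed.

Definition supp p := forall a, ~~ T a -> p a = 0%N.

Lemma chi_Nsum p b : supp p ->
  chi (wta C b) (Nsum p) = \sum_a (p a)%:Z * verma_dim a b.
Proof.
move=> sp; rewrite /Nsum (big_morph (chi (wta C b)) (chiD hA (wta C b)) (chi0 hA (wta C b))).
apply: eq_bigr => a _; have [/hT hTa|/sp ->] := boolP (T a); last by rewrite mul0r chi0.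
rewrite (vclsE hTa); elim: (p a) => [|k IH] /=; first by rewrite mul0r chi0.
by rewrite chiD // IH chi_cls // intS mulrDl mul1r.
Qed.

Lemma Vgen_coef x : Vgen T x ->
  exists p q, [/\ supp p, supp q & Kadd x (Nsum q) = Nsum p].
Proof.
elim=> [|a h Ta|{}x y _ [p [q [sp sq e]]] _ [p' [q' [sp' sq' e']]]|{}x _ [p [q [sp sq e]]]].
- by exists (fun=> 0%N), (fun=> 0%N); split=> //; rewrite Nsum0 Kadd0.
- exists (fun b => b == a : nat), (fun=> 0%N); split=> // [b|].
    by case: eqP => // ->; rewrite Ta.
  by rewrite Nsum0 Nsum1 Kaddr0 (vclsE h).
- exists (fun a => p a + p' a)%N, (fun a => q a + q' a)%N; split.
  + by move=> a Ta; rewrite sp // sp'.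
  + by move=> a Ta; rewrite sq // sq'.
  rewrite !NsumD -e -e' -!KaddA; congr Kadd; rewrite !KaddA; congr Kadd.
  exact: KaddC.
- exists q, p; split=> //; rewrite -e KaddA KaddN; exact: Kadd0.
Qed.

Lemma Vgen_chi x : Vgen T x ->
  exists z : idx -> int, forall b, chi (wta C b) x = \sum_a z a * verma_dim a b.
Proof.
case/Vgen_coef => p [q [sp sq e]]; exists (fun a => (p a)%:Z - (q a)%:Z) => b.
have := congr1 (chi (wta C b)) e; rewrite chiD // !chi_Nsum // => /(canRL (addrK _)) ->.
by rewrite -sumrB; apply: eq_bigr => a _; rewrite mulrBl.
Qed.

(** By [verma_dim_free], equal multiplicities force p + q' = p' + q; adding Nsum q + Nsum q' to both
    sides and cancelling gives x = y. *)
Lemma chi_inj x y : Vgen T x -> Vgen T y ->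
  (forall b, chi (wta C b) x = chi (wta C b) y) -> x = y.
Proof.
move=> /Vgen_coef [p [q [sp sq e]]] /Vgen_coef [p' [q' [sp' sq' e']]] h.
have pq a : (p a + q' a)%N = (p' a + q a)%N.
  apply/eqP; rewrite -(eqr_nat int) !natrD -subr_eq0 !natz; apply/eqP.
  apply: (verma_dim_free (z := fun a => (p a)%:Z + (q' a)%:Z - ((p' a)%:Z + (q a)%:Z))) => b.
  have := congr1 (chi (wta C b)) e; have := congr1 (chi (wta C b)) e'.
  rewrite !chiD // !chi_Nsum // h => e1 e2.
  under eq_bigr => c _ do rewrite mulrBl !mulrDl.
  rewrite sumrB !big_split /= -e1 -e2; ring.
apply: (@KaddIr _ _ _ _ _ (Kadd (Nsum q) (Nsum q'))).
rewrite KaddA e -NsumD [Kadd (Nsum q) _]KaddC KaddA e' -NsumD.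
by congr Nsum; apply/funext => a; apply: pq.
Qed.

End Class.
End VermaBasis.

Section Contents.
Variable n : nat.
Local Notation idx := {ffun 'I_n -> 'I_8}.

Definition class_content (c : Dtilde n) (a : idx) : bool :=
  [exists d in val c, has_content a d].

Lemma content_exists (a : idx) : exists d, has_content a d.
Proof.
have le k : (#|[set m | a m == k]| < n.+1)%N.
  by rewrite ltnS -[leqRHS]card_ord max_card.
pose f : {ffun 'I_8 -> 'I_n.+1} := [ffun k => Ordinal (le k)].
have hf : \sum_(k < 8) (f k : nat) == n.
  rewrite -[X in _ == X]card_ord -sum1_card (partition_big a xpredT) //=.
  by apply/eqP; apply: eq_bigr => k _; rewrite ffunE /= -sum1dep_card.
exists (exist _ f hf); apply/forallP => k.
by rewrite /dpart /= ffunE.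
Qed.

Lemma class_exists (a : idx) : exists c, class_content c a.
Proof.
have [d hd] := content_exists a.
pose s := [set d' in [set: Dset n] | dsim d d'].
have hs : s \in equivalence_partition (@dsim n) [set: Dset n].
  by apply/imsetP; exists d.
exists (exist _ s hs); apply/existsP; exists d.
by rewrite hd andbT /= !inE /dsim !eqxx.
Qed.

End Contents.

(** * The map gamma on K(O^n) and on each K(O_[d]) *)

Section Gamma.
Variables (C : fieldType) (n : nat).
Hypothesis natr_inj : injective (fun k : nat => k%:R : C).
Implicit Types (M : glmod C n) (c : Dtilde n).
Local Notation idx := {ffun 'I_n -> 'I_8}.

Lemma O_class_hss_fdw c M : O_class c M -> hss M /\ fdw M.
Proof.
case=> N hN dN; apply: dsum_hss_fdw dN _ => d.
by have /(O_dP natr_inj) [] := hN d.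
Qed.

Lemma O_n_hss_fdw M : O_n M -> hss M /\ fdw M.
Proof. by case=> N hN dN; apply: dsum_hss_fdw dN _ => c; apply: O_class_hss_fdw. Qed.

Lemma zero_O_d (d : Dset n) : O_d d (zero_glmod C n).
Proof. exact: zero_O_theta. Qed.

Lemma vermaM_O_class c (a : idx) : class_content c a -> O_class c (vermaM C a).
Proof.
case/existsP => d /andP [dc ha].
apply: (@dsum_cat_single _ _ _ (fun d : {d : Dset n | d \in val c} => O_d (val d)) _
  (exist _ d dc)) => [i|]; first exact: zero_O_d.
exact: vermaM_O_d.
Qed.

Lemma vermaM_O_n (a : idx) : O_n (vermaM C a).
Proof. by have [c /vermaM_O_class /O_class_sub] := class_exists a. Qed.

Lemma O_class_gen c (x : K (@O_class C n c)) : Vgen (class_content c) x.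
Proof.
move: x; apply: Vgen_all; apply: dsum_cat_gen => [d|d M h h']; first exact: zero_O_d.
have AB M' : O_d (val d) M' -> O_class c M'.
  by apply: (@dsum_cat_single _ _ _ (fun d : {d : Dset n | d \in val c} => O_d (val d))) => i;
    apply: zero_O_d.
rewrite (Kcls_irr h' (AB M h)) -(Kincl_cls AB); apply: Vgen_incl.
apply: Vgen_mono (Kcls_O_d_gen natr_inj h) => a ha.
by apply/existsP; exists (val d); rewrite ha andbT (valP d).
Qed.

Lemma O_n_gen (x : K (@O_n C n)) : Vgen predT x.
Proof.
move: x; apply: Vgen_all; apply: dsum_cat_gen => [c|c M h h']; first exact: zero_O_class.
rewrite (Kcls_irr h' (O_class_sub h)) -(Kincl_cls (@O_class_sub C n c)).
by apply: Vgen_incl; apply: Vgen_mono (O_class_gen (Kcls h)).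
Qed.

(** An arbitrary choice of coefficients, made canonical by [gcoef_uniq]; that uniqueness is the tool
    for computing [gamma]. *)
Definition gcoef (x : K (@O_n C n)) : idx -> int :=
  sval (cid (Vgen_chi O_n_hss_fdw (fun a (_ : predT a) => vermaM_O_n a) (O_n_gen x))).

Lemma gcoefP x b : chi (wta C b) x = \sum_a gcoef x a * verma_dim C a b.
Proof. by rewrite /gcoef; case: cid. Qed.

Lemma gcoef_uniq x (z : idx -> int) :
  (forall b, chi (wta C b) x = \sum_a z a * verma_dim C a b) -> gcoef x =1 z.
Proof.
move=> h a; apply/eqP; rewrite -subr_eq0; apply/eqP.
apply: (verma_dim_free natr_inj (z := fun a => gcoef x a - z a)) => b.
under eq_bigr => e _ do rewrite mulrBl.
by rewrite sumrB -h -gcoefP subrr.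
Qed.

Definition vtensor (a : idx) : Vspn C n := tensor (fun m : 'I_n => vsp C (a m)).

Lemma vtensorE a b : vtensor a b = (a == b)%:R.
Proof.
rewrite ffunE; have [<-|ab] := eqVneq a b.
  by rewrite big1 // => m _; rewrite mxE !eqxx.
have /existsP [m hm] : [exists m, a m != b m].
  by apply: contraNT ab => /existsPn h; apply/eqP/ffunP => m; apply/eqP; have /negPn := h m.
by rewrite (bigD1 m) //= mxE eqxx eq_sym (negbTE hm) mul0r.
Qed.

Definition gamma (x : K (@O_n C n)) : Vspn C n := \sum_a vtensor a *~ gcoef x a.

Lemma gammaD : {morph gamma : x y / Kadd x y >-> x + y}.
Proof.
move=> x y; rewrite /gamma -big_split; apply: eq_bigr => a _ /=.
rewrite (@gcoef_uniq _ (fun a => gcoef x a + gcoef y a)) ?mulrzDr // => b.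
rewrite (chiD O_n_hss_fdw) !gcoefP -big_split; apply: eq_bigr => e _ /=.
by rewrite mulrDl.
Qed.

Lemma gamma0 : gamma (Kzero _) = 0.
Proof. by apply: (addrI (gamma (Kzero _))); rewrite -gammaD Kadd0 addr0. Qed.

Lemma gammaN x : gamma (Kopp x) = - gamma x.
Proof. by apply/eqP; rewrite -addr_eq0 -gammaD KaddN gamma0. Qed.

Lemma gamma_cls a (h : O_n (vermaM C a)) : gamma (Kcls h) = vtensor a.
Proof.
rewrite /gamma (bigD1 a) //= big1 => [|b ba].
  rewrite (@gcoef_uniq _ (fun b => (b == a)%:R)) ?eqxx ?addr0 // => b.
  rewrite (chi_cls O_n_hss_fdw) (bigD1 a) //= eqxx mul1r big1 ?addr0 // => e /negbTE ->.
  by rewrite mul0r.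
rewrite (@gcoef_uniq _ (fun b => (b == a)%:R)) ?(negbTE ba) // => e.
rewrite (chi_cls O_n_hss_fdw) (bigD1 a) //= eqxx mul1r big1 ?addr0 // => f /negbTE ->.
by rewrite mul0r.
Qed.

(** The [vtensor a] are coordinate functions and int embeds in a field of characteristic zero, so
    [gamma x] determines the coefficients of x. *)
Lemma gamma_chi x y : gamma x = gamma y ->
  forall b, chi (wta C b) x = chi (wta C b) y.
Proof.
move=> h b; rewrite !gcoefP; apply: eq_bigr => a _; congr (_ * _).
have ev w : gamma w a = (gcoef w a)%:~R.
  rewrite /gamma sum_ffunE (bigD1 a) //= big1 => [|e ea].
    by rewrite addr0 ffunMzE vtensorE eqxx.
  by rewrite ffunMzE vtensorE (negbTE ea) mul0rz.
have := congr1 (fun w : Vspn C n => w a) h; rewrite !ev => /eqP.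
rewrite -subr_eq0 -rmorphB /= => /eqP e; apply/eqP; rewrite -subr_eq0; apply/eqP.
case: (gcoef x a - gcoef y a) e => k; first by move/(@natr_inj k 0%N) ->.
by rewrite NegzE rmorphN => /eqP; rewrite oppr_eq0 => /eqP /(@natr_inj k.+1 0%N).
Qed.

(** Stated for a subcategory A and an index set T to cover O^n, with the identity inclusion, and
    every O_[d] at once. *)
Lemma Kiso_generated (A : glmod C n -> Prop) (T : pred idx)
    (AB : forall M, A M -> O_n M) (S : Vspn C n -> Prop) :
  (forall M, A M -> hss M /\ fdw M) -> (forall a, T a -> A (vermaM C a)) ->
  (forall x : K A, Vgen T x) ->
  S 0 -> (forall v w, S v -> S w -> S (v - w)) -> (forall a, T a -> S (vtensor a)) ->
  (forall v, S v -> exists z : idx -> int, v = \sum_(a | T a) vtensor a *~ z a) ->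
  Kiso (fun x : K A => gamma (Kincl AB x)) S.
Proof.
move=> hA hT gen S0 SB St Sz; split.
- by move=> x y; rewrite KinclD gammaD.
- move=> x y /gamma_chi h; apply: (chi_inj natr_inj hA hT) => // b.
  (* An inclusion of categories keeps the modules of a word, hence its multiplicities; freeness is
     then applied inside [K A]. *)
  have := h b; elim/Kof_ind: x {h} => s; elim/Kof_ind: y => t.
  rewrite !Kincl_of !(chi_of O_n_hss_fdw) !(chi_of hA) /chi_word !big_map //.
have SN v : S v -> S (- v) by move=> hv; rewrite -sub0r; apply: SB.
move=> v; split=> [/Sz [z ->]|[x <-]]; last first.
  elim: (gen x) => [|a h Ta|y w _ h1 _ h2|y _ h].
  - by rewrite Kincl0 gamma0.
  - by rewrite Kincl_cls gamma_cls; apply: St.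
  - by rewrite KinclD gammaD -[gamma (Kincl AB w)]opprK; apply: SB => //; apply: SN.
  - by rewrite KinclN gammaN; apply: SN.
pose im u := exists x, gamma (Kincl AB x) = u.
have im0 : im 0 by exists (Kzero A); rewrite Kincl0 gamma0.
have imD u w : im u -> im w -> im (u + w).
  by move=> [x <-] [y <-]; exists (Kadd x y); rewrite KinclD gammaD.
have imN u : im u -> im (- u) by move=> [x <-]; exists (Kopp x); rewrite KinclN gammaN.
apply: (big_ind im) => // a Ta.
have ima : im (vtensor a) by exists (Kcls (hT a Ta)); rewrite Kincl_cls gamma_cls.
have imn k : im (vtensor a *+ k).
  by elim: k => [|k IH] //; rewrite mulrS; apply: imD.
by case: (z a) => k; [exact: imn | apply: imN; exact: imn].
Qed.

Lemma ZVsp_class0 c : ZVsp_class c (0 : Vspn C n).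
Proof. by exists (fun=> 0); rewrite big1 // => a _; rewrite mulr0z. Qed.

Lemma ZVsp_classB c (v w : Vspn C n) :
  ZVsp_class c v -> ZVsp_class c w -> ZVsp_class c (v - w).
Proof.
move=> [z ->] [z' ->]; exists (fun a => z a - z' a); rewrite -sumrB.
by apply: eq_bigr => a _; rewrite mulrzBr.
Qed.

Lemma ZVsp_class_vtensor c a : class_content c a -> ZVsp_class c (vtensor a).
Proof.
move=> ha; exists (fun b => (b == a)%:R); rewrite (bigD1 a) //= eqxx big1 ?addr0 //.
by move=> b /andP [_ /negbTE ->].
Qed.

Lemma Kincl_id (A : glmod C n -> Prop) (x : K A) : Kincl (fun M (h : A M) => h) x = x.
Proof.
elim/Kof_ind: x => s; rewrite Kincl_of; congr Kof; rewrite /Kword_incl.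
rewrite -[RHS]map_id; apply: eq_map => -[b [M h]] /=; congr pair; exact: eq_exist.
Qed.

Lemma gamma_iso : Kiso gamma (@ZVsp C n).
Proof.
have -> : gamma = (fun x => gamma (Kincl (fun M (h : O_n M) => h) x)).
  by apply/funext => x; rewrite Kincl_id.
apply: (@Kiso_generated _ predT).
- exact: O_n_hss_fdw.
- by move=> a _; apply: vermaM_O_n.
- exact: O_n_gen.
- exists (fun=> 0) => [c|]; [exact: ZVsp_class0 | by rewrite big1].
- move=> v w [x hx ->] [y hy ->]; exists (fun c => x c - y c) => [c|].
    exact: ZVsp_classB.
  by rewrite sumrB.
- move=> a _; have [c hc] := class_exists a.
  exists (fun c' => if c' == c then vtensor a else 0) => [c'|].
    by case: eqP => [->|_]; [apply: ZVsp_class_vtensor | apply: ZVsp_class0].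
  by rewrite -big_mkcond big_pred1_eq.
- move=> v [x hx ->]; have /choice [z hz] c : exists z : idx -> int,
      x c = \sum_(a | class_content c a) vtensor a *~ z a by apply: hx.
  exists (fun a => \sum_(c | class_content c a) z c a).
  under eq_bigr => c _ do rewrite hz big_mkcond.
  rewrite exchange_big /=; apply: eq_bigr => a _; by rewrite -big_mkcond mulrz_sumr.
Qed.

Lemma gamma_class_iso c :
  Kiso (fun x : K (@O_class C n c) => gamma (Kincl (@O_class_sub C n c) x))
       (@ZVsp_class C n c).
Proof.
apply: (@Kiso_generated _ (class_content c)).
- exact: O_class_hss_fdw.
- exact: vermaM_O_class.
- exact: O_class_gen.
- exact: ZVsp_class0.
- exact: ZVsp_classB.
- exact: ZVsp_class_vtensor.
- by [].
Qed.

End Gamma.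

Theorem theorem3p1 (R : realType) (n : nat) (hn : (0 < n)%N) :
  exists gamma : K (@O_n R[i] n) -> Vspn R[i] n,
    [/\ Kiso gamma (@ZVsp R[i] n),
        forall a : {ffun 'I_n -> 'I_8},
          exists h : O_n (vermaM R[i] a),
            gamma (Kcls h) = tensor (fun m : 'I_n => vsp R[i] (a m))
      & forall c : Dtilde n,
          Kiso (fun x : K (@O_class R[i] n c) => gamma (Kincl (@O_class_sub R[i] n c) x))
               (@ZVsp_class R[i] n c)].
Proof.
have natr_inj : injective (fun k : nat => k%:R : R[i]).
  exact: (mulrIn (oner_neq0 R[i])).
exists (@gamma R[i] n natr_inj); split.
- exact: gamma_iso.
- move=> a; exists (vermaM_O_n natr_inj a); exact: gamma_cls.
- exact: gamma_class_iso.
Qed.
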